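(* For all $\mu_1,\mu_2\in M_+(\mathbb T)$, the Dirichlet-type space $\mathcal D(\mu_1,\mu_2)$ has the division property: for each $j\in\{1,2\}$, whenever $\lambda=(\lambda_1,\lambda_2)\in\mathbb D^2$ and $f\in\mathcal D(\mu_1,\mu_2)$ vanishes on $\{z\in\mathbb D^2:z_j=\lambda_j\}$, the function $z\mapsto f(z)/(z_j-\lambda_j)$ (extended holomorphically across $\{z_j=\lambda_j\}$) belongs to $\mathcal D(\mu_1,\mu_2)$.
   Context: $\mathbb D=\{z\in\mathbb C:|z|<1\}$, $\mathbb T$ is the unit circle, $\mathbb D^2$ the unit bidisc and $\mathcal O(\mathbb D^2)$ the space of holomorphic functions on $\mathbb D^2$. $M_+(\mathbb T)$ denotes the set of finite positive Borel measures on $\mathbb T$. Integrals $\int_{\mathbb T}\cdots d\theta$ are over $\theta\in[0,2\pi]$ with respect to normalized Lebesgue measure $d\theta/2\pi$; $dA$ is normalized area measure on $\mathbb D$. For $\mu\in M_+(\mathbb T)$, $P_\mu(w)=\int_{\mathbb T}\frac{1-|w|^2}{|w-\zeta|^2}\,d\mu(\zeta)$. The Hardy space $H^2(\mathbb D^2)$ is the space of $f=\sum_{m,n\ge0}a_{m,n}z_1^mz_2^n\in\mathcal O(\mathbb D^2)$ with $\|f\|^2_{H^2(\mathbb D^2)}=\sum|a_{m,n}|^2<\infty$. For $f\in\mathcal O(\mathbb D^2)$, $$D_{\mu_1,\mu_2}(f)=\sup_{0<r<1}\int_{\mathbb T}\int_{\mathbb D}|\partial_1f(z_1,re^{i\theta})|^2P_{\mu_1}(z_1)\,dA(z_1)\,d\theta+\sup_{0<r<1}\int_{\mathbb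 T}\int_{\mathbb D}|\partial_2f(re^{i\theta},z_2)|^2P_{\mu_2}(z_2)\,dA(z_2)\,d\theta.$$ If $\mu_1=0$ or $\mu_2=0$, $\mathcal D(\mu_1,\mu_2)=\{f\in H^2(\mathbb D^2):D_{\mu_1,\mu_2}(f)<\infty\}$; otherwise $\mathcal D(\mu_1,\mu_2)=\{f\in\mathcal O(\mathbb D^2):D_{\mu_1,\mu_2}(f)<\infty\}$. *)

(* Defs.v *)
(* MathComp + MathComp-Analysis (R : realType), complex numbers from
   mathcomp-real-closed ('R[i]'), viewed through the regular normed-module
   structure '(R[i])^o' so that 'D_1 is the complex derivative. *)
From mathcomp Require Import all_boot all_order all_algebra.
From mathcomp Require Import all_classical all_reals all_analysis.
From mathcomp Require Import complex.
Import Order.TTheory GRing.Theory Num.Theory.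
Import numFieldNormedType.Exports.

Set Implicit Arguments.
Unset Strict Implicit.
Unset Printing Implicit Defensive.

Local Open Scope classical_set_scope.
Local Open Scope ring_scope.

Notation CC R := ((R[i])^o).

Definition cmod (R : realType) (z : CC R) : R := Normc.normc (z : R[i]).

Definition inD (R : realType) (z : CC R) : Prop := cmod z < 1.
Definition inD2 (R : realType) (z : CC R * CC R) : Prop := inD z.1 /\ inD z.2.

Definition zcoord (R : realType) (j : 'I_2) (z : CC R * CC R) : CC R :=
  if val j == 0%N then z.1 else z.2.

Definition rexpi (R : realType) (r t : R) : CC R :=
  Complex (r * cos t) (r * sin t).

(* A finite positive Borel measure on T, encoded (via t |-> e^{it}) as a
   finite positive Borel measure on R carried by [0, 2 pi[. *)
Definition measure_on_T (R : realType) (mu : {measure set R -> \bar R}) : Prop :=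
  (mu setT < +oo)%E /\ mu (~` `[0, pi *+ 2[%classic) = 0%E.

Definition poisson (R : realType) (mu : {measure set R -> \bar R}) (w : CC R)
  : \bar R :=
  (\int[mu]_(t in `[0%R, (pi *+ 2 : R)%R[%classic)
     ((1 - cmod w ^+ 2) / cmod (w - rexpi 1 t) ^+ 2)%:E)%E.

Definition holomorphic2 (R : realType) (f : CC R * CC R -> CC R) : Prop :=
  forall z, inD2 z ->
    [/\ {for z, continuous f},
        derivable (fun w => f (w, z.2)) z.1 1
      & derivable (fun w => f (z.1, w)) z.2 1].

Definition d1 (R : realType) (f : CC R * CC R -> CC R) (z : CC R * CC R)
  : CC R := 'D_1 (fun w => f (w, z.2)) z.1.
Definition d2 (R : realType) (f : CC R * CC R -> CC R) (z : CC R * CC R)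
  : CC R := 'D_1 (fun w => f (z.1, w)) z.2.

Definition areaD (R : realType) (g : CC R -> \bar R) : \bar R :=
  ((pi^-1)%:E *
   \int[(@lebesgue_measure R \x @lebesgue_measure R)]_(p in
        [set p : R * R | (p.1 ^+ 2 + p.2 ^+ 2 < 1)%R]) g (Complex p.1 p.2))%E.

Definition circT (R : realType) (h : R -> \bar R) : \bar R :=
  (((pi *+ 2)^-1)%:E * \int[@lebesgue_measure R]_(t in `[0%R, (pi *+ 2 : R)%R]%classic) h t)%E.

Definition dir1 (R : realType) (mu : {measure set R -> \bar R})
  (f : CC R * CC R -> CC R) (r : R) : \bar R :=
  circT (fun t => areaD (fun x =>
     ((cmod (d1 f (x, rexpi r t)) ^+ 2)%:E * poisson mu x)%E)).

Definition dir2 (R : realType) (mu : {measure set R -> \bar R})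
  (f : CC R * CC R -> CC R) (r : R) : \bar R :=
  circT (fun t => areaD (fun x =>
     ((cmod (d2 f (rexpi r t, x)) ^+ 2)%:E * poisson mu x)%E)).

Definition Dint (R : realType) (mu1 mu2 : {measure set R -> \bar R})
  (f : CC R * CC R -> CC R) : \bar R :=
  (ereal_sup [set dir1 mu1 f r | r in `]0%R, 1%R[%classic]
   + ereal_sup [set dir2 mu2 f r | r in `]0%R, 1%R[%classic])%E.

Definition hardy2 (R : realType) (f : CC R * CC R -> CC R) : Prop :=
  exists a : nat -> nat -> CC R,
    (\esum_(p in [set: nat * nat]) ((cmod (a p.1 p.2)) ^+ 2)%:E < +oo)%E /\
    forall z, inD2 z ->
      (fun N : nat => \sum_(m < N) \sum_(n < N) a m n * z.1 ^+ m * z.2 ^+ n)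
        @ \oo --> f z.

Definition in_Dspace (R : realType) (mu1 mu2 : {measure set R -> \bar R})
  (f : CC R * CC R -> CC R) : Prop :=
  [/\ holomorphic2 f,
      (mu1 setT = 0%E \/ mu2 setT = 0%E) -> hardy2 f
    & (Dint mu1 mu2 f < +oo)%E].

(* Main.v *)
(** By the symmetry of the two variables assume j = 1. Cauchy's formula (from a
    Goursat argument on polar rectangles) makes f a double power series on each
    smaller polydisc, and f(z) / (z_1 - lam) has the coefficients
    b_{m,n} = sum_k a_{m+1+k,n} lam^k. So the quotient g is holomorphic, and as
    b_{m,n} = a_{m+1,n} + lam b_{m+1,n} with |lam| < 1, it is in the Hardy space
    if f is.

    On |z_1| = r > |lam| the d_2-integral is harmless: there
    |d_2 g| <= |d_2 f| / (r - |lam|), and smaller radii are dominated by larger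
    ones through the mean value property.

    For the d_1-integral fix z_2 and put k = g(., z_2), h = (z - lam) k. If w is a
    positive harmonic function, Green's formula on the disc of radius r for w and
    (|z|^2 - r^2) |k|^2, which vanishes on the boundary circle and has an outward
    derivative >= 0 there, gives
      r^2 int |k'|^2 w <= int |(z k)'|^2 w.
    As (z k)' = h' + lam k' and |lam| < 1, the term with k' on the right is
    absorbed for r close to 1, so int |k'|^2 w <= c int |h'|^2 w with c depending
    on lam only. Take for w the Poisson kernels, integrate with respect to the
    measure, and let r tend to 1. *)
From HB Require Import structures.
Require Import Defs.
From mathcomp Require Import all_boot all_order all_algebra.
From mathcomp Require Import all_classical all_reals all_analysis.
From mathcomp Require Import measurable_realfun complex.
From mathcomp Require Import ring lra.
Import Order.TTheory GRing.Theory Num.Theory.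
Import numFieldNormedType.Exports.
Set Implicit Arguments.
Unset Strict Implicit.
Unset Printing Implicit Defensive.
Local Open Scope classical_set_scope.
Local Open Scope ring_scope.

(** * The complex modulus, limits, and complex derivatives in epsilon-delta form *)

Section ComplexBasics.
Context {R : realType}.
Implicit Types (z w : CC R).

(** The form F(z) dz / z suits polar coordinates: its sides are plain integrals in r and t, and over
    a full turn the radial sides cancel, so circle means do not depend on the radius. Cauchy's
    formula becomes the vanishing of one such mean, and the double series carry all regularity:
    partial derivatives are again holomorphic, and measurability comes from polynomial
    approximation.

    The obstacle in the d_1-integral is that (z - lam) k' = h' - k leaves k itself to be estimated.
    Passing to (z k)' = h' + lam k' removes the undifferentiated k, and Green's inequality compares
    k' with (z k)' with a factor that tends to 1 as r does, so any |lam| < 1 can be absorbed.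

    The Poisson integral of a measure may be unbounded near the circle. Hence Green's inequality is
    proved for one kernel at a time on a closed disc of radius r < 1, where all functions involved
    are bounded. No boundary integral is computed: slicing the disc, only the sign of the flux at
    the end points of horizontal and vertical chords matters. *)

Lemma cmod0 : cmod (0 : CC R) = 0. Proof. exact: Normc.normc0. Qed.
Lemma cmod1 : cmod (1 : CC R) = 1. Proof. exact: Normc.normc1. Qed.
Lemma cmodM z w : cmod (z * w) = cmod z * cmod w. Proof. exact: Normc.normcM. Qed.
Lemma cmodV z : cmod z^-1 = (cmod z)^-1. Proof. exact: Normc.normcV. Qed.
Lemma cmodN z : cmod (- z) = cmod z. Proof. exact: normcN. Qed.
Lemma ler_cmodD z w : cmod (z + w) <= cmod z + cmod w.
Proof. exact: le_normcD. Qed.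
Lemma cmod_ge0 z : 0 <= cmod z.
Proof. by case: z => a b; rewrite /cmod /= sqrtr_ge0. Qed.
Lemma cmod_eq0 z : (cmod z == 0) = (z == 0).
Proof. by apply/eqP/eqP => [/Normc.eq0_normc //|->]; exact: cmod0. Qed.
Lemma cmod_gt0 z : (0 < cmod z) = (z != 0).
Proof. by rewrite lt0r cmod_ge0 andbT cmod_eq0. Qed.
Lemma cmodX z n : cmod (z ^+ n) = cmod z ^+ n.
Proof. by elim: n => [|n ih]; rewrite ?cmod1 // !exprS cmodM ih. Qed.
Lemma ler_cmodB z w : cmod (z - w) <= cmod z + cmod w.
Proof. by rewrite -(cmodN w) ler_cmodD. Qed.
Lemma cmodBC z w : cmod (z - w) = cmod (w - z).
Proof. by rewrite -cmodN opprB. Qed.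
Lemma lerB_cmod z w : cmod z - cmod w <= cmod (z - w).
Proof. by rewrite lerBlDr -{1}(subrK w z) ler_cmodD. Qed.
Lemma ler_cmod_sum (I : Type) (s : seq I) (P : pred I) (F : I -> CC R) :
  cmod (\sum_(i <- s | P i) F i) <= \sum_(i <- s | P i) cmod (F i).
Proof.
elim/big_rec2: _ => [|i x y _ h]; first by rewrite cmod0.
by rewrite (le_trans (ler_cmodD _ _)) // lerD2l.
Qed.

Lemma sqr_cmod z : cmod z ^+ 2 = complex.Re z ^+ 2 + complex.Im z ^+ 2.
Proof. by case: z => a b; rewrite /cmod /= sqr_sqrtr // addr_ge0 ?sqr_ge0. Qed.
Lemma normr_Re_le z : `|complex.Re z| <= cmod z.
Proof.
rewrite -(ler_pXn2r (n:=2)) ?nnegrE ?cmod_ge0 //.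
by rewrite sqr_cmod real_normK ?num_real // lerDl sqr_ge0.
Qed.
Lemma normr_Im_le z : `|complex.Im z| <= cmod z.
Proof.
rewrite -(ler_pXn2r (n:=2)) ?nnegrE ?cmod_ge0 //.
by rewrite sqr_cmod real_normK ?num_real // lerDr sqr_ge0.
Qed.
Lemma cmod_le_ReIm z : cmod z <= `|complex.Re z| + `|complex.Im z|.
Proof.
rewrite -(ler_pXn2r (n:=2)) ?nnegrE ?cmod_ge0 ?addr_ge0 //.
rewrite sqr_cmod sqrrD !real_normK ?num_real //.
by rewrite -addrA lerD2l lerDr mulrn_wge0 // mulr_ge0.
Qed.
Lemma ReD z w : complex.Re (z + w) = complex.Re z + complex.Re w.
Proof. by case: z w => a b [c d]. Qed.
Lemma ImD z w : complex.Im (z + w) = complex.Im z + complex.Im w.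
Proof. by case: z w => a b [c d]. Qed.
Lemma ReN z : complex.Re (- z) = - complex.Re z. Proof. by case: z. Qed.
Lemma ImN z : complex.Im (- z) = - complex.Im z. Proof. by case: z. Qed.
Lemma ReM z w : complex.Re (z * w) =
  complex.Re z * complex.Re w - complex.Im z * complex.Im w.
Proof. by case: z w => a b [c d]. Qed.
Lemma ImM z w : complex.Im (z * w) =
  complex.Re z * complex.Im w + complex.Im z * complex.Re w.
Proof. by case: z w => a b [c d]. Qed.
Lemma CC_eqP z w : complex.Re z = complex.Re w -> complex.Im z = complex.Im w -> z = w.
Proof. by case: z w => a b [c d] /= -> ->. Qed.

Lemma posc (e : R[i]) : 0 < e -> e = (complex.Re e)%:C%C /\ 0 < complex.Re e.
Proof. by case: e => a b; rewrite ltcE /= => /andP[/eqP -> ?]. Qed.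

Lemma cvg_cmodP (T : Type) (F : set_system T) {FF : Filter F} (f : T -> CC R) l :
  f @ F --> l <-> forall e : R, 0 < e -> \forall x \near F, cmod (f x - l) < e.
Proof.
split=> [/cvgrPdist_lt h e e0|h].
  have e0' : (0 : R[i]) < e%:C%C by rewrite ltcR.
  apply: filterS (h _ e0') => x; rewrite distrC.
  by rewrite -[`|_|]/((cmod (f x - l))%:C%C) ltcR.
apply/cvgrPdist_lt => e e0.
have [er /h] := posc e0; apply: filterS => x; rewrite distrC er.
by rewrite -[`|_|]/((cmod (f x - l))%:C%C) ltcR.
Qed.

Lemma ccvg_cst (T : Type) (F : set_system T) {FF : Filter F} (c : CC R) :
  (fun _ : T => c) @ F --> c.
Proof. exact: cvg_cst. Qed.

Lemma ccvgB (T : Type) (F : set_system T) {FF : Filter F} (f g : T -> CC R) (l m : CC R) :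
  f @ F --> l -> g @ F --> m -> (fun x => f x - g x : CC R) @ F --> (l - m : CC R).
Proof. by move=> hf hg; exact: cvgB hf hg. Qed.

Lemma ccvgD (T : Type) (F : set_system T) {FF : Filter F} (f g : T -> CC R) (l m : CC R) :
  f @ F --> l -> g @ F --> m -> (fun x => f x + g x : CC R) @ F --> (l + m : CC R).
Proof. by move=> hf hg; exact: cvgD hf hg. Qed.

Lemma ccvgM (T : Type) (F : set_system T) {FF : Filter F} (f g : T -> CC R) (l m : CC R) :
  f @ F --> l -> g @ F --> m -> (fun x => f x * g x : CC R) @ F --> (l * m : CC R).
Proof. by move=> hf hg; exact: cvgM hf hg. Qed.

Lemma ccvgZ (T : Type) (F : set_system T) {FF : Filter F} (c : CC R) (g : T -> CC R) (m : CC R) :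
  g @ F --> m -> (fun x => c * g x : CC R) @ F --> (c * m : CC R).
Proof. by move=> hg; exact: (ccvgM (ccvg_cst (c := c)) hg). Qed.

Lemma ccvg_unique (T : Type) (F : set_system T) {FF : ProperFilter F} (f : T -> CC R) (l m : CC R) :
  f @ F --> l -> f @ F --> m -> l = m.
Proof. by move=> h1 h2; apply: (cvg_unique _ h1 h2). Qed.

Lemma ccvg_limn (u : nat -> CC R) (l : CC R) : u @ \oo --> l -> limn u = l.
Proof. by move=> h; apply: (cvg_lim _ h). Qed.

Lemma nbhs_cmodP z (P : set (CC R)) :
  nbhs z P <-> exists2 d : R, 0 < d & forall w, cmod (w - z) < d -> P w.
Proof.
split=> [[e /= e0 h]|[d d0 h]].
  have [er e0'] := posc e0; exists (complex.Re e) => //.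
  move=> w hw; apply: h; rewrite /ball_ /= distrC er.
  by rewrite -[`|_|]/((cmod (w - z))%:C%C) ltcR.
exists d%:C%C; rewrite /= ?ltcR // => w; rewrite /ball_ /= distrC.
by rewrite -[`|_|]/((cmod (w - z))%:C%C) ltcR; exact: h.
Qed.

(** The derivative in little-o form: without a quotient, the point [w = z] need not be excluded. *)
Definition cderiv (f : CC R -> CC R) z c : Prop :=
  forall e : R, 0 < e -> exists2 d : R, 0 < d &
   forall w, cmod (w - z) < d -> cmod (f w - f z - c * (w - z)) <= e * cmod (w - z).

Lemma dnbhs_cmodP z (P : set (CC R)) :
  dnbhs z P <-> exists2 d : R, 0 < d & forall w, w != z -> cmod (w - z) < d -> P w.
Proof.
rewrite /dnbhs /within /=; split.
  by move=> /nbhs_cmodP[d d0 h]; exists d => // w wz wd; apply: h.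
by move=> [d d0 h]; apply/nbhs_cmodP; exists d => // w wd wz; apply: h.
Qed.

Lemma cderivP f z c :
  cderiv f z c <-> (fun h : CC R => h^-1 *: ((f \o shift z) (h *: 1) - f z)) @ 0^' --> c.
Proof.
split=> [h|h].
  apply/cvg_cmodP => e e0.
  have e20 : 0 < e / 2 by rewrite divr_gt0.
  have [d d0 hd] := h _ e20.
  apply/dnbhs_cmodP; exists d => // w w0; rewrite subr0 => wd.
  have := hd (w + z); rewrite addrK => /(_ wd) hw.
  have e1 : w *: (1 : CC R) = w by exact: mulr1.
  rewrite /= e1 -[_ *: _]/(w^-1 * _).
  have -> : w^-1 * (f (w + z) - f z) - c = w^-1 * (f (w + z) - f z - c * w).
    by field.
  rewrite cmodM cmodV mulrC ltr_pdivrMr ?cmod_gt0 //.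
  by rewrite (le_lt_trans hw) // ltr_pM2r ?cmod_gt0 // ltr_pdivrMr // ltr_pMr // ltr1n.
move=> e e0; have /cvg_cmodP/(_ _ e0)/dnbhs_cmodP[d d0 hd] := h.
exists d => // w wd; have [->|wz] := eqVneq w z.
  by rewrite !subrr mulr0 subrr cmod0 mulr0.
have wz0 : w - z != 0 by rewrite subr_eq0.
have := hd (w - z) wz0; rewrite subr0 => /(_ wd).
have e1 : (w - z) *: (1 : CC R) = w - z by exact: mulr1.
rewrite /= e1 subrK -[_ *: _]/((w - z)^-1 * _).
have -> : (w - z)^-1 * (f w - f z) - c = (w - z)^-1 * (f w - f z - c * (w - z)).
  by field.
by rewrite cmodM cmodV mulrC ltr_pdivrMr ?cmod_gt0 // => /ltW.
Qed.

Lemma cderiv_derivable f z c : cderiv f z c -> derivable f z 1.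
Proof. by move=> /cderivP h; apply/cvg_ex; exists c. Qed.
Lemma cderiv_derive f z c : cderiv f z c -> 'D_1 f z = c.
Proof. by move=> /cderivP h; apply/cvg_lim. Qed.
Lemma derivable_cderiv f z : derivable f z 1 -> cderiv f z ('D_1 f z).
Proof. by move=> h; apply/cderivP. Qed.

Lemma cderiv_ext f g z c (d : R) : 0 < d ->
  (forall w, cmod (w - z) < d -> f w = g w) -> cderiv f z c -> cderiv g z c.
Proof.
move=> d0 fg h e e0; have [d' d'0 hd] := h _ e0.
exists (Num.min d d'); first by rewrite lt_min d0.
move=> w; rewrite lt_min => /andP[wd wd'].
by rewrite -!fg ?subrr ?cmod0 //; apply: hd.
Qed.

Lemma is_cderiv (f : CC R -> CC R) z c : is_derive z 1 f c -> cderiv f z c.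
Proof. by case=> h <-; exact: derivable_cderiv. Qed.

Lemma cderiv_is (f : CC R -> CC R) z c : cderiv f z c -> is_derive z 1 f c.
Proof.
by move=> h; apply: DeriveDef; [exact: cderiv_derivable h|exact: cderiv_derive].
Qed.

Lemma cderivM (f g : CC R -> CC R) z c c' : cderiv f z c -> cderiv g z c' ->
  cderiv (fun w => f w * g w) z (f z * c' + g z * c).
Proof. by move=> /cderiv_is h /cderiv_is h'; apply: is_cderiv; exact: is_deriveM. Qed.

Lemma cderivD (f g : CC R -> CC R) z c c' : cderiv f z c -> cderiv g z c' ->
  cderiv (fun w => f w + g w) z (c + c').
Proof. by move=> /cderiv_is h /cderiv_is h'; apply: is_cderiv; exact: is_deriveD. Qed.

Lemma cderiv_cst z c : cderiv (fun=> c) z 0.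
Proof.
move=> e e0; exists 1 => // w _.
by rewrite subrr mul0r subr0 cmod0 mulr_ge0 ?cmod_ge0 // ltW.
Qed.

Lemma cderiv_subc z c : cderiv (fun w => w - c) z 1.
Proof.
move=> e e0; exists 1 => // w _.
have -> : w - c - (z - c) - 1 * (w - z) = 0 by ring.
by rewrite cmod0 mulr_ge0 ?cmod_ge0 // ltW.
Qed.

Lemma cderiv_unique f z c c' : cderiv f z c -> cderiv f z c' -> c = c'.
Proof. by move=> /cderiv_derive <- /cderiv_derive. Qed.

Definition ccont (f : CC R -> CC R) z : Prop :=
  forall e : R, 0 < e -> exists2 d : R, 0 < d &
   forall w, cmod (w - z) < d -> cmod (f w - f z) <= e.

(** Caratheodory's criterion: a continuous slope function yields the derivative. Division of power
    series produces exactly such slopes. *)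
Lemma cderiv_slope f z (g : CC R -> CC R) (d : R) : 0 < d ->
  (forall w, cmod (w - z) < d -> f w - f z = (w - z) * g w) -> ccont g z ->
  cderiv f z (g z).
Proof.
move=> d0 fg gc e e0; have [d' d'0 hd] := gc _ e0.
exists (Num.min d d'); first by rewrite lt_min d0.
move=> w; rewrite lt_min => /andP[wd wd'].
rewrite fg // (mulrC (g z)) -mulrBr cmodM mulrC ler_wpM2r ?cmod_ge0 //.
exact: hd.
Qed.

Lemma cderivV z c : z != c -> cderiv (fun w => (w - c)^-1) z (- (z - c) ^- 2).
Proof.
rewrite -subr_eq0 => zc; set rho := cmod (z - c).
have rho0 : 0 < rho by rewrite cmod_gt0.
have wc w : cmod (w - z) < rho -> w - c != 0.
  apply: contraTneq => wc0; rewrite -leNgt /rho.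
  have -> : w - z = (w - c) - (z - c) by ring.
  by rewrite wc0 sub0r cmodN.
pose g w := - ((w - c)^-1 * (z - c)^-1).
have -> : - (z - c) ^- 2 = g z by rewrite /g -invfM expr2.
apply: (cderiv_slope (g := g) rho0) => [w /wc w0|e e0].
  by rewrite /g; field; rewrite ?zc ?w0.
(* The first radius keeps [cmod (w - c)] above [rho / 2]; the second then makes [cmod (w - z)] at
   most [e] times the denominators. *)
exists (Num.min (rho / 2) (e * rho ^+ 3 / 2)).
  rewrite lt_min; apply/andP; split; rewrite divr_gt0 ?ltr0n //.
  by rewrite mulr_gt0 // exprn_gt0.
move=> w; rewrite lt_min /g => /andP[w1 w2].
have w0 : w - c != 0 by apply: wc; lra.
have -> : - ((w - c)^-1 * (z - c)^-1) - - ((z - c)^-1 * (z - c)^-1) =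
   (w - z) / (w - c) / (z - c) ^+ 2 by field; rewrite ?zc ?w0.
have w3 : rho / 2 <= cmod (w - c).
  have := lerB_cmod (z - c) (z - w).
  have -> : z - c - (z - w) = w - c by ring.
  by rewrite (cmodBC z w) -/rho; lra.
rewrite !cmodM !cmodV cmodX -/rho ler_pdivrMr ?exprn_gt0 //.
rewrite ler_pdivrMr ?cmod_gt0 //.
apply: (le_trans (ltW w2)).
have -> : e * rho ^+ 3 / 2 = e * rho ^+ 2 * (rho / 2) by rewrite (exprS _ 2); ring.
by rewrite ler_wpM2l // mulr_ge0 ?exprn_ge0 ?ltW.
Qed.

Lemma cderiv_ccont f z c : cderiv f z c -> ccont f z.
Proof.
move=> h e e0; have [d d0 hd] := h _ ltr01.
have K0 : 0 < 1 + cmod c by rewrite ltr_pwDl // cmod_ge0.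
exists (Num.min d (e / (1 + cmod c))); first by rewrite lt_min d0 divr_gt0.
move=> w; rewrite lt_min => /andP[wd].
rewrite ltr_pdivlMr // => we; have := hd _ wd; rewrite mul1r => h1.
rewrite -(subrK (c * (w - z)) (f w - f z)).
rewrite (le_trans (ler_cmodD _ _)) // (le_trans _ (ltW we)) //.
by rewrite [leRHS]mulrDr mulr1 lerD // cmodM mulrC.
Qed.

End ComplexBasics.

(** * Double power series with geometrically bounded coefficients, and division of such series *)

Section ComplexSeries.
Context {R : realType}.
Implicit Types (p : CC R).

Lemma cvg_cmod_le (T : Type) (F : set_system T) {FF : ProperFilter F}
  (f : T -> CC R) l B :
  f @ F --> l -> (\forall x \near F, cmod (f x) <= B) -> cmod l <= B.
Proof.
move=> /cvg_cmodP h hB; apply/ler_addgt0Pr => e e0.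
have [x [xe xB]] := filter_ex (filterI (h _ e0) hB).
rewrite -(subrK (f x) l) (le_trans (ler_cmodD _ _)) // addrC lerD //.
by rewrite cmodBC ltW.
Qed.

Lemma ccvg_shiftS (u : nat -> CC R) (l : CC R) :
  u @ \oo --> l -> (fun n => u n.+1) @ \oo --> l.
Proof. by rewrite -cvg_shiftS => h; exact: h. Qed.

Lemma cvg_ReIm (u : nat -> CC R) (a b : R) :
  (fun n => complex.Re (u n)) @ \oo --> a ->
  (fun n => complex.Im (u n)) @ \oo --> b -> u @ \oo --> (Complex a b : CC R).
Proof.
move=> /cvgrPdist_lt ha /cvgrPdist_lt hb; apply/cvg_cmodP => e e0.
have e2 : 0 < e / 2 by rewrite divr_gt0.
near=> n; rewrite cmodBC (le_lt_trans (cmod_le_ReIm _)) //.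
rewrite (splitr e) ltrD // !(ReD, ImD, ReN, ImN) /=.
  by near: n; exact: ha.
by near: n; exact: hb.
Unshelve. all: by end_near. Qed.

Lemma le_increments (V : nat -> CC R) (v : nat -> R) :
  (forall n, cmod (V n.+1 - V n) <= v n.+1 - v n) ->
  forall n m, (n <= m)%N -> cmod (V m - V n) <= v m - v n.
Proof.
move=> h n m /subnKC <-; elim: (m - n)%N => [|k ih].
  by rewrite addn0 !subrr cmod0.
rewrite addnS; have -> : V (n + k).+1 - V n = (V (n + k).+1 - V (n + k)%N) + (V (n + k)%N - V n).
  by rewrite addrA subrK.
by have := ler_cmodD (V (n + k).+1 - V (n + k)%N) (V (n + k)%N - V n);
  have := h (n + k)%N; lra.
Qed.

(** Completeness comes from monotone real sequences: for a 1-Lipschitz real [g], both [v] and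
    [v - g \o u] are nondecreasing and bounded, hence [g \o u] converges. This is applied to the
    real and imaginary parts. *)
Lemma cseq_cvg (u : nat -> CC R) (v : nat -> R) B :
  (forall n, cmod (u n.+1 - u n) <= v n.+1 - v n) -> (forall n, v n <= B) ->
  exists l, u @ \oo --> l /\ forall n, cmod (l - u n) <= B - v n.
Proof.
move=> uv vB.
have uvm := le_increments uv.
have vnd : nondecreasing_seq v.
  by move=> n m nm; rewrite -subr_ge0 (le_trans _ (uvm _ _ nm)) ?cmod_ge0.
have vc : cvgn v.
  by apply: nondecreasing_is_cvgn => //; exists B => _ [n _ <-].
have key (g : CC R -> R) : (forall z w, `|g z - g w| <= cmod (z - w)) ->
    cvgn (g \o u).
  move=> gl; have -> : g \o u = (v \- (v \- (g \o u))).
    by apply/funext => n /=; rewrite opprB addrC subrK.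
  apply: is_cvgB => //; apply: nondecreasing_is_cvgn.
    move=> n m nm /=; have := le_trans (gl (u m) (u n)) (uvm _ _ nm).
    by rewrite ler_norml => /andP[_]; lra.
  exists (B + `|g (u 0%N)| + (B - v 0%N)) => _ [n _ <-] /=.
  have := le_trans (gl (u n) (u 0%N)) (uvm _ _ (leq0n n)).
  rewrite ler_norml => /andP[+ _]; have := vB n; have := ler_norm (g (u 0%N)).
  have := ler_norm (- g (u 0%N)); rewrite normrN; lra.
have /cvg_ex[a ha] : cvgn (@complex.Re R \o u).
  by apply: key => z w; rewrite -ReN -ReD normr_Re_le.
have /cvg_ex[b hb] : cvgn (@complex.Im R \o u).
  by apply: key => z w; rewrite -ImN -ImD normr_Im_le.
exists (Complex a b).
have ul := cvg_ReIm ha hb; split => // n.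
apply: (@cvg_cmod_le _ \oo _ (fun m => u m - u n)).
  exact: (ccvgB ul (ccvg_cst (c := u n))).
near=> m; have nm : (n <= m)%N by near: m; exists n.
by rewrite (le_trans (uvm _ _ nm)) // lerD2r.
Unshelve. all: by end_near. Qed.

Definition geosum (q : R) N := \sum_(k < N) q ^+ k.

Lemma geosumS q N : geosum q N.+1 = geosum q N + q ^+ N.
Proof. by rewrite /geosum big_ord_recr. Qed.

Lemma geosum_ge0 q N : 0 <= q -> 0 <= geosum q N.
Proof. by move=> q0; apply: sumr_ge0 => i _; rewrite exprn_ge0. Qed.

Lemma geosum_le q N : 0 <= q -> q < 1 -> geosum q N <= (1 - q)^-1.
Proof.
move=> q0 q1; have h : (1 - q) * geosum q N = 1 - q ^+ N.
  by have := subrX1 q N; rewrite -/(geosum q N); lra.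
rewrite -[leRHS]mul1r ler_pdivlMr ?subr_gt0 // mulrC h.
by rewrite gerBl exprn_ge0.
Qed.

Lemma cseries_geo (u : nat -> CC R) K q : 0 <= q -> q < 1 ->
  (forall k, cmod (u k) <= K * q ^+ k) ->
  exists l, (fun N => \sum_(k < N) u k) @ \oo --> l /\
    cmod l <= K / (1 - q).
Proof.
move=> q0 q1 uK.
have K0 : 0 <= K.
  by have := uK 0%N; rewrite mulr1; apply: le_trans; rewrite cmod_ge0.
have [||l [ul lb]] := @cseq_cvg (fun N => \sum_(k < N) u k)
   (fun N => K * geosum q N) (K / (1 - q)).
- move=> n; rewrite big_ord_recr /= addrAC subrr add0r.
  by rewrite -mulrBr geosumS addrAC subrr add0r.
- by move=> n; rewrite ler_wpM2l // geosum_le.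
exists l; split => //; have := lb 0%N.
by rewrite /geosum !big_ord0 mulr0 !subr0.
Qed.

Definition psum (a : nat -> nat -> CC R) (z : CC R * CC R) (N : nat) : CC R :=
  \sum_(m < N) \sum_(n < N) a m n * z.1 ^+ m * z.2 ^+ n.

Definition psfun a z : CC R := limn (psum a z).

Definition bddc (r M : R) (a : nat -> nat -> CC R) : Prop :=
  forall m n, cmod (a m n) * r ^+ (m + n) <= M.

Lemma bddc_ge0 r M a : bddc r M a -> 0 <= M.
Proof.
by move=> /(_ 0%N 0%N); rewrite mulr1; apply: le_trans; rewrite cmod_ge0.
Qed.

Lemma bddc_term r M a z s : 0 < r -> bddc r M a ->
  cmod z.1 <= s -> cmod z.2 <= s -> forall m n,
  cmod (a m n * z.1 ^+ m * z.2 ^+ n) <= M * ((s / r) ^+ m * (s / r) ^+ n).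
Proof.
move=> r0 ha z1 z2 m n; have s0 : 0 <= s by rewrite (le_trans _ z1) ?cmod_ge0.
have -> : M * ((s / r) ^+ m * (s / r) ^+ n) = M / r ^+ (m + n) * (s ^+ m * s ^+ n).
  by rewrite !expr_div_n exprD; field; rewrite !expf_neq0 ?gt_eqF.
rewrite -mulrA !cmodM !cmodX ler_pM ?mulr_ge0 ?exprn_ge0 ?cmod_ge0 //.
  by rewrite ler_pdivlMr ?exprn_gt0.
by rewrite ler_pM ?exprn_ge0 ?cmod_ge0 // lerXn2r ?nnegrE ?cmod_ge0.
Qed.

Lemma psumS a z N : psum a z N.+1 = psum a z N +
  (\sum_(m < N) a m N * z.1 ^+ m * z.2 ^+ N +
   \sum_(n < N.+1) a N n * z.1 ^+ N * z.2 ^+ n).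
Proof.
rewrite /psum big_ord_recr /= addrA; congr (_ + _).
by rewrite -big_split; apply: eq_bigr => m _; rewrite big_ord_recr.
Qed.

(** The square partial sums are majorised by [M * geosum q N ^+ 2] with [q = s / r]: passing from
    [N] to [N.+1] adds an L-shaped border of terms on both sides. *)
Lemma psum_cvg r M a z s : 0 < r -> bddc r M a ->
  cmod z.1 <= s -> cmod z.2 <= s -> s < r ->
  psum a z @ \oo --> psfun a z /\ cmod (psfun a z) <= M / (1 - s / r) ^+ 2.
Proof.
move=> r0 ha z1 z2 sr; have M0 := bddc_ge0 ha.
have s0 : 0 <= s by rewrite (le_trans _ z1) ?cmod_ge0.
pose q := s / r; have q0 : 0 <= q by rewrite divr_ge0 // ltW.
have q1 : q < 1 by rewrite ltr_pdivrMr // mul1r.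
suff [l [lu lb]] : exists l, psum a z @ \oo --> l /\ cmod l <= M / (1 - q) ^+ 2.
  by rewrite /psfun (ccvg_limn lu).
have [||l [ul lb]] := @cseq_cvg (psum a z)
   (fun N => M * geosum q N ^+ 2) (M / (1 - q) ^+ 2).
- move=> n; rewrite psumS addrAC subrr add0r.
  have -> : M * geosum q n.+1 ^+ 2 - M * geosum q n ^+ 2 =
     \sum_(m < n) M * (q ^+ m * q ^+ n) + \sum_(m < n.+1) M * (q ^+ n * q ^+ m).
    rewrite -!mulr_sumr -mulr_suml -/(geosum q n) -/(geosum q n.+1) geosumS; ring.
  rewrite (le_trans (ler_cmodD _ _)) // lerD //;
    rewrite (le_trans (ler_cmod_sum _ _ _)) // ler_sum // => i _;
    exact: bddc_term.
- move=> n; rewrite -exprVn ler_wpM2l // lerXn2r ?nnegrE ?geosum_ge0 //.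
    by rewrite invr_ge0 subr_ge0 ltW.
  exact: geosum_le.
exists l; split => //; have := lb 0%N.
by rewrite /geosum /psum !big_ord0 expr0n mulr0 !subr0.
Qed.

Lemma psum_tr a z : psum (fun m n => a n m) z = psum a (z.2, z.1).
Proof.
apply/funext => N; rewrite /psum exchange_big /=.
by apply: eq_bigr => m _; apply: eq_bigr => n _; rewrite mulrAC.
Qed.

Lemma bddc_tr r M a : bddc r M a -> bddc r M (fun m n => a n m).
Proof. by move=> h m n; rewrite addnC. Qed.

(* The coefficients of (psfun a z - psfun a (p, z.2)) / (z.1 - p). *)
Definition divc p (a : nat -> nat -> CC R) m n : CC R :=
  limn (fun N => \sum_(k < N) a (m.+1 + k)%N n * p ^+ k).

Lemma divc_cvg r M a p m n : 0 < r -> bddc r M a -> cmod p < r ->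
  (fun N => \sum_(k < N) a (m.+1 + k)%N n * p ^+ k) @ \oo --> divc p a m n /\
  cmod (divc p a m n) * r ^+ (m + n) <= M / (r - cmod p).
Proof.
move=> r0 ha pr; have M0 := bddc_ge0 ha; have p0 := cmod_ge0 p.
have rp0 : 0 < r - cmod p by rewrite subr_gt0.
have [|||l [ul lb]] := @cseries_geo (fun k => a (m.+1 + k)%N n * p ^+ k)
   (M / r ^+ (m.+1 + n)) (cmod p / r).
- by rewrite divr_ge0 // ltW.
- by rewrite ltr_pdivrMr // mul1r.
- move=> k; rewrite cmodM cmodX.
  have -> : M / r ^+ (m.+1 + n) * (cmod p / r) ^+ k =
      M / r ^+ (m.+1 + k + n) * cmod p ^+ k.
    rewrite expr_div_n !exprD; field.
    by rewrite !expf_neq0 ?gt_eqF.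
  rewrite ler_wpM2r ?exprn_ge0 // ler_pdivlMr ?exprn_gt0 //.
have lE : divc p a m n = l by exact: ccvg_limn ul.
rewrite lE; split => //; rewrite -ler_pdivlMr ?exprn_gt0 //.
apply: (le_trans lb); rewrite le_eqVlt; apply/orP; left; apply/eqP.
rewrite addSn exprS; field.
by rewrite expf_neq0 ?gt_eqF.
Qed.

Lemma divcS r M a p m n : 0 < r -> bddc r M a -> cmod p < r ->
  divc p a m n = a m.+1 n + p * divc p a m.+1 n.
Proof.
move=> r0 ha pr.
have [h1 _] := divc_cvg m n r0 ha pr; have [h2 _] := divc_cvg m.+1 n r0 ha pr.
rewrite -cvg_shiftS in h1.
apply: (ccvg_unique h1).
have -> : (fun N => \sum_(k < N.+1) a (m.+1 + k)%N n * p ^+ k) =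
  (fun N => a m.+1 n + p * \sum_(k < N) a (m.+2 + k)%N n * p ^+ k).
  apply/funext => N; rewrite big_ord_recl addn0 mulr1 mulr_sumr; congr (_ + _).
  apply: eq_bigr => k _; rewrite lift0 -addSnnS exprS; ring.
exact: (ccvgD (ccvg_cst (c := a m.+1 n)) (ccvgZ h2)).
Qed.

Lemma bddc_divc r M a p : 0 < r -> bddc r M a -> cmod p < r ->
  bddc r (M / (r - cmod p)) (divc p a).
Proof. by move=> r0 ha pr m n; have [] := divc_cvg m n r0 ha pr. Qed.

(** The recursion [divcS] telescopes in the first index, so the truncated quotient is exact up to
    one row of boundary terms; [psfun_divc] lets this row tend to 0. *)
Lemma psum_divc r M a p z N : 0 < r -> bddc r M a -> cmod p < r ->
  psum a z N.+1 - psum a (p, z.2) N.+1 = (z.1 - p) * psum (divc p a) z N.+1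
   - (z.1 ^+ N.+1 - p ^+ N.+1) * \sum_(n < N.+1) divc p a N n * z.2 ^+ n.
Proof.
move=> r0 ha pr; pose b := divc p a; pose c n := a 0%N n + p * b 0%N n.
have bS m n : b m n = a m.+1 n + p * b m.+1 n := divcS m n r0 ha pr.
have key w n K : \sum_(m < K.+1) a m n * w ^+ m =
   (w - p) * (\sum_(m < K.+1) b m n * w ^+ m) + c n - b K n * w ^+ K.+1.
  elim: K => [|K ih]; first by rewrite !big_ord1 /c (bS 0%N) !expr0 expr1; ring.
  rewrite big_ord_recr /= ih [in RHS]big_ord_recr /= (bS K) !exprS; ring.
have psE (d : nat -> nat -> CC R) y : psum d y N.+1 =
    \sum_(n < N.+1) (\sum_(m < N.+1) d m n * y.1 ^+ m) * y.2 ^+ n.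
  rewrite /psum exchange_big /=; apply: eq_bigr => n _.
  by rewrite mulr_suml.
rewrite !psE /= -sumrB !mulr_sumr -sumrB; apply: eq_bigr => n _.
rewrite !key /= -/b subrr mul0r add0r; ring.
Qed.

Lemma psfun_divc r M a p z : 0 < r -> bddc r M a -> cmod p < r ->
  cmod z.1 < r -> cmod z.2 < r ->
  psfun a z - psfun a (p, z.2) = (z.1 - p) * psfun (divc p a) z.
Proof.
move=> r0 ha pr z1 z2.
have M0 := bddc_ge0 ha.
pose s := Num.max (cmod p) (Num.max (cmod z.1) (cmod z.2)).
have sr : s < r by rewrite !gt_max pr z1 z2.
have ps : cmod p <= s by rewrite le_max lexx.
have z1s : cmod z.1 <= s by rewrite !le_max lexx orbT.
have z2s : cmod z.2 <= s by rewrite !le_max lexx !orbT.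
have s0 : 0 <= s by rewrite (le_trans _ ps) ?cmod_ge0.
have hb := bddc_divc r0 ha pr; set M' := M / _ in hb.
have M'0 := bddc_ge0 hb.
have [c1 _] := psum_cvg r0 ha z1s z2s sr.
have [c2 _] := @psum_cvg _ _ _ (p, z.2) _ r0 ha ps z2s sr.
have [c3 _] := psum_cvg r0 hb z1s z2s sr.
have h1 : (fun n => psum a z n.+1 - psum a (p, z.2) n.+1 : CC R) @ \oo -->
    (psfun a z - psfun a (p, z.2) : CC R).
  exact: ccvg_shiftS (ccvgB c1 c2).
have h2 : (fun n => (z.1 - p) * psum (divc p a) z n.+1 : CC R) @ \oo -->
   ((z.1 - p) * psfun (divc p a) z : CC R).
  exact: ccvg_shiftS (ccvgZ (c := z.1 - p) c3).
refine (ccvg_unique h1 _).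
rewrite -[X in _ --> X]subr0.
have -> : (fun n => psum a z n.+1 - psum a (p, z.2) n.+1) =
  (fun n => (z.1 - p) * psum (divc p a) z n.+1 -
    (z.1 ^+ n.+1 - p ^+ n.+1) * \sum_(k < n.+1) divc p a n k * z.2 ^+ k).
  by apply/funext => n; rewrite -(psum_divc _ _ r0 ha pr).
apply: ccvgB; first exact: h2.
pose q := s / r; have q0 : 0 <= q by rewrite divr_ge0 // ltW.
have q1 : q < 1 by rewrite ltr_pdivrMr // mul1r.
(* The boundary row is at most [M' / (1 - q) / r ^+ n] and its factor at most [2 * s ^+ n.+1]; their
   product is [C * q ^+ n]. *)
pose C := 2 * s * (M' / (1 - q)).
have qC : (fun n => C * q ^+ n) @ \oo --> (0 : R).
  rewrite -[X in _ --> X](mulr0 C); apply: cvgM; first exact: cvg_cst.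
  by apply: cvg_expr; rewrite ger0_norm.
apply/cvg_cmodP => e e0; move/cvgrPdist_lt : qC => /(_ _ e0).
apply: filterS => n; rewrite sub0r normrN subr0 => /(le_lt_trans (ler_norm _)).
apply: le_lt_trans; rewrite cmodM.
have e1 : cmod (z.1 ^+ n.+1 - p ^+ n.+1) <= 2 * s ^+ n.+1.
  rewrite (le_trans (ler_cmodB _ _)) // !cmodX mulrDl mul1r.
  by rewrite lerD // lerXn2r ?nnegrE ?cmod_ge0.
have e2 : cmod (\sum_(k < n.+1) divc p a n k * z.2 ^+ k) <= M' / (1 - q) / r ^+ n.
  apply: (@le_trans _ _ (\sum_(k < n.+1) M' / r ^+ n * q ^+ k)).
    rewrite (le_trans (ler_cmod_sum _ _ _)) // ler_sum // => k _.
    rewrite cmodM cmodX.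
    have -> : M' / r ^+ n * q ^+ k = M' / r ^+ (n + k) * s ^+ k.
      by rewrite /q expr_div_n exprD; field; rewrite !expf_neq0 ?gt_eqF.
    rewrite ler_pM ?exprn_ge0 ?cmod_ge0 //.
      by rewrite ler_pdivlMr ?exprn_gt0.
    by rewrite lerXn2r ?nnegrE ?cmod_ge0.
  rewrite -mulr_sumr -/(geosum q n.+1) [leRHS]mulrAC.
  by rewrite ler_wpM2l ?geosum_le // divr_ge0 // exprn_ge0 // ltW.
apply: le_trans (ler_pM (cmod_ge0 _) (cmod_ge0 _) e1 e2) _.
rewrite /C /q expr_div_n exprS le_eqVlt; apply/orP; left; apply/eqP.
have rsE : r - s != 0 by rewrite subr_eq0 gt_eqF.
by field; rewrite rsE expf_neq0 ?gt_eqF.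
Qed.
End ComplexSeries.

(** * Continuity and differentiability of double power series and of their first partial
    derivative *)

Section PowerSeriesRegularity.
Context {R : realType}.
Implicit Types (p w : CC R) (a : nat -> nat -> CC R) (z : CC R * CC R).

Lemma ccont2P (f : CC R * CC R -> CC R) z : {for z, continuous f} <->
  forall e : R, 0 < e -> exists2 d : R, 0 < d & forall w : CC R * CC R,
    cmod (w.1 - z.1) < d -> cmod (w.2 - z.2) < d -> cmod (f w - f z) <= e.
Proof.
rewrite /prop_for /continuous_at; split=> [h e e0|h].
  have /(@cvg_cmodP _ _ (nbhs z) (nbhs_filter z))/(_ _ e0) := h.
  move=> [[A B] [/= /nbhs_cmodP[d1 d10 hA] /nbhs_cmodP[d2 d20 hB]] AB].
  exists (Num.min d1 d2) => [|w]; first by rewrite lt_min d10.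
  rewrite !lt_min => /andP[w1 _] /andP[_ w2]; apply: ltW.
  by apply: (AB w); split; [exact: hA|exact: hB].
apply/(@cvg_cmodP _ _ (nbhs z) (nbhs_filter z)) => e e0.
have e2 : 0 < e / 2 by rewrite divr_gt0.
have [d d0 hd] := h _ e2.
exists ([set w | cmod (w - z.1) < d], [set w | cmod (w - z.2) < d]).
  by split; apply/nbhs_cmodP; exists d.
by move=> w [/= w1 w2]; have := hd w w1 w2; lra.
Qed.

Lemma psfun_le (r M : R) a z (s : R) : 0 < r -> bddc r M a ->
  cmod z.1 <= s -> cmod z.2 <= s -> s < r ->
  cmod (psfun a z) <= M / (1 - s / r) ^+ 2.
Proof. by move=> r0 ha z1 z2 sr; case: (psum_cvg r0 ha z1 z2 sr). Qed.

Lemma bddc_divcW (r M : R) a p (s : R) : 0 < r -> bddc r M a -> cmod p <= s -> s < r ->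
  bddc r (M / (r - s)) (divc p a).
Proof.
move=> r0 ha ps sr; have M0 := bddc_ge0 ha.
have h := bddc_divc r0 ha (le_lt_trans ps sr) => m n.
apply: (le_trans (h m n)); rewrite ler_wpM2l // lef_pV2 ?posrE ?subr_gt0 //.
  by rewrite lerB.
exact: le_lt_trans ps sr.
Qed.

Lemma psfun_tr a z : psfun (fun m n => a n m) z = psfun a (z.2, z.1).
Proof. by rewrite /psfun psum_tr. Qed.

Definition psfun_lipc (r M s : R) : R := M / (r - s) / (1 - s / r) ^+ 2.

Lemma psfun_lip1 (r M : R) a z p (s : R) : 0 < r -> bddc r M a -> s < r ->
  cmod z.1 <= s -> cmod z.2 <= s -> cmod p <= s ->
  cmod (psfun a z - psfun a (p, z.2)) <= cmod (z.1 - p) * psfun_lipc r M s.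
Proof.
move=> r0 ha sr z1 z2 ps.
rewrite (psfun_divc r0 ha) ?(le_lt_trans _ sr) //.
rewrite cmodM ler_wpM2l ?cmod_ge0 //.
exact: (psfun_le r0 (bddc_divcW r0 ha ps sr)).
Qed.

Lemma psfun_lip (r M : R) a z (w : CC R * CC R) (s : R) : 0 < r -> bddc r M a -> s < r ->
  cmod z.1 <= s -> cmod z.2 <= s -> cmod w.1 <= s -> cmod w.2 <= s ->
  cmod (psfun a z - psfun a w) <=
    (cmod (z.1 - w.1) + cmod (z.2 - w.2)) * psfun_lipc r M s.
Proof.
move=> r0 ha sr z1 z2 w1 w2.
have -> : psfun a z - psfun a w =
  (psfun a z - psfun a (w.1, z.2)) + (psfun a (w.1, z.2) - psfun a (w.1, w.2)).
  by rewrite addrA subrK -surjective_pairing.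
rewrite (le_trans (ler_cmodD _ _)) // mulrDl lerD //; first exact: psfun_lip1.
have := @psfun_lip1 r M (fun m n => a n m) (z.2, w.1) w.2 s r0 (bddc_tr ha) sr.
by rewrite !(psfun_tr a) /= => h; exact: (h z2 w1 w2).
Qed.

Lemma psfun_lipc_ge0 (r M s : R) : 0 <= M -> s < r -> 0 <= psfun_lipc r M s.
Proof. by move=> M0 sr; rewrite !divr_ge0 // ?sqr_ge0 // subr_ge0 ltW. Qed.

Lemma between2 (r : R) z : cmod z.1 < r -> cmod z.2 < r ->
  exists2 s, s < r & cmod z.1 < s /\ cmod z.2 < s.
Proof.
move=> z1 z2; pose m := Num.max (cmod z.1) (cmod z.2).
have mr : m < r by rewrite gt_max z1 z2.
have m1 : cmod z.1 <= m by rewrite le_max lexx.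
have m2 : cmod z.2 <= m by rewrite le_max lexx orbT.
exists ((m + r) / 2); first lra.
by split; lra.
Qed.

Lemma cmod_near w p (s d : R) : cmod (w - p) < d -> cmod p + d <= s -> cmod w <= s.
Proof.
move=> wp ps; have := ler_cmodD (w - p) p; rewrite subrK; lra.
Qed.

Lemma psfun_cont (r M : R) a z : 0 < r -> bddc r M a ->
  cmod z.1 < r -> cmod z.2 < r -> {for z, continuous (psfun a)}.
Proof.
move=> r0 ha z1 z2; have [s sr [zs1 zs2]] := between2 z1 z2.
have K0 := psfun_lipc_ge0 (bddc_ge0 ha) sr; set K := psfun_lipc r M s in K0.
apply/ccont2P => e e0.
pose d := Num.min (Num.min (s - cmod z.1) (s - cmod z.2)) (e / (2 * (1 + K))).
have K1 : 0 < 2 * (1 + K) by lra.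
have d0 : 0 < d by rewrite !lt_min !subr_gt0 zs1 zs2 divr_gt0.
exists d => // w; rewrite !lt_min => /andP[/andP[w1 _] w1'] /andP[/andP[_ w2] w2'].
have ws1 : cmod w.1 <= s by apply: (cmod_near w1); lra.
have ws2 : cmod w.2 <= s by apply: (cmod_near w2); lra.
apply: le_trans (psfun_lip r0 ha sr ws1 ws2 (ltW zs1) (ltW zs2)) _.
rewrite -/K; rewrite !ltr_pdivlMr // in w1' w2'.
have := cmod_ge0 (w.1 - z.1); have := cmod_ge0 (w.2 - z.2); nra.
Qed.

(** The derivative in the first variable, read off as the slope series centred at [p] evaluated at
    [p]. The coefficients move with [p], so its regularity is not that of a single [psfun]. *)
Definition dpsfun a p (v : CC R) : CC R := psfun (divc p a) (p, v).

Lemma psfun_cderiv1 (r M : R) a p v : 0 < r -> bddc r M a ->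
  cmod p < r -> cmod v < r -> cderiv (fun w => psfun a (w, v)) p (dpsfun a p v).
Proof.
move=> r0 ha pr vr.
pose g w := psfun (divc p a) (w, v).
have rp : 0 < r - cmod p by rewrite subr_gt0.
apply: (@cderiv_slope _ _ p g _ rp) => [w wp|].
  rewrite (@psfun_divc _ _ _ _ p (w, v) r0 ha) //.
  have := ler_cmodD (w - p) p; rewrite subrK /=; lra.
have := @psfun_cont _ _ _ (p, v) r0 (bddc_divc r0 ha pr) pr vr.
move=> /ccont2P h e e0; have [d d0 hd] := h _ e0.
by exists d => // w wp; apply: hd; rewrite //= subrr cmod0.
Qed.

Lemma psfun_cderiv2 (r M : R) a p v : 0 < r -> bddc r M a ->
  cmod p < r -> cmod v < r ->
  cderiv (fun w => psfun a (p, w)) v (dpsfun (fun m n => a n m) v p).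
Proof.
move=> r0 ha pr vr.
apply: (cderiv_ext (ltr01 : 0 < 1 :> R)) (psfun_cderiv1 r0 (bddc_tr ha) vr pr) => w _.
exact: psfun_tr.
Qed.

Lemma taylor2E (A Ap B Bp C d : CC R) :
  B - Bp = d * C -> A - Ap = d * B -> Ap + d * (Bp + d * C) = A.
Proof.
by move=> <- h; rewrite (addrC Bp) subrK -h addrC subrK.
Qed.

Lemma taylor2_deriv (d D G A : CC R) :
  0 + (d * (0 + (d * D + G * 1)) + (A + d * G) * 1) - A = d * (2 * G + d * D).
Proof. ring. Qed.

(** Dividing twice by [x - p] gives a second order Taylor expansion of [psfun a (x, v)] at [p] with
    a series as remainder. Differentiating it at [w] and using uniqueness of derivatives exhibits
    the slope of [dpsfun] itself. *)
Lemma dpsfun_sub (r M : R) a p w v : 0 < r -> bddc r M a ->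
  cmod p < r -> cmod v < r -> cmod w < r ->
  let a2 := divc p (divc p a) in
  dpsfun a w v - dpsfun a p v =
   (w - p) * (2 * psfun a2 (w, v) + (w - p) * dpsfun a2 w v).
Proof.
move=> r0 ha pr vr wr a2.
have ha1 := bddc_divc r0 ha pr; have ha2 := bddc_divc r0 ha1 pr.
pose F x : CC R := psfun a (p, v) +
  (x - p) * (psfun (divc p a) (p, v) + (x - p) * psfun a2 (x, v)).
have FE x : cmod x < r -> F x = psfun a (x, v).
  move=> xr; exact: taylor2E (@psfun_divc _ _ _ _ p (x, v) r0 ha1 pr xr vr)
    (@psfun_divc _ _ _ _ p (x, v) r0 ha pr xr vr).
have dF := cderivD (cderiv_cst w (psfun a (p, v))) (cderivM (cderiv_subc w p)
  (cderivD (cderiv_cst w (psfun (divc p a) (p, v)))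
    (cderivM (cderiv_subc w p) (psfun_cderiv1 r0 ha2 wr vr)))).
have rw : 0 < r - cmod w by rewrite subr_gt0.
have dF' : cderiv F w (dpsfun a w v).
  apply: (cderiv_ext rw) (psfun_cderiv1 r0 ha wr vr) => x xw; rewrite FE //.
  have := ler_cmodD (x - w) w; rewrite subrK; lra.
rewrite (cderiv_unique dF' dF); exact: taylor2_deriv.
Qed.

(** [M2] bounds the coefficients after two divisions, and [2 * s] bounds [cmod (w - p)] in the last
    term of [dpsfun_sub]. *)
Definition dpsfun_lipc (r M s : R) : R :=
  let M2 := M / (r - s) / (r - s) in
  2 * (M2 / (1 - s / r) ^+ 2) + 2 * s * psfun_lipc r M2 s.

Lemma cmod2 : cmod (2 : CC R) = 2.
Proof.
have -> : (2 : CC R) = Complex (2 : R) 0 by apply: CC_eqP; rewrite /= ?addr0.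
by rewrite /cmod /= expr0n addr0 sqrtr_sqr ger0_norm.
Qed.

Lemma dpsfun_lip1 (r M : R) a p w v (s : R) : 0 < r -> bddc r M a -> s < r ->
  cmod p <= s -> cmod v <= s -> cmod w <= s ->
  cmod (dpsfun a w v - dpsfun a p v) <= cmod (w - p) * dpsfun_lipc r M s.
Proof.
move=> r0 ha sr ps vs ws.
rewrite (dpsfun_sub r0 ha) ?(le_lt_trans _ sr) //= cmodM ler_wpM2l ?cmod_ge0 //.
have ha2 := bddc_divcW r0 (bddc_divcW r0 ha ps sr) ps sr.
rewrite (le_trans (ler_cmodD _ _)) // lerD // cmodM.
  by rewrite cmod2 ler_wpM2l // (psfun_le r0 ha2).
rewrite ler_pM ?cmod_ge0 //.
  by rewrite (le_trans (ler_cmodB _ _)) // mulrDl mul1r lerD.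
exact: (psfun_le r0 (bddc_divcW r0 ha2 ws sr)).
Qed.

Lemma dpsfun_derivable1 (r M : R) a p v : 0 < r -> bddc r M a ->
  cmod p < r -> cmod v < r -> derivable (fun w => dpsfun a w v) p 1.
Proof.
move=> r0 ha pr vr; have [s sr [ps vs]] := @between2 r (p, v) pr vr.
have ha2 := bddc_divcW r0 (bddc_divcW r0 ha (ltW ps) sr) (ltW ps) sr.
set a2 := divc p _ in ha2; set M2 := _ / (r - s) in ha2.
have s0 : 0 <= s by rewrite (le_trans _ (ltW ps)) ?cmod_ge0.
pose g w := 2 * psfun a2 (w, v) + (w - p) * dpsfun a2 w v.
have d0 : 0 < s - cmod p by rewrite subr_gt0.
have near w : cmod (w - p) < s - cmod p -> cmod w <= s.
  by move=> h; apply: (cmod_near h); lra.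
apply: (@cderiv_derivable _ _ _ (g p)); apply: (cderiv_slope (g := g) d0).
  move=> w /near ws; rewrite (dpsfun_sub r0 ha) //; exact: le_lt_trans ws sr.
set K := psfun_lipc r M2 s.
have K0 : 0 <= K := psfun_lipc_ge0 (bddc_ge0 ha2) sr.
have K1 : 0 < 1 + 3 * K by lra.
move=> e e0; exists (Num.min (s - cmod p) (e / (1 + 3 * K))).
  by rewrite lt_min d0 divr_gt0.
move=> w; rewrite lt_min => /andP[wp]; rewrite (ltr_pdivlMr _ _ K1) => we; have ws := near _ wp.
have -> : g w - g p = 2 * (psfun a2 (w, v) - psfun a2 (p, v)) + (w - p) * dpsfun a2 w v.
  rewrite /g; move: (psfun _ _) (psfun _ _) (dpsfun _ _ _) (dpsfun _ _ _) => A B C D.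
  by ring.
have h1 := @psfun_lip1 _ _ _ (w, v) p _ r0 ha2 sr ws (ltW vs) (ltW ps).
have h2 := @psfun_le _ _ _ (w, v) _ r0 (bddc_divcW r0 ha2 ws sr) ws (ltW vs) sr.
rewrite -/K /= in h1; rewrite -[_ / _]/K -/(dpsfun a2 w v) in h2.
have h3 := ler_cmodD (2 * (psfun a2 (w, v) - psfun a2 (p, v))) ((w - p) * dpsfun a2 w v).
rewrite !cmodM cmod2 in h3.
have := ler_wpM2l (cmod_ge0 (w - p)) h2; have := cmod_ge0 (w - p); nra.
Qed.

Lemma dpsfun_cont (r M : R) a p v : 0 < r -> bddc r M a ->
  cmod p < r -> cmod v < r ->
  {for (p, v), continuous (fun y : CC R * CC R => dpsfun a y.1 y.2)}.
Proof.
move=> r0 ha z1 z2; have [s sr [zs1 zs2]] := @between2 r (p, v) z1 z2.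
have ha1 := bddc_divcW r0 ha (ltW zs1) sr.
have /ccont2P hc := @psfun_cont _ _ _ (p, v) r0 ha1 z1 z2.
set L := dpsfun_lipc r M s.
apply/ccont2P => e e0.
have e2 : 0 < e / 2 by rewrite divr_gt0.
have [d0 d00 hd0] := hc _ e2.
have L1 : 0 < 2 * (1 + `|L|) by rewrite mulr_gt0 // ltr_pwDl.
pose d := Num.min (Num.min (s - cmod p) (s - cmod v))
  (Num.min d0 (e / (2 * (1 + `|L|)))).
exists d; first by rewrite !lt_min !subr_gt0 zs1 zs2 d00 divr_gt0.
move=> [w x] /=; rewrite !lt_min.
move=> /andP[/andP[w1 _] /andP[_ w1']] /andP[/andP[_ w2] /andP[w2' _]].
have ws1 : cmod w <= s by apply: (cmod_near w1); lra.
have ws2 : cmod x <= s by apply: (cmod_near w2); lra.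
have h1 := dpsfun_lip1 r0 ha sr (ltW zs1) ws2 ws1; rewrite -/L in h1.
have h2 : cmod (dpsfun a p x - dpsfun a p v) <= e / 2.
  by apply: (hd0 (p, x)); [rewrite /= subrr cmod0|exact: w2'].
rewrite /= in h1 *; move: h1 h2.
move: (dpsfun a w x) (dpsfun a p x) (dpsfun a p v) => A B C h1 h2.
have h3 := ler_cmodD (A - B) (B - C).
rewrite addrA subrK in h3; apply: (le_trans h3).
rewrite ltr_pdivlMr // in w1'.
have : cmod (w - p) * L <= cmod (w - p) * (1 + `|L|).
  by rewrite ler_wpM2l ?cmod_ge0 // (le_trans (ler_norm L)) // lerDr.
lra.
Qed.

Lemma dpsfun_derivable2 (r M : R) a p v : 0 < r -> bddc r M a ->
  cmod p < r -> cmod v < r -> derivable (fun w => dpsfun a p w) v 1.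
Proof.
move=> r0 ha pr vr.
exact: cderiv_derivable (psfun_cderiv2 r0 (bddc_divc r0 ha pr) pr vr).
Qed.
End PowerSeriesRegularity.

(** * Integrals of complex functions over real segments, and the parametrisation of circles *)

Section ComplexIntegral.
Context {R : realType}.
Local Notation mu := (@lebesgue_measure R).
Implicit Types (F G : R -> CC R) (a b c x : R).

Definition pcont F x : Prop := F @ nbhs x --> F x.
Definition pcontI a b F : Prop := forall x, a <= x <= b -> pcont F x.

Lemma pcontP F x : pcont F x <-> forall e : R, 0 < e ->
  exists2 d : R, 0 < d & forall y, `|y - x| < d -> cmod (F y - F x) < e.
Proof.
split=> [/(@cvg_cmodP _ _ (nbhs x) (nbhs_filter x)) h e /h [d /= d0 hd]|h].
  by exists d => // y yx; apply: hd; rewrite /= distrC.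
apply/(@cvg_cmodP _ _ (nbhs x) (nbhs_filter x)) => e /h[d d0 hd].
by exists d => // y /=; rewrite distrC; exact: hd.
Qed.

Lemma pcont_cst (k : CC R) x : pcont (fun=> k) x.
Proof. exact: ccvg_cst. Qed.
Lemma pcontD F G x : pcont F x -> pcont G x -> pcont (fun t => F t + G t) x.
Proof. by move=> h h'; exact: ccvgD h h'. Qed.
Lemma pcontB F G x : pcont F x -> pcont G x -> pcont (fun t => F t - G t) x.
Proof. by move=> h h'; exact: ccvgB h h'. Qed.
Lemma pcontM F G x : pcont F x -> pcont G x -> pcont (fun t => F t * G t) x.
Proof. by move=> h h'; exact: ccvgM h h'. Qed.
Lemma pcontZ (k : CC R) F x : pcont F x -> pcont (fun t => k * F t) x.
Proof. by move=> h; exact: ccvgZ h. Qed.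
Lemma pcont_comp (g : CC R -> CC R) F x : ccont g (F x) -> pcont F x ->
  pcont (fun t => g (F t)) x.
Proof.
move=> hg /pcontP hF; apply/pcontP => e e0.
have e2 : 0 < e / 2 by rewrite divr_gt0.
have [d d0 hd] := hg _ e2; have [d' d'0 hd'] := hF _ d0.
by exists d' => // y /hd' /hd h; lra.
Qed.

Lemma pcont_Re F x : pcont F x -> (fun t => complex.Re (F t)) @ nbhs x --> complex.Re (F x).
Proof.
move=> /pcontP h; apply/(@cvgrPdist_lt _ _ _ (nbhs x)) => e /h [d d0 hd].
exists d => // y /=; rewrite distrC => /hd; apply: le_lt_trans.
by rewrite -ReN -ReD cmodBC normr_Re_le.
Qed.
Lemma pcont_Im F x : pcont F x -> (fun t => complex.Im (F t)) @ nbhs x --> complex.Im (F x).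
Proof.
move=> /pcontP h; apply/(@cvgrPdist_lt _ _ _ (nbhs x)) => e /h [d d0 hd].
exists d => // y /=; rewrite distrC => /hd; apply: le_lt_trans.
by rewrite -ImN -ImD cmodBC normr_Im_le.
Qed.
Lemma pcont_pair (f g : R -> R) x : f @ nbhs x --> f x -> g @ nbhs x --> g x ->
  pcont (fun t => Complex (f t) (g t)) x.
Proof.
move=> /cvgrPdist_lt hf /cvgrPdist_lt hg; apply/(@cvg_cmodP _ _ (nbhs x)) => e e0.
have e2 : 0 < e / 2 by rewrite divr_gt0.
near=> y; rewrite cmodBC (le_lt_trans (cmod_le_ReIm _)) // (splitr e).
rewrite ltrD // !(ReD, ImD, ReN, ImN) /=.
  by near: y; exact: hf.
by near: y; exact: hg.
Unshelve. all: by end_near. Qed.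

Lemma segment_integrable (f : R -> R) a b :
  (forall x, a <= x <= b -> f @ nbhs x --> f x) ->
  mu.-integrable `[a, b] (EFin \o f).
Proof.
move=> h; apply: continuous_compact_integrable; first exact: segment_compact.
by apply: continuous_in_subspaceT => x; rewrite inE /= in_itv /= => /h.
Qed.

Definition cint a b F : CC R :=
  Complex (\int[mu]_(x in `[a, b]) complex.Re (F x))
          (\int[mu]_(x in `[a, b]) complex.Im (F x)).

Let intRe a b F : pcontI a b F ->
  mu.-integrable `[a, b] (EFin \o (fun x => complex.Re (F x))).
Proof. by move=> h; apply: segment_integrable => x /h /pcont_Re. Qed.
Let intIm a b F : pcontI a b F ->
  mu.-integrable `[a, b] (EFin \o (fun x => complex.Im (F x))).
Proof. by move=> h; apply: segment_integrable => x /h /pcont_Im. Qed.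

Lemma eq_cint a b F G : (forall x, a <= x <= b -> F x = G x) ->
  cint a b F = cint a b G.
Proof.
move=> h; rewrite /cint; congr Complex; apply: eq_Rintegral => x;
  by rewrite inE /= in_itv /= => /h ->.
Qed.

Lemma Rintegral_split (f : R -> R) a b c :
  a <= c -> c <= b -> mu.-integrable `[a, b] (EFin \o f) ->
  \int[mu]_(x in `[a, b]) f x = \int[mu]_(x in `[a, c]) f x + \int[mu]_(x in `[c, b]) f x.
Proof.
move=> ac cb h; have := @Rintegral_itvB _ f (BLeft a) (BRight b) c h.
rewrite !bnd_simp => /(_ ac cb).
rewrite Rintegral_itv_obnd_cbnd => [<-|]; first by rewrite addrC subrK.
by apply: integrableS h => //; apply: subset_itv; rewrite bnd_simp.
Qed.

Lemma cint_split a b c F : a <= c -> c <= b -> pcontI a b F ->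
  cint a b F = cint a c F + cint c b F.
Proof.
move=> ac cb h; rewrite /cint (Rintegral_split ac cb (intRe h)).
by rewrite (Rintegral_split ac cb (intIm h)).
Qed.

Lemma cintD a b F G : pcontI a b F -> pcontI a b G ->
  cint a b (fun x => F x + G x) = cint a b F + cint a b G.
Proof.
move=> hF hG; rewrite /cint.
under eq_Rintegral do rewrite ReD.
under [X in Complex _ X]eq_Rintegral do rewrite ImD.
by rewrite (RintegralD _ (intRe hF) (intRe hG)) ?(RintegralD _ (intIm hF) (intIm hG)).
Qed.

Lemma cintZ a b (k : CC R) F : pcontI a b F ->
  cint a b (fun x => k * F x) = k * cint a b F.
Proof.
move=> h.
have cZ (f : R -> R) (r : R) : mu.-integrable `[a, b] (EFin \o f) ->
    mu.-integrable `[a, b] (EFin \o (fun x => r * f x)).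
  by move=> hf; exact: (integrableZl _ r hf).
apply: CC_eqP; rewrite /cint /= ?ReM ?ImM /=.
  under eq_Rintegral do rewrite ReM.
  rewrite (RintegralB _ (cZ _ _ (intRe h)) (cZ _ _ (intIm h))) //.
  by rewrite (RintegralZl _ _ (intRe h)) // (RintegralZl _ _ (intIm h)).
under eq_Rintegral do rewrite ImM.
rewrite (RintegralD _ (cZ _ _ (intIm h)) (cZ _ _ (intRe h))) //.
by rewrite (RintegralZl _ _ (intRe h)) // (RintegralZl _ _ (intIm h)).
Qed.

Lemma cintB a b F G : pcontI a b F -> pcontI a b G ->
  cint a b (fun x => F x - G x) = cint a b F - cint a b G.
Proof.
move=> hF hG.
have hG' : pcontI a b (fun x => -1 * G x).
  by move=> x /hG h; exact: pcontZ h.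
have -> : cint a b (fun x => F x - G x) = cint a b (fun x => F x + -1 * G x).
  by apply: eq_cint => x _; rewrite mulN1r.
by rewrite (cintD hF hG') cintZ // mulN1r.
Qed.

Lemma Rintegral_segment_cst a b (k : R) : a <= b ->
  \int[mu]_(x in `[a, b]) k = k * (b - a).
Proof.
move=> ab; rewrite Rintegral_cst //= lebesgue_measure_itv /= lte_fin.
case: ltP => [_ //|ba].
by have -> : b = a; [apply/eqP; rewrite eq_le ab ba|rewrite subrr mulr0].
Qed.

Lemma cint_cst a b (k : CC R) : a <= b -> cint a b (fun=> k) = k * (b - a)%:C%C.
Proof.
by move=> ab; apply: CC_eqP; rewrite /cint /= Rintegral_segment_cst // ?ReM ?ImM /=
  ?mulr0 ?subr0 ?add0r.
Qed.

Lemma normr_Rintegral_le (f : R -> R) a b B : a <= b ->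
  (forall x, a <= x <= b -> f @ nbhs x --> f x) ->
  (forall x, a <= x <= b -> `|f x| <= B) ->
  `|\int[mu]_(x in `[a, b]) f x| <= B * (b - a).
Proof.
move=> ab fc fB; have fi := segment_integrable fc.
apply: le_trans (le_normr_Rintegral _ fi) _ => //.
rewrite -(Rintegral_segment_cst B ab); apply: le_Rintegral => //.
- exact: (integrable_norm fi).
- by apply: segment_integrable => x _; exact: cvg_cst.
Qed.

(** Real and imaginary parts are bounded separately, which costs the factor 2. The factor reappears
    in all estimates of means and coefficients below and is harmless there. *)
Lemma cmod_cint_le a b F B : a <= b -> pcontI a b F ->
  (forall x, a <= x <= b -> cmod (F x) <= B) ->
  cmod (cint a b F) <= 2 * (B * (b - a)).
Proof.
move=> ab hF FB; apply: le_trans (cmod_le_ReIm _) _.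
rewrite mulrDl mul1r lerD //= normr_Rintegral_le // => x xab.
- exact: pcont_Re (hF x xab).
- exact: le_trans (normr_Re_le _) (FB _ xab).
- exact: pcont_Im (hF x xab).
- exact: le_trans (normr_Im_le _) (FB _ xab).
Qed.

Lemma pcont_rexpi r x : pcont (rexpi r) x.
Proof.
by apply: pcont_pair; apply: cvgM; [exact: cvg_cst|exact: continuous_cos|
  exact: cvg_cst|exact: continuous_sin].
Qed.

Lemma cmod_rexpi (r t : R) : 0 <= r -> cmod (rexpi r t) = r.
Proof.
by move=> r0; rewrite /cmod /= !exprMn -mulrDr cos2Dsin2 mulr1 sqrtr_sqr ger0_norm.
Qed.

Lemma rexpiE (r t : R) : rexpi r t = r%:C%C * rexpi 1 t.
Proof. by apply: CC_eqP; rewrite ?ReM ?ImM /= !mul0r ?subr0 ?addr0 mul1r. Qed.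

Lemma pcont_radial (t x : R) : pcont (fun r => rexpi r t) x.
Proof.
by apply: pcont_pair; apply: cvgM; [exact: cvg_id|exact: cvg_cst|
  exact: cvg_id|exact: cvg_cst].
Qed.

Lemma FTC_segment (f g : R -> R) a b : a <= b ->
  (forall x : R, a <= x <= b -> is_derive x 1 g (f x)) ->
  (forall x : R, a <= x <= b -> f @ nbhs x --> f x) ->
  \int[mu]_(x in `[a, b]) f x = g b - g a.
Proof.
rewrite le_eqVlt => /predU1P[->|ab] dg cf.
  by rewrite set_itv1 Rintegral_set1 subrr.
have gc (x : R) : a <= x <= b -> {for x, continuous g}.
  move=> xab; apply: differentiable_continuous; apply/derivable1_diffP.
  by case: (dg x xab).
have mid x : x \in `]a, b[ -> a <= x <= b.
  by rewrite in_itv /= => /andP[ax xb]; rewrite !ltW.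
rewrite /Rintegral (@continuous_FTC2 _ f g) //.
- by apply: continuous_in_subspaceT => x; rewrite inE /= in_itv /=; exact: cf.
- split => [x /mid xab|| ]; first by case: (dg x xab).
    by apply: cvg_at_right_filter; apply: gc; rewrite lexx ltW.
  by apply: cvg_at_left_filter; apply: gc; rewrite lexx ltW.
- by move=> x /mid xab; rewrite derive1E; case: (dg x xab).
Qed.

(** This evaluation is what makes the linear part of a function cancel in [gphi_le]. *)
Lemma cint_rexpi a b : a <= b ->
  'i%C * cint a b (rexpi 1) = rexpi 1 b - rexpi 1 a.
Proof.
move=> ab; apply: CC_eqP; rewrite ?ReM ?ImM ?ReD ?ImD ?ReN ?ImN /=.
- rewrite mul0r mul1r sub0r; under eq_Rintegral do rewrite mul1r.
  have dc (x : R) : is_derive x 1 (fun x => - cos x) (sin x).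
    by have := is_deriveN (is_derive_cos x); rewrite opprK.
  rewrite (FTC_segment ab (fun x _ => dc x) (fun x _ => @continuous_sin R x)).
  by rewrite !mul1r opprB opprK addrC.
- rewrite mul0r mul1r add0r; under eq_Rintegral do rewrite mul1r.
  rewrite (FTC_segment ab (fun x _ => is_derive_sin x) (fun x _ => @continuous_cos R x)).
  by rewrite !mul1r.
Qed.

Lemma lipschitz_derive1 (f g : R -> R) (K : R) (a b : R) :
  (forall x : R, is_derive x 1 g (f x)) -> (forall x, `|f x| <= K) ->
  `|g b - g a| <= K * `|b - a|.
Proof.
move=> dg fK; wlog ab : a b / a <= b => [h|].
  by have [/h //|/ltW/h] := leP a b; rewrite distrC (distrC a).
have gc (x : R) : {for x, continuous g}.
  by apply: differentiable_continuous; apply/derivable1_diffP; case: (dg x).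
have [|c _ ->] := @MVT_segment _ g f a b ab (fun x _ => dg x).
  by apply: continuous_in_subspaceT => x _; exact: gc.
by rewrite normrM ler_wpM2r.
Qed.

Lemma rexpi_lip (r r' t t' : R) : 0 <= r ->
  cmod (rexpi r t - rexpi r' t') <= 2 * `|r - r'| + 2 * r * `|t - t'|.
Proof.
move=> r0.
have -> : rexpi r t - rexpi r' t' = Complex (r * (cos t - cos t') + (r - r') * cos t')
   (r * (sin t - sin t') + (r - r') * sin t').
  by apply: CC_eqP; rewrite ?ReD ?ImD ?ReN ?ImN /=; ring.
apply: le_trans (cmod_le_ReIm _) _ => /=.
have hc : `|cos t - cos t'| <= 1 * `|t - t'|.
  apply: (@lipschitz_derive1 (fun x => - sin x)) => x.
  by rewrite normrN ler_norml sin_geN1 sin_le1.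
have hs : `|sin t - sin t'| <= 1 * `|t - t'|.
  apply: (@lipschitz_derive1 cos) => x; first by rewrite ler_norml cos_geN1 cos_le1.
have h1 : `|r * (cos t - cos t')| <= r * `|t - t'|.
  by rewrite normrM ger0_norm // ler_wpM2l // -[leRHS]mul1r.
have h2 : `|r * (sin t - sin t')| <= r * `|t - t'|.
  by rewrite normrM ger0_norm // ler_wpM2l // -[leRHS]mul1r.
have h3 : `|(r - r') * cos t'| <= `|r - r'|.
  by rewrite normrM ler_piMr // ler_norml cos_geN1 cos_le1.
have h4 : `|(r - r') * sin t'| <= `|r - r'|.
  by rewrite normrM ler_piMr // ler_norml sin_geN1 sin_le1.
have := ler_normD (r * (cos t - cos t')) ((r - r') * cos t').
have := ler_normD (r * (sin t - sin t')) ((r - r') * sin t').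
lra.
Qed.
End ComplexIntegral.

Arguments pcont_cst {R} k x.
Arguments pcont_rexpi {R} r x.
Arguments pcont_radial {R} t x.

(** * Goursat's theorem on polar rectangles *)

Section Goursat.
Context {R : realType}.
Implicit Types (F : CC R -> CC R) (a b r t : R).

Lemma nested_segments (a : nat -> R) (l : R) : 0 <= l -> (forall n, a n <= a n.+1) ->
  (forall n, a n.+1 + l / 2 ^+ n.+1 <= a n + l / 2 ^+ n) ->
  exists x, forall n, a n <= x <= a n + l / 2 ^+ n.
Proof.
move=> l0 a1 a2.
have m1 n k : a n <= a (n + k)%N.
  by elim: k => [|k ih]; rewrite ?addn0 // addnS (le_trans ih).
have m2 n k : a (n + k)%N + l / 2 ^+ (n + k) <= a n + l / 2 ^+ n.
  by elim: k => [|k ih]; rewrite ?addn0 // addnS (le_trans _ ih).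
have l2 n : 0 <= l / 2 ^+ n by rewrite divr_ge0 // exprn_ge0.
have m3 n m : a m <= a n + l / 2 ^+ n.
  case: (leqP n m) => [/subnKC <-|/ltnW/subnKC <-].
    by apply: le_trans (m2 n (m - n)%N); rewrite lerDl.
  by apply: le_trans (m1 m (n - m)%N) _; rewrite lerDl.
exists (sup (range a)) => n; apply/andP; split.
  apply: ub_le_sup; last by exists n.
  by exists (a 0%N + l / 2 ^+ 0) => _ [m _ <-].
by apply: ge_sup; [exists (a 0%N), 0%N|move=> _ [m _ <-]].
Qed.

(** One bisection argument serves both Goursat's theorem and the compactness facts below. If the
    conclusion failed, a failing quarter could be chosen at each stage, and the nested rectangles
    would shrink to a point where the local hypothesis is violated. A rectangle is recorded by its
    level and its lower corner. *)
Lemma bisection2 (P : nat -> R -> R -> Prop) (a0 t0 l h : R) : 0 <= l -> 0 <= h ->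
  (forall n a t, (forall a' t', a' = a \/ a' = a + l / 2 ^+ n.+1 ->
      t' = t \/ t' = t + h / 2 ^+ n.+1 -> P n.+1 a' t') -> P n a t) ->
  (forall x y, exists n, forall a t, a <= x <= a + l / 2 ^+ n ->
      t <= y <= t + h / 2 ^+ n -> P n a t) ->
  P 0%N a0 t0.
Proof.
move=> l0 h0 Pstep Plocal; apply: contrapT => nP0.
have step (p : nat * (R * R)) : exists q : R * R, ~ P p.1 p.2.1 p.2.2 ->
    [/\ q.1 = p.2.1 \/ q.1 = p.2.1 + l / 2 ^+ p.1.+1,
        q.2 = p.2.2 \/ q.2 = p.2.2 + h / 2 ^+ p.1.+1 & ~ P p.1.+1 q.1 q.2].
  have [pP|nP] := pselect (P p.1 p.2.1 p.2.2); first by exists p.2.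
  apply: contrapT => hn; apply: nP; apply: Pstep => a' t' ha ht.
  by apply: contrapT => nP'; apply: hn; exists (a', t').
have [f hf] := choice step.
pose s := fix s n := if n is m.+1 then f (m, s m) else (a0, t0).
have ns n : ~ P n (s n).1 (s n).2.
  by elim: n => [//|n ih]; case: (hf (n, s n) ih).
have hs n := hf (n, s n) (ns n).
have half (k : R) n : k / 2 ^+ n.+1 + k / 2 ^+ n.+1 = k / 2 ^+ n.
  by rewrite exprS; field; rewrite expf_neq0.
have pos (k : R) n : 0 <= k -> 0 <= k / 2 ^+ n.
  by move=> k0; rewrite divr_ge0 // exprn_ge0.
have [||x hx] := @nested_segments (fun n => (s n).1) l l0.
- move=> n; have [/= + _ _] := hs n; have := pos l n.+1 l0.
  by case: (f _) => u v /= ? [|] ->; lra.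
- move=> n; have [/= + _ _] := hs n; have := pos l n.+1 l0; rewrite -(half l n).
  by case: (f _) => u v /= ? [|] ->; lra.
have [||y hy] := @nested_segments (fun n => (s n).2) h h0.
- move=> n; have [/= _ + _] := hs n; have := pos h n.+1 h0.
  by case: (f _) => u v /= ? [|] ->; lra.
- move=> n; have [/= _ + _] := hs n; have := pos h n.+1 h0; rewrite -(half h n).
  by case: (f _) => u v /= ? [|] ->; lra.
have [n hn] := Plocal x y.
by apply: (ns n); apply: hn.
Qed.

(* the integral of F(z) dz / z over the boundary of a polar rectangle *)
Definition gphi F (r0 r1 t0 t1 : R) : CC R :=
  ('i%C : CC R) * cint t0 t1 (fun t => F (rexpi r1 t) - F (rexpi r0 t))
  - cint r0 r1 (fun r => (r^-1)%:C%C * (F (rexpi r t1) - F (rexpi r t0))).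

Definition cont_annulus F (a b : R) : Prop :=
  forall z, a <= cmod z <= b -> ccont F z.

Lemma pcont_circle F (a b r : R) x : cont_annulus F a b -> 0 <= r -> a <= r <= b ->
  pcont (fun t => F (rexpi r t)) x.
Proof.
move=> h r0 ab; refine (@pcont_comp _ F (rexpi r) x _ (pcont_rexpi r x)).
by apply: h; rewrite cmod_rexpi.
Qed.

Lemma pcont_inv x : x != 0 -> pcont (fun r => (r^-1)%:C%C : CC R) x.
Proof.
move=> x0; apply: pcont_pair; last exact: cvg_cst.
by apply: cvgV; [exact: x0|exact: cvg_id].
Qed.

Lemma pcont_ray F (a b t : R) x : cont_annulus F a b -> 0 <= a -> a <= x <= b ->
  pcont (fun r => F (rexpi r t)) x.
Proof.
move=> h a0 ab; refine (@pcont_comp _ F (fun r => rexpi r t) x _ (pcont_radial t x)).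
by apply: h; rewrite cmod_rexpi // (le_trans a0) //; case/andP: ab.
Qed.

Lemma gphi_split F (a b r0 rm r1 t0 tm t1 : R) : 0 < a -> cont_annulus F a b ->
  a <= r0 -> r0 <= rm -> rm <= r1 -> r1 <= b -> t0 <= tm -> tm <= t1 ->
  gphi F r0 r1 t0 t1 = gphi F r0 rm t0 tm + gphi F rm r1 t0 tm
    + (gphi F r0 rm tm t1 + gphi F rm r1 tm t1).
Proof.
move=> a0 hF ar0 r0m rm1 r1b t0m tm1.
have pc r x : r0 <= r <= r1 -> pcont (fun t => F (rexpi r t)) x.
  by move=> rr; apply: (pcont_circle hF); lra.
have pr t t' x : r0 <= x <= r1 ->
    pcont (fun r => (r^-1)%:C%C * (F (rexpi r t) - F (rexpi r t'))) x.
  move=> xr; have x0 : x != 0 by apply: lt0r_neq0; lra.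
  apply: (pcontM (pcont_inv x0)); apply: pcontB; apply: (pcont_ray hF); lra.
have tsplit r r' : a <= r -> r <= r' -> r' <= b -> r0 <= r -> r' <= r1 ->
    gphi F r r' t0 t1 = gphi F r r' t0 tm + gphi F r r' tm t1.
  move=> ar rr' rb rr0 rr1; rewrite /gphi.
  rewrite (@cint_split _ t0 t1 tm) //; last first.
    by move=> x _; apply: pcontB; apply: pc; lra.
  rewrite (_ : cint r r' _ = cint r r' (fun r => (r^-1)%:C%C * (F (rexpi r tm) - F (rexpi r t0))) +
     cint r r' (fun r => (r^-1)%:C%C * (F (rexpi r t1) - F (rexpi r tm)))).
    by rewrite mulrDr opprD addrACA.
  rewrite -cintD; last 2 first.
  - by move=> x xr; apply: pr; lra.
  - by move=> x xr; apply: pr; lra.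
  by apply: eq_cint => x _; rewrite -mulrDr [in RHS]addrC addrA subrK.
have rsplit t t' : t <= t' ->
    gphi F r0 r1 t t' = gphi F r0 rm t t' + gphi F rm r1 t t'.
  move=> tt'; rewrite /gphi.
  rewrite [cint r0 r1 _](@cint_split _ r0 r1 rm) //; last first.
    by move=> x xr; apply: pr; lra.
  rewrite (_ : cint t t' _ = cint t t' (fun t => F (rexpi rm t) - F (rexpi r0 t)) +
     cint t t' (fun t => F (rexpi r1 t) - F (rexpi rm t))).
    by rewrite mulrDr opprD addrACA.
  rewrite -cintD; last 2 first.
  - by move=> x _; apply: pcontB; apply: pc; lra.
  - by move=> x _; apply: pcontB; apply: pc; lra.
  by apply: eq_cint => x _; rewrite [in RHS]addrC addrA subrK.
rewrite tsplit ?rsplit //; lra.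
Qed.

(** The affine approximation contributes nothing: constants cancel in each difference, and the
    linear part gives the same multiple of [r1 - r0] on the arcs and on the rays. Only the error [E]
    remains. In the 4, one factor 2 comes from the difference of two values of [E], the other from
    [cmod_cint_le]. *)
Lemma gphi_le F (a b r0 r1 t0 t1 : R) (c z0 : CC R) B : 0 < a -> cont_annulus F a b ->
  a <= r0 -> r0 <= r1 -> r1 <= b -> t0 <= t1 ->
  (forall r t, r0 <= r <= r1 -> t0 <= t <= t1 ->
    cmod (F (rexpi r t) - F z0 - c * (rexpi r t - z0)) <= B) ->
  cmod (gphi F r0 r1 t0 t1) <= 4 * B * ((t1 - t0) + (r1 - r0) / a).
Proof.
move=> a0 hF ar0 r01 r1b t01 hB.
pose E w := F w - F z0 - c * (w - z0).
have pE (g : R -> CC R) x : pcont g x -> pcont (fun t => F (g t)) x ->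
    pcont (fun t => E (g t)) x.
  move=> hg hFg; apply: pcontB; first by apply: pcontB hFg _; exact: pcont_cst.
  by apply: pcontZ; apply: pcontB hg _; exact: pcont_cst.
have pc r x : r0 <= r <= r1 -> pcont (fun t => E (rexpi r t)) x.
  by move=> rr; apply: pE; [exact: pcont_rexpi|apply: (pcont_circle hF); lra].
have pr t t' x : r0 <= x <= r1 ->
    pcont (fun r => (r^-1)%:C%C * (E (rexpi r t) - E (rexpi r t'))) x.
  move=> xr; have x0 : x != 0 by apply: lt0r_neq0; lra.
  apply: (pcontM (pcont_inv x0)); apply: pcontB;
    (apply: pE; [exact: pcont_radial|apply: (pcont_ray hF); lra]).
pose k := (r1 - r0)%:C%C : CC R.
have e1 : cint t0 t1 (fun t => F (rexpi r1 t) - F (rexpi r0 t)) =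
    cint t0 t1 (fun t => E (rexpi r1 t) - E (rexpi r0 t)) + c * k * cint t0 t1 (rexpi 1).
  rewrite -cintZ; last by move=> x _; exact: pcont_rexpi.
  rewrite -cintD; last 2 first.
  - by move=> x _; apply: pcontB; apply: pc; lra.
  - by move=> x _; apply: pcontZ; exact: pcont_rexpi.
  apply: eq_cint => x _; rewrite /E (rexpiE r1) (rexpiE r0) /k rmorphB /=.
  by move: (rexpi 1 x) (F _) (F _) (F _) => e A A' A0; ring.
have e2 : cint r0 r1 (fun r => (r^-1)%:C%C * (F (rexpi r t1) - F (rexpi r t0))) =
    cint r0 r1 (fun r => (r^-1)%:C%C * (E (rexpi r t1) - E (rexpi r t0))) +
    c * (rexpi 1 t1 - rexpi 1 t0) * k.
  rewrite -cint_cst // -cintD; last 2 first.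
  - by move=> x xr; apply: pr; lra.
  - by move=> x _; exact: pcont_cst.
  apply: eq_cint => x xr; have x0 : (x%:C%C : CC R) != 0.
    by rewrite -cmod_gt0 /cmod /= expr0n addr0 sqrtr_sqr normr_gt0 lt0r_neq0 //; lra.
  rewrite /E (rexpiE x t1) (rexpiE x t0) fmorphV /=.
  move: x0; move: (x%:C%C : CC R) (rexpi 1 t1) (rexpi 1 t0) (F _) (F _) (F _).
  move=> y e e' A A' A0 y0.
  by field.
have -> : gphi F r0 r1 t0 t1 = gphi E r0 r1 t0 t1.
  rewrite /gphi e1 e2 -(cint_rexpi t01).
  move: (cint t0 t1 _) (cint r0 r1 _) (cint t0 t1 _) => X Y Z; ring.
have B0 : 0 <= B by apply: le_trans (hB r0 t0 _ _); rewrite ?cmod_ge0 //; lra.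
have EB r t r' t' : r0 <= r <= r1 -> t0 <= t <= t1 -> r0 <= r' <= r1 -> t0 <= t' <= t1 ->
    cmod (E (rexpi r t) - E (rexpi r' t')) <= 2 * B.
  move=> h1 h2 h3 h4; apply: le_trans (ler_cmodB _ _) _.
  by have := hB _ _ h1 h2; have := hB _ _ h3 h4; rewrite /E; lra.
have i1 : cmod ('i%C : CC R) = 1 by rewrite /cmod /= expr0n expr1n add0r sqrtr1.
rewrite /gphi; apply: le_trans (ler_cmodB _ _) _; rewrite cmodM i1 mul1r.
have h1 : cmod (cint t0 t1 (fun t => E (rexpi r1 t) - E (rexpi r0 t))) <= 2 * (2 * B * (t1 - t0)).
  apply: cmod_cint_le => //; first by move=> x _; apply: pcontB; apply: pc; lra.
  by move=> x xt; apply: EB; lra.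
have h2 : cmod (cint r0 r1 (fun r => (r^-1)%:C%C * (E (rexpi r t1) - E (rexpi r t0))))
   <= 2 * (2 * B / a * (r1 - r0)).
  apply: cmod_cint_le => //; first by move=> x xr; apply: pr.
  move=> x xr; rewrite cmodM mulrC ler_pM ?cmod_ge0 //; first by apply: EB; lra.
  rewrite /cmod /= expr0n addr0 sqrtr_sqr ger0_norm ?invr_ge0; last lra.
  by rewrite lef_pV2 ?posrE; lra.
have -> : 4 * B * (t1 - t0 + (r1 - r0) / a) = 2 * (2 * B * (t1 - t0)) + 2 * (2 * B / a * (r1 - r0)).
  by ring.
exact: lerD.
Qed.

Lemma half_pow_small (C d : R) : 0 < d -> exists n, C / 2 ^+ n < d.
Proof.
move=> d0.
have h : (fun n => C * (2^-1) ^+ n) @ \oo --> (0 : R).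
  rewrite -[X in _ --> X](mulr0 C); apply: cvgM; first exact: cvg_cst.
  by apply: cvg_expr; rewrite ger0_norm // invf_lt1 // ltr1n.
move/cvgrPdist_lt : h => /(_ _ d0) /filter_ex[n hn]; exists n.
rewrite sub0r normrN in hn; apply: le_lt_trans hn; rewrite -exprVn.
exact: ler_norm.
Qed.

Lemma gphi_eq0 F (a b t0 t1 : R) : 0 < a -> a <= b -> t0 <= t1 ->
  (forall z, a <= cmod z <= b -> exists c, cderiv F z c) ->
  gphi F a b t0 t1 = 0.
Proof.
move=> a0 ab t01 dF.
have hF : cont_annulus F a b by move=> z /dF[c /cderiv_ccont].
apply/eqP; rewrite -cmod_eq0 eq_le cmod_ge0 andbT.
suff key (eta : R) : 0 < eta -> cmod (gphi F a b t0 t1) <= eta.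
  by apply/ler_addgt0Pr => eta eta0; rewrite add0r; exact: key.
move=> eta0.
pose l := b - a; pose h := t1 - t0.
have l0 : 0 <= l by rewrite subr_ge0.
have h0 : 0 <= h by rewrite subr_ge0.
(* The two guards make the property vacuous outside the annulus; [eta / 4 ^+ n] is the share of the
   error allotted to one of the [4 ^+ n] rectangles. *)
pose P n r t := a <= r -> r + l / 2 ^+ n <= b ->
  cmod (gphi F r (r + l / 2 ^+ n) t (t + h / 2 ^+ n)) <= eta / 4 ^+ n.
suff : P 0%N a t0.
  rewrite /P !expr0 !divr1 /l /h !subrKC; exact.
have pos (k : R) n : 0 <= k -> 0 <= k / 2 ^+ n.
  by move=> k0; rewrite divr_ge0 // exprn_ge0.
apply: (@bisection2 P a t0 l h l0 h0) => [n r t IH ar rb|x y].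
  set l' := l / 2 ^+ n.+1; set h' := h / 2 ^+ n.+1.
  have l'0 : 0 <= l' by exact: pos.
  have h'0 : 0 <= h' by exact: pos.
  have lE : l / 2 ^+ n = l' + l'.
    by rewrite /l' exprS; field; rewrite expf_neq0.
  have hE : h / 2 ^+ n = h' + h'.
    by rewrite /h' exprS; field; rewrite expf_neq0.
  rewrite lE in rb *; rewrite hE.
  rewrite (@gphi_split F a b r (r + l') _ t (t + h')) //; try (move: l'0 h'0 rb; clear; lra).
  have IH1 := IH r t (or_introl erefl) (or_introl erefl).
  have IH2 := IH (r + l') t (or_intror erefl) (or_introl erefl).
  have IH3 := IH r (t + h') (or_introl erefl) (or_intror erefl).
  have IH4 := IH (r + l') (t + h') (or_intror erefl) (or_intror erefl).
  rewrite /P -/l' -/h' in IH1 IH2 IH3 IH4.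
  have rb1 : r + l' <= b by move: rb l'0; clear; lra.
  have rb2 : r + l' + l' <= b by move: rb; clear; lra.
  have ar1 : a <= r + l' by move: ar l'0; clear; lra.
  have e4 : eta / 4 ^+ n = 4 * (eta / 4 ^+ n.+1).
    by rewrite exprS; field; rewrite expf_neq0.
  move: (IH1 ar rb1) (IH2 ar1 rb2) (IH3 ar rb1) (IH4 ar1 rb2).
  rewrite e4 -!(addrA r) -!(addrA t).
  move: (gphi _ _ _ _ _) (gphi _ _ _ _ _) (gphi _ _ _ _ _) (gphi _ _ _ _ _) (eta / _).
  clear=> A B C D e.
  move=> hA hB hC hD.
  apply: le_trans (ler_cmodD _ _) _.
  apply: le_trans (lerD (ler_cmodD _ _) (ler_cmodD _ _)) _.
  lra.
have [xab|nxab] := pselect (a <= x <= b); last first.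
  by exists 0%N => r t xr _ ar rb; exfalso; apply: nxab; lra.
have x0 : 0 <= x by lra.
have xab' : a <= cmod (rexpi x y) <= b by rewrite cmod_rexpi.
have [c hc] := dF _ xab'.
(* [D / 2 ^+ n] bounds the distance of points in a rectangle of level [n], and [K / 4 ^+ n] is the
   bound of [gphi_le] per unit of derivative error. Dividing [eta] by [K + 1] avoids the case
   [K = 0]. *)
pose D := 2 * l + 2 * b * h; pose K := 4 * D * (h + l / a).
have D0 : 0 <= D by rewrite addr_ge0 // !mulr_ge0 //; lra.
have K0 : 0 <= K by rewrite !mulr_ge0 // addr_ge0 // divr_ge0 //; lra.
pose eps := eta / (K + 1).
have eps0 : 0 < eps by rewrite divr_gt0 //; lra.
have [d d0 hd] := hc _ eps0.
have [n hn] := half_pow_small D d0.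
exists n => r t xr yt ar rb.
set l' := l / 2 ^+ n in xr rb *; set h' := h / 2 ^+ n in yt *.
have p2 : 0 < 2 ^+ n :> R by rewrite exprn_gt0.
have l'0 : 0 <= l' by exact: pos.
have h'0 : 0 <= h' by exact: pos.
have DE : D / 2 ^+ n = 2 * l' + 2 * b * h' by rewrite /D /l' /h' mulrDl !mulrA.
have near u v : r <= u <= r + l' -> t <= v <= t + h' ->
    cmod (rexpi u v - rexpi x y) <= D / 2 ^+ n.
  move=> ur vt; have u0 : 0 <= u by lra.
  apply: le_trans (@rexpi_lip R u x v y u0) _; rewrite DE.
  have ux : `|u - x| <= l' by rewrite ler_norml; lra.
  have vy : `|v - y| <= h' by rewrite ler_norml; lra.
  have ub : u <= b by lra.
  have : u * `|v - y| <= b * h' by rewrite ler_pM.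
  lra.
apply: le_trans (@gphi_le F a b r (r + l') t (t + h') c (rexpi x y) (eps * (D / 2 ^+ n)) a0 hF ar _ rb _ _) _.
- lra.
- lra.
- move=> u v ur vt; have nr := near _ _ ur vt.
  by apply: le_trans (hd _ (le_lt_trans nr hn)) _; rewrite ler_wpM2l // ltW.
rewrite [t + h' - t]addrC addKr [r + l' - r]addrC addKr.
have -> : 4 * (eps * (D / 2 ^+ n)) * (h' + l' / a) = eta * (K / (K + 1)) / 4 ^+ n.
  have -> : 4 ^+ n = 2 ^+ n * 2 ^+ n :> R by rewrite -exprMn -natrM.
  have -> : eta * (K / (K + 1)) = eps * K by rewrite /eps -mulrA (mulrC K).
  by rewrite /h' /l' /K; field; rewrite expf_neq0 // gt_eqF.
rewrite ler_wpM2r ?invr_ge0 ?exprn_ge0 // ler_piMr ?(ltW eta0) //.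
by rewrite ler_pdivrMr; lra.
Qed.

Lemma rexpi_2pi (r : R) : rexpi r (pi *+ 2) = rexpi r 0.
Proof. by rewrite /rexpi cos2pi sin2pi cos0 sin0. Qed.

(** For the full turn the rays at angles 0 and [pi *+ 2] coincide, so the radial integral is 0 and
    only the two arcs are left. *)
Lemma circle_mean_const F (a b : R) : 0 < a -> a <= b ->
  (forall z, a <= cmod z <= b -> exists c, cderiv F z c) ->
  cint 0 (pi *+ 2) (fun t => F (rexpi b t)) = cint 0 (pi *+ 2) (fun t => F (rexpi a t)).
Proof.
move=> a0 ab dF.
have p2 : 0 <= (pi *+ 2 : R) by rewrite mulrn_wge0 // pi_ge0.
have hF : cont_annulus F a b by move=> z /dF[c /cderiv_ccont].
have := gphi_eq0 a0 ab p2 dF; rewrite /gphi.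
rewrite (_ : cint a b _ = 0); last first.
  rewrite (_ : cint a b _ = cint a b (fun=> 0)); last first.
    by apply: eq_cint => x _; rewrite !rexpi_2pi subrr mulr0.
  by rewrite cint_cst // mul0r.
rewrite subr0 => /eqP; rewrite mulf_eq0 => /orP[/eqP/(congr1 (@complex.Im R)) /= /eqP|].
  by rewrite oner_eq0.
rewrite cintB => [|x _|x _]; last 2 first.
- by apply: (pcont_circle hF); lra.
- by apply: (pcont_circle hF); lra.
by rewrite subr_eq0 => /eqP.
Qed.
End Goursat.

(** * Normalised circle means and their dependence on a parameter *)

Section CircleMean.
Context {R : realType}.
Implicit Types (F G : R -> CC R).

Let p2 : 0 < (pi *+ 2 : R). Proof. by rewrite mulrn_wgt0 // pi_gt0. Qed.
Let p2C : ((pi *+ 2 : R)%:C%C : CC R) != 0.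
Proof. by rewrite -cmod_gt0 /cmod /= expr0n addr0 sqrtr_sqr normr_gt0 gt_eqF. Qed.

Definition cmean F : CC R := ((pi *+ 2 : R)^-1)%:C%C * cint 0 (pi *+ 2) F.
Definition pcontT F := forall x, pcont F x.

Lemma cmod_real (x : R) : cmod (x%:C%C : CC R) = `|x|.
Proof. by rewrite /cmod /= expr0n addr0 sqrtr_sqr. Qed.

Lemma eq_cmean F G : (forall x, F x = G x) -> cmean F = cmean G.
Proof. by move=> h; rewrite /cmean (@eq_cint _ _ _ F G). Qed.
Lemma cmeanD F G : pcontT F -> pcontT G -> cmean (fun x => F x + G x) = cmean F + cmean G.
Proof. by move=> hF hG; rewrite /cmean cintD ?mulrDr // => x _. Qed.
Lemma cmeanB F G : pcontT F -> pcontT G -> cmean (fun x => F x - G x) = cmean F - cmean G.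
Proof. by move=> hF hG; rewrite /cmean cintB ?mulrBr // => x _. Qed.
Lemma cmeanZ k F : pcontT F -> cmean (fun x => k * F x) = k * cmean F.
Proof. by move=> hF; rewrite /cmean cintZ 1?mulrCA // => x _. Qed.
Lemma cmean_cst (k : CC R) : cmean (fun=> k) = k.
Proof.
by rewrite /cmean cint_cst ?(ltW p2) // subr0 fmorphV /= mulrCA (mulVf p2C) mulr1.
Qed.
Lemma cmean_le F B : pcontT F -> (forall x, 0 <= x <= pi *+ 2 -> cmod (F x) <= B) ->
  cmod (cmean F) <= 2 * B.
Proof.
move=> hF FB; rewrite /cmean cmodM cmod_real ger0_norm ?invr_ge0 ?(ltW p2) //.
rewrite mulrC ler_pdivrMr //.
apply: le_trans (cmod_cint_le (B := B) (ltW p2) _ _) _ => [x _ //|//|].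
by rewrite subr0 mulrA.
Qed.

Lemma pcontT_sum (I : Type) (s : seq I) (H : I -> R -> CC R) :
  (forall i, pcontT (H i)) -> pcontT (fun x => \sum_(i <- s) H i x).
Proof.
move=> hH; elim: s => [|i s ih] x.
  have -> : (fun x => \sum_(i <- [::]) H i x) = (fun=> 0 : CC R).
    by apply/funext => y; rewrite big_nil.
  exact: pcont_cst.
have -> : (fun x => \sum_(j <- i :: s) H j x) = (fun x => H i x + \sum_(j <- s) H j x).
  by apply/funext => y; rewrite big_cons.
by apply: pcontD; [exact: hH|exact: ih].
Qed.

Lemma cmean_sum (I : Type) (s : seq I) (H : I -> R -> CC R) : (forall i, pcontT (H i)) ->
  cmean (fun x => \sum_(i <- s) H i x) = \sum_(i <- s) cmean (H i).
Proof.
move=> hH; elim: s => [|i s ih].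
  rewrite big_nil -[RHS]cmean_cst; apply: eq_cmean => x; exact: big_nil.
rewrite big_cons -ih -cmeanD //; last exact: pcontT_sum.
by apply: eq_cmean => x; rewrite big_cons.
Qed.

(** Compactness of the segment, taken from [bisection2] with a first side of length 0. *)
Lemma uniform_in_segment (K : R -> R -> CC R) (x0 t0 h : R) : 0 <= h ->
  (forall y e, 0 < e -> exists2 d : R, 0 < d & forall x t,
     `|x - x0| < d -> `|t - y| < d -> cmod (K x t - K x0 y) <= e) ->
  forall e, 0 < e -> exists2 d : R, 0 < d & forall x t,
     `|x - x0| < d -> t0 <= t <= t0 + h -> cmod (K x t - K x0 t) <= e.
Proof.
move=> h0 hK e e0.
pose P (n : nat) (_ t : R) := exists2 d : R, 0 < d & forall x t',
     `|x - x0| < d -> t <= t' <= t + h / 2 ^+ n -> cmod (K x t' - K x0 t') <= e.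
suff : P 0%N 0 t0 by rewrite /P expr0 divr1.
apply: (@bisection2 _ P 0 t0 0 h) => // [n a t IH|x_ y].
  have hE : h / 2 ^+ n = h / 2 ^+ n.+1 + h / 2 ^+ n.+1.
    by rewrite exprS; field; rewrite expf_neq0.
  have [d d0 hd] := IH a t (or_introl erefl) (or_introl erefl).
  have [d' d'0 hd'] := IH a _ (or_introl erefl) (or_intror erefl).
  exists (Num.min d d') => [|x t']; first by rewrite lt_min d0.
  rewrite lt_min hE => /andP[xd xd'] tt.
  have [tm|tm] := leP t' (t + h / 2 ^+ n.+1).
    by apply: hd => //; rewrite tm; case/andP: tt => ->.
  by apply: hd' => //; rewrite (ltW tm) -addrA; case/andP: tt.
have e2 : 0 < e / 2 by rewrite divr_gt0.
have [d d0 hd] := hK y _ e2.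
have [n hn] := half_pow_small h d0.
exists n => a t _ yt; exists d => // x t' xd tt.
have ty : `|t' - y| < d by apply: le_lt_trans hn; rewrite ler_norml; lra.
have h1 := hd x t' xd ty; have h2 := hd x0 t'; rewrite subrr normr0 in h2.
have {}h2 := h2 d0 ty.
have -> : K x t' - K x0 t' = (K x t' - K x0 y) - (K x0 t' - K x0 y).
  by rewrite opprB addrA subrK.
by apply: le_trans (ler_cmodB _ _) _; lra.
Qed.

Lemma pcont_cmean (K : R -> R -> CC R) (x0 d1 : R) : 0 < d1 ->
  (forall x, `|x - x0| < d1 -> pcontT (K x)) ->
  (forall y e, 0 < e -> exists2 d : R, 0 < d & forall x t,
     `|x - x0| < d -> `|t - y| < d -> cmod (K x t - K x0 y) <= e) ->
  pcont (fun x => cmean (K x)) x0.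
Proof.
move=> d10 Kc hK; apply/pcontP => e e0.
have e2 : 0 < e / 4 by rewrite divr_gt0.
have [d d0 hd] := @uniform_in_segment K x0 0 _ (ltW p2) hK _ e2.
exists (Num.min d d1) => [|x]; first by rewrite lt_min d0.
rewrite lt_min => /andP[xd xd1].
have x0d1 : `|x0 - x0| < d1 by rewrite subrr normr0.
rewrite /cmean -mulrBr -cintB; last 2 first.
- by move=> t _; apply: Kc.
- by move=> t _; apply: Kc.
rewrite cmodM cmod_real ger0_norm ?invr_ge0 ?(ltW p2) // mulrC ltr_pdivrMr //.
apply: le_lt_trans (cmod_cint_le (B := e / 4) (ltW p2) _ _) _.
- by move=> t _; apply: pcontB; apply: Kc.
- by move=> t tt; apply: hd => //; rewrite add0r.
rewrite subr0 mulrA ltr_pM2r //; lra.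
Qed.

Lemma rexpi_near (s0 y d : R) : 0 < d -> exists2 d' : R, 0 < d' & forall s t,
  `|s - s0| < d' -> `|t - y| < d' -> cmod (rexpi s t - rexpi s0 y) < d.
Proof.
move=> d0; pose K : R := 4 + 2 * `|s0|.
have K0 : 0 < K by rewrite /K; have := normr_ge0 s0; lra.
exists (d / K); first by rewrite divr_gt0.
(* Continuity at radius 0 is two-sided, so negative radii occur; a negative radius is a positive one
   up to a global sign, to which [rexpi_lip] applies. *)
have lipn (s s' t t' : R) : cmod (rexpi s t - rexpi s' t') <= 2 * `|s - s'| + 2 * `|s| * `|t - t'|.
  have [sp|sn] := leP 0 s; first by rewrite (ger0_norm sp); exact: rexpi_lip.
  have e (v u : R) : rexpi v u = - rexpi (- v) u.
    by apply: CC_eqP; rewrite ?ReN ?ImN /= mulNr opprK.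
  rewrite (e s) (e s') -opprD cmodN.
  have -> : `|s - s'| = `|(- s) - (- s')| by rewrite -opprD normrN.
  by rewrite -(normrN s) (@ger0_norm _ (- s)) ?oppr_ge0 ?(ltW sn) //; apply: rexpi_lip;
    rewrite oppr_ge0 ltW.
move=> s t; rewrite !ltr_pdivlMr // => h1 h2.
rewrite -opprB cmodN; apply: le_lt_trans (lipn s0 s y t) _.
rewrite (distrC s0) (distrC y).
move: h1 h2; rewrite /K; have := normr_ge0 s0; have := normr_ge0 (s - s0).
have := normr_ge0 (t - y).
move: `|s0| `|s - s0| `|t - y| => A B C *; nra.
Qed.

Lemma pcont_circle_mean (F : CC R -> CC R) (rho s0 : R) : 0 <= s0 < rho ->
  (forall z, cmod z < rho -> ccont F z) ->
  pcont (fun s => cmean (fun t => F (rexpi s t))) s0.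
Proof.
move=> s0r Fc; have d1 : 0 < rho - s0 by lra.
have cr (s t : R) : cmod (rexpi s t) = `|s|.
  have [sp|sn] := leP 0 s; first by rewrite cmod_rexpi // ger0_norm.
  have -> : rexpi s t = - rexpi (- s) t.
    by apply: CC_eqP; rewrite ?ReN ?ImN /= mulNr opprK.
  by rewrite cmodN cmod_rexpi ?oppr_ge0 ?(ltW sn) // ltr0_norm.
apply: (pcont_cmean (K := fun s t => F (rexpi s t)) d1) => [s ss t|y e e0].
  refine (pcont_comp _ (pcont_rexpi s t)); apply: Fc; rewrite cr.
  have := ler_normD (s - s0) s0; rewrite subrK (@ger0_norm _ s0); lra.
have [|d d0 hd] := Fc (rexpi s0 y) _ _ e0; first by rewrite cr ger0_norm; lra.
have [d' d'0 hd'] := rexpi_near s0 y d0.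
by exists d' => // s t h1 h2; apply: hd; apply: hd'.
Qed.

Lemma pcont_eq_right (M : R -> CC R) (x0 b : R) (v : CC R) : x0 < b -> pcont M x0 ->
  (forall x, x0 < x < b -> M x = v) -> M x0 = v.
Proof.
move=> xb /pcontP hM Mv; apply/eqP; rewrite -subr_eq0 -cmod_eq0 eq_le cmod_ge0 andbT.
rewrite leNgt; apply/negP => /hM[d d0 hd].
pose x := x0 + Num.min (d / 2) ((b - x0) / 2).
have m0 : 0 < Num.min (d / 2) ((b - x0) / 2) by rewrite lt_min !divr_gt0 // subr_gt0.
have m1 : Num.min (d / 2) ((b - x0) / 2) <= d / 2 by rewrite ge_min lexx.
have m2 : Num.min (d / 2) ((b - x0) / 2) <= (b - x0) / 2 by rewrite ge_min lexx orbT.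
have := hd x; rewrite /x addrC addKr (gtr0_norm m0) Mv; last by lra.
by move=> /(_ ltac:(lra)); rewrite cmodBC ltxx.
Qed.

Lemma pcont_eq_left (M : R -> CC R) (x0 a : R) (v : CC R) : a < x0 -> pcont M x0 ->
  (forall x, a < x < x0 -> M x = v) -> M x0 = v.
Proof.
move=> ax hM Mv.
have h : pcont (fun x => M (- x)) (- x0).
  move/pcontP : hM => h; apply/pcontP => e /h[d d0 hd]; exists d => // y yx.
  by rewrite opprK; apply: hd; rewrite -opprD normrN -[x0]opprK.
rewrite -[x0]opprK; apply: (@pcont_eq_right (fun x => M (- x)) _ (- a)) => //.
  by rewrite ltrN2.
by move=> x xx; apply: Mv; lra.
Qed.
End CircleMean.

(** * Cauchy's formula on a disc and Taylor expansion in one variable *)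

Section CauchyTaylor.
Context {R : realType}.

Lemma cmean_const (F : CC R -> CC R) (a b : R) : 0 < a -> a <= b ->
  (forall z, a <= cmod z <= b -> exists c, cderiv F z c) ->
  cmean (fun t => F (rexpi b t)) = cmean (fun t => F (rexpi a t)).
Proof. by move=> a0 ab dF; rewrite /cmean (circle_mean_const a0 ab dF). Qed.

Lemma pcontT_circle (F : CC R -> CC R) (r : R) : 0 <= r ->
  (forall z, cmod z = r -> ccont F z) -> pcontT (fun t => F (rexpi r t)).
Proof.
move=> r0 h x; refine (pcont_comp _ (pcont_rexpi r x)).
by apply: h; rewrite cmod_rexpi.
Qed.

(* The mean of F over a circle is constant off the exceptional radius cmod a,
   continuous across it, and tends to F 0 = 0 at the centre. *)
Lemma cmean_punctured (F : CC R -> CC R) (a : CC R) (rho r : R) :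
  cmod a < r -> r < rho -> F 0 = 0 ->
  (forall z, cmod z < rho -> ccont F z) ->
  (forall z, cmod z < rho -> z != a -> exists c, cderiv F z c) ->
  cmean (fun t => F (rexpi r t)) = 0.
Proof.
move=> ar rrho F0 Fc Fd.
pose M s := cmean (fun t => F (rexpi s t)).
pose m := cmod a; have m0 : 0 <= m := cmod_ge0 a; have mr : m < r := ar.
have Mc s : 0 <= s < rho -> pcont M s by move=> sr; exact: pcont_circle_mean Fc.
have M0 : M 0 = 0.
  rewrite /M (@eq_cmean _ _ (fun=> 0)) ?cmean_cst // => x.
  by rewrite (_ : rexpi 0 x = 0) //; apply: CC_eqP; rewrite /= mul0r.
have Mcst s s' : 0 < s -> s <= s' -> s' < rho -> (s' < m) || (m < s) -> M s' = M s.
  move=> s0 ss sr sm; apply: cmean_const => // z /andP[z1 z2].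
  apply: Fd; first exact: le_lt_trans sr.
  by apply/eqP => za; move: sm z1 z2; rewrite za -/m => /orP[] ? ? ?; lra.
have Mm : M m = 0.
  have [m0'|m0'] := eqVneq m 0; first by rewrite m0'.
  have mp : 0 < m by rewrite lt0r m0'.
  have Ms s : 0 < s < m -> M s = 0.
    move=> /andP[s0 sm]; rewrite -M0; apply/esym/(@pcont_eq_right _ M 0 s) => //.
      by apply: Mc; lra.
    by move=> x /andP[x0 xs]; apply/esym/Mcst; rewrite ?(ltW xs) ?sm //; lra.
  by apply: (@pcont_eq_left _ M m 0) => //; apply: Mc; lra.
rewrite -/(M r) -Mm; apply/esym/(@pcont_eq_right _ M m r) => //.
  by apply: Mc; rewrite m0 /=; lra.
move=> x /andP[x0 xr]; apply/esym/Mcst; rewrite ?(ltW xr) ?x0 ?orbT //; lra.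
Qed.

Lemma rexpi_neq (r t : R) (a : CC R) : cmod a < r -> rexpi r t - a != 0.
Proof.
move=> ar; rewrite subr_eq0; apply: contraTneq ar => <-.
by rewrite -leNgt; have [r0|r0] := leP 0 r; [rewrite cmod_rexpi|
  exact: le_trans (ltW r0) (cmod_ge0 _)].
Qed.

Lemma cderiv_id (z : CC R) : cderiv id z 1.
Proof.
move=> e e0; exists 1 => // w _.
by rewrite mul1r subrr cmod0 mulr_ge0 ?cmod_ge0 // ltW.
Qed.

(** Cauchy's kernel for the angular measure: on a circle about 0, dz / (2 pi i (z - a)) equals z /
    (z - a) dt / (2 pi). *)
Definition ckernel (a z : CC R) : CC R := z * (z - a)^-1.

Lemma ckernel_cderiv (a z : CC R) : z != a -> exists c, cderiv (ckernel a) z c.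
Proof. by move=> za; eexists; exact: cderivM (cderiv_id z) (cderivV za). Qed.

Lemma cmod_circle_sub (r t : R) (a : CC R) : 0 <= r ->
  r - cmod a <= cmod (rexpi r t - a).
Proof. by move=> r0; have := lerB_cmod (rexpi r t) a; rewrite cmod_rexpi. Qed.

Lemma pcontT_ckernel (r : R) (a : CC R) : cmod a < r ->
  pcontT (fun t => ckernel a (rexpi r t)).
Proof.
move=> ar; have r0 : 0 <= r by rewrite (le_trans (cmod_ge0 a)) // ltW.
apply: pcontT_circle => // z zr.
have [|c /cderiv_ccont //] := @ckernel_cderiv a z.
by apply: contraTneq ar => <-; rewrite zr ltxx.
Qed.

(** The kernel is holomorphic outside the circle of radius [r], so its mean does not change when the
    radius grows, and the kernel tends to 1 at infinity. *)
Lemma cmean_ckernel (r : R) (a : CC R) : cmod a < r ->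
  cmean (fun t => ckernel a (rexpi r t)) = 1.
Proof.
move=> ar; have r0 : 0 < r := le_lt_trans (cmod_ge0 a) ar.
apply/eqP; rewrite -subr_eq0 -cmod_eq0 eq_le cmod_ge0 andbT.
suff key (e : R) : 0 < e -> cmod (cmean (fun t => ckernel a (rexpi r t)) - 1) <= e.
  by apply/ler_addgt0Pr => e e0; rewrite add0r; exact: key.
(* At this radius [cmod a / (b - cmod a)] is at most [e / 2], and [cmean_le] doubles it. *)
move=> e0; pose b := r + 2 * cmod a / e.
have q0 : 0 <= 2 * cmod a / e by rewrite divr_ge0 ?mulr_ge0 ?cmod_ge0 // ltW.
have rb : r <= b by rewrite lerDl.
have b0 : 0 <= b by lra.
rewrite -(@cmean_const (ckernel a) r b r0 rb) => [|z /andP[zr _]]; last first.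
  apply: ckernel_cderiv; apply: contraTneq ar => <-.
  by rewrite -leNgt.
rewrite -(cmean_cst 1) -cmeanB; last 2 first.
- by apply: pcontT_ckernel; apply: lt_le_trans rb.
- by move=> x; exact: pcont_cst.
apply: le_trans (cmean_le (B := e / 2) _ _) _; last by lra.
  move=> x; apply: pcontB; last exact: pcont_cst.
  by apply: pcontT_ckernel; apply: lt_le_trans rb.
move=> t _; have ba : cmod a < b by apply: lt_le_trans rb.
have za := rexpi_neq t ba; have d := cmod_circle_sub t a b0.
rewrite /ckernel (_ : _ - 1 = a * (rexpi b t - a)^-1); last first.
  by move: za; move: (rexpi b t) => z za; field.
rewrite cmodM cmodV ler_pdivrMr ?cmod_gt0 //.
apply: (@le_trans _ _ (e / 2 * (b - cmod a))); last first.
  by rewrite ler_wpM2l // divr_ge0 // ltW.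
have -> : b - cmod a = (r - cmod a) + 2 * cmod a / e by rewrite /b addrAC.
have -> : e / 2 * (r - cmod a + 2 * cmod a / e) = e / 2 * (r - cmod a) + cmod a.
  by field; rewrite gt_eqF.
by rewrite lerDr mulr_ge0 // ?subr_ge0 ?ltW // divr_gt0.
Qed.

Lemma cauchy_formula (phi : CC R -> CC R) (rho r : R) (a : CC R) :
  cmod a < r -> r < rho -> (forall z, cmod z < rho -> exists c, cderiv phi z c) ->
  cmean (fun t => phi (rexpi r t) * ckernel a (rexpi r t)) = phi a.
Proof.
move=> ar rrho dphi; have r0 : 0 <= r by rewrite (le_trans (cmod_ge0 a)) // ltW.
have arho : cmod a < rho by exact: lt_trans rrho.
have [c hc] := dphi a arho.
(* The factor [z] gives [F 0 = 0], as [cmean_punctured] demands; the value [a * c] fills the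
   removable singularity continuously. The mean of [F] is the difference of the two sides of the
   formula. *)
pose F z : CC R := if z == a then a * c else z * ((phi z - phi a) * (z - a)^-1).
have Fne z : z != a -> F z = z * ((phi z - phi a) * (z - a)^-1).
  by rewrite /F => /negbTE ->.
have phc z : cmod z < rho -> ccont phi z by move=> /dphi[d /cderiv_ccont].
have Fd z : cmod z < rho -> z != a -> exists d, cderiv F z d.
  move=> zr za; have [d hd] := dphi z zr.
  have da0 : 0 < cmod (z - a) by rewrite cmod_gt0 subr_eq0.
  eexists; apply: (@cderiv_ext _ (fun z => z * ((phi z + - phi a) * (z - a)^-1)) _ _ _ _ da0).
    move=> w wz; rewrite Fne //; apply: contraTneq wz => ->.
    by rewrite cmodBC ltxx.
  exact: cderivM (cderiv_id z) (cderivM (cderivD hd (cderiv_cst z _)) (cderivV za)).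
have Fc z : cmod z < rho -> ccont F z.
  move=> zr; have [->|za] := eqVneq z a; last by have [d /cderiv_ccont] := Fd z zr za.
  pose K := 2 + cmod a + cmod c.
  have ca0 := cmod_ge0 a; have cc0 := cmod_ge0 c.
  have K0 : 0 < K by rewrite /K; lra.
  move=> e e0.
  pose e' := Num.min 1 (e / K).
  have e'0 : 0 < e' by rewrite lt_min ltr01 divr_gt0.
  have [d d0 hd] := hc e' e'0.
  exists (Num.min d e'); first by rewrite lt_min d0.
  move=> w; rewrite lt_min => /andP[/hd h wd].
  have [->|wa] := eqVneq w a; first by rewrite subrr cmod0 ltW.
  rewrite Fne // /F eqxx.
  have wa0 : w - a != 0 by rewrite subr_eq0.
  have -> : w * ((phi w - phi a) / (w - a)) - a * c =
      w * ((phi w - phi a - c * (w - a)) / (w - a)) + (w - a) * c.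
    by move: (phi w) (phi a) => A B; field.
  apply: le_trans (ler_cmodD _ _) _; rewrite !cmodM cmodV.
  have h1 : cmod (phi w - phi a - c * (w - a)) / cmod (w - a) <= e'.
    by rewrite ler_pdivrMr // cmod_gt0.
  have h2 : cmod w <= 1 + cmod a.
    have := ler_cmodD (w - a) a; rewrite subrK.
    have : e' <= 1 by rewrite ge_min lexx.
    by move: wd; lra.
  have h3 : e' * K <= e by rewrite -ler_pdivlMr // ge_min lexx orbT.
  have h4 : cmod w * (cmod (phi w - phi a - c * (w - a)) / cmod (w - a)) <= (1 + cmod a) * e'.
    by rewrite ler_pM ?cmod_ge0 // divr_ge0 ?cmod_ge0.
  have h5 : cmod (w - a) * cmod c <= e' * cmod c by rewrite ler_wpM2r // ltW.
  move: h3 h4 h5; rewrite /K; lra.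
have F0 : F 0 = 0.
  by rewrite /F; case: eqVneq => [<-|_]; rewrite mul0r.
have := cmean_punctured ar rrho F0 Fc Fd.
have pk := pcontT_ckernel ar.
have pphi : pcontT (fun t => phi (rexpi r t)).
  by apply: pcontT_circle => // z zr; apply: phc; rewrite zr.
have ppk : pcontT (fun t => phi (rexpi r t) * ckernel a (rexpi r t)).
  by move=> x; apply: pcontM; [exact: pphi|exact: pk].
rewrite (@eq_cmean _ _ (fun t => phi (rexpi r t) * ckernel a (rexpi r t) - phi a * ckernel a (rexpi r t))).
  have pak : pcontT (fun t => phi a * ckernel a (rexpi r t)).
    by move=> x; apply: pcontZ; exact: pk.
  rewrite (cmeanB ppk pak) (cmeanZ _ pk) (cmean_ckernel ar) mulr1 => /eqP.
  by rewrite subr_eq0 => /eqP.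
move=> t; have za := rexpi_neq t ar.
rewrite Fne; last by rewrite -subr_eq0.
rewrite /ckernel; move: za; move: (phi a) (phi _) (rexpi r t) => B A z za.
by field.
Qed.

(** If [h] is the trace on the circle of radius [r] of a function holomorphic on a larger disc, this
    is Cauchy's integral for its Taylor coefficient of order [n]. *)
Definition fcoef (r : R) (h : R -> CC R) (n : nat) : CC R :=
  cmean (fun t => (rexpi r t)^-1 ^+ n * h t).

Lemma pcontT_invX (r : R) n : 0 < r -> pcontT (fun t => (rexpi r t)^-1 ^+ n).
Proof.
move=> r0; apply: (@pcontT_circle (fun z => z^-1 ^+ n)); first exact: ltW.
move=> z zr; have z0 : z != 0 by rewrite -cmod_gt0 zr.
have hV : exists c, cderiv (fun w => w^-1) z c.
  exists (- (z - 0) ^- 2).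
  by apply: (cderiv_ext (ltr01 : 0 < 1 :> R)) (cderivV z0) => w _; rewrite subr0.
suff [c] : exists c, cderiv (fun w : CC R => w^-1 ^+ n) z c by move=> /cderiv_ccont.
elim: n => [|n [c ih]]; first by exists 0; exact: cderiv_cst.
have [d hd] := hV; eexists.
by apply: (cderiv_ext (ltr01 : 0 < 1 :> R)) (cderivM hd ih) => w _; rewrite exprS.
Qed.

Lemma fcoef_le (r : R) (h : R -> CC R) (M : R) n : 0 < r -> pcontT h ->
  (forall t, 0 <= t <= pi *+ 2 -> cmod (h t) <= M) -> cmod (fcoef r h n) * r ^+ n <= 2 * M.
Proof.
move=> r0 hc hM; rewrite -ler_pdivlMr ?exprn_gt0 // -mulrA.
apply: cmean_le => [x|t tT]; first by apply: pcontM; [exact: pcontT_invX|exact: hc].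
rewrite cmodM cmodX cmodV cmod_rexpi ?(ltW r0) // exprVn [leLHS]mulrC.
by rewrite ler_wpM2r ?hM // invr_ge0 exprn_ge0 // ltW.
Qed.

Lemma ckernel_expand (a z : CC R) N : z != 0 -> z - a != 0 ->
  ckernel a z = \sum_(n < N) a ^+ n * z^-1 ^+ n + (a / z) ^+ N * ckernel a z.
Proof.
move=> z0 za; have h : (1 - a / z) * ckernel a z = 1 by rewrite /ckernel; field; rewrite ?z0 ?za.
have : (\sum_(n < N) a ^+ n * z^-1 ^+ n) = (1 - (a / z) ^+ N) * ckernel a z.
  have := subrX1 (a / z) N; under eq_bigr do rewrite exprMn.
  move=> e; rewrite -opprB e -mulNr opprB mulrAC h mul1r.
  by [].
by move=> ->; rewrite mulrBl mul1r subrK.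
Qed.

(** Cauchy's formula with the kernel expanded as a finite geometric sum: its tail carries the factor
    [(a / z) ^+ N], and the rest is bounded by means of [cmod_circle_sub]. *)
Lemma taylor_remainder (phi : CC R -> CC R) (rho r M : R) (a : CC R) N :
  cmod a < r -> r < rho -> (forall z, cmod z < rho -> exists c, cderiv phi z c) ->
  (forall t, 0 <= t <= pi *+ 2 -> cmod (phi (rexpi r t)) <= M) ->
  cmod (phi a - \sum_(n < N) a ^+ n * fcoef r (fun t => phi (rexpi r t)) n) <=
    2 * M / (1 - cmod a / r) * (cmod a / r) ^+ N.
Proof.
move=> ar rrho dphi phiM; have r0 : 0 < r := le_lt_trans (cmod_ge0 a) ar.
have pk := pcontT_ckernel ar.
have pphi : pcontT (fun t => phi (rexpi r t)).
  apply: pcontT_circle => [|z zr]; first exact: ltW.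
  by have [|d /cderiv_ccont] := dphi z; rewrite ?zr.
have pV n := @pcontT_invX r n r0.
have z0 t : rexpi r t != 0 by rewrite -[rexpi r t]subr0 rexpi_neq // cmod0.
rewrite -(cauchy_formula ar rrho dphi).
pose H (n : 'I_N) t := a ^+ n * ((rexpi r t)^-1 ^+ n * phi (rexpi r t)).
pose E t := (rexpi r t)^-1 ^+ N * (phi (rexpi r t) * ckernel a (rexpi r t)).
have pVp n : pcontT (fun t => (rexpi r t)^-1 ^+ n * phi (rexpi r t)).
  by move=> x; exact: pcontM (pV n x) (pphi x).
have pH n : pcontT (H n) by move=> x; exact: pcontZ (pVp n x).
have pS : pcontT (fun t => \sum_(n < N) H n t) := pcontT_sum pH.
have pE : pcontT E.
  by move=> x; exact: pcontM (pV N x) (pcontM (pphi x) (pk x)).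
have pE' : pcontT (fun t => a ^+ N * E t) by move=> x; exact: pcontZ (pE x).
rewrite (@eq_cmean _ _ (fun t => \sum_(n < N) H n t + a ^+ N * E t)); last first.
  move=> t; rewrite {1}(ckernel_expand N (z0 t) (rexpi_neq t ar)) mulrDr mulr_sumr.
  congr (_ + _).
    by apply: eq_bigr => n _; rewrite /H mulrCA (mulrC (phi _)).
  rewrite exprMn /E; move: (ckernel _ _) (phi _) (_ ^+ N) (_ ^+ N) => A B C D; ring.
rewrite (cmeanD pS pE') (cmean_sum _ pH) (cmeanZ _ pE).
rewrite (eq_bigr (fun n : 'I_N => a ^+ n * fcoef r (fun t => phi (rexpi r t)) n)); last first.
  by move=> n _; rewrite /H (cmeanZ _ (pVp n)).
rewrite addrC addrA [- _ + _]addrC subrr add0r.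
have M0 : 0 <= M.
  by apply: le_trans (cmod_ge0 _) (phiM 0 _); rewrite lexx mulrn_wge0 // pi_ge0.
have ra : 0 < r - cmod a by rewrite subr_gt0.
have -> : 2 * M / (1 - cmod a / r) * (cmod a / r) ^+ N =
    cmod a ^+ N * (2 * (M * (r / (r - cmod a)) / r ^+ N)).
  rewrite expr_div_n; field.
  by rewrite expf_neq0 ?gt_eqF //.
rewrite cmodM cmodX ler_wpM2l ?exprn_ge0 ?cmod_ge0 //.
apply: cmean_le => // t tT.
rewrite !cmodM cmodX !cmodV cmod_rexpi ?(ltW r0) // exprVn [leLHS]mulrC.
rewrite ler_wpM2r ?invr_ge0 ?exprn_ge0 ?(ltW r0) // ler_pM ?cmod_ge0 ?mulr_ge0 ?invr_ge0 ?cmod_ge0 ?phiM ?(ltW r0) //.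
rewrite ler_wpM2l ?(ltW r0) // lef_pV2 ?posrE ?cmod_gt0 ?rexpi_neq //.
by apply: cmod_circle_sub; exact: ltW.
Qed.
End CauchyTaylor.

(** * Holomorphic functions of two variables are double power series on smaller polydiscs *)

Section TwoVariableTaylor.
Context {R : realType}.

Lemma fcoef_subsum (r : R) (h : R -> CC R) (w : CC R) (d : nat -> R -> CC R) N m :
  0 < r -> pcontT h -> (forall n, pcontT (d n)) ->
  fcoef r (fun t => h t - \sum_(n < N) w ^+ n * d n t) m =
  fcoef r h m - \sum_(n < N) w ^+ n * fcoef r (d n) m.
Proof.
move=> r0 hc dc; have pV := @pcontT_invX R r m r0.
pose H (n : 'I_N) t := w ^+ n * ((rexpi r t)^-1 ^+ m * d n t).
have pVd n : pcontT (fun t => (rexpi r t)^-1 ^+ m * d n t).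
  by move=> x; exact: pcontM (pV x) (dc n x).
have pH n : pcontT (H n) by move=> x; exact: pcontZ (pVd n x).
have pVh : pcontT (fun t => (rexpi r t)^-1 ^+ m * h t).
  by move=> x; exact: pcontM (pV x) (hc x).
rewrite /fcoef (@eq_cmean _ _ (fun t => (rexpi r t)^-1 ^+ m * h t - \sum_(n < N) H n t)).
  rewrite (cmeanB pVh (pcontT_sum pH)) (cmean_sum _ pH); congr (_ - _).
  by apply: eq_bigr => n _; rewrite /H (cmeanZ _ (pVd n)).
move=> t; rewrite mulrBr mulr_sumr; congr (_ - _).
by apply: eq_bigr => n _; rewrite /H mulrCA.
Qed.

Lemma pcontT_fcoef (K : R -> R -> CC R) (r : R) n : 0 < r ->
  (forall x, pcontT (K x)) ->
  (forall x0 y e, 0 < e -> exists2 d : R, 0 < d & forall x t,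
     `|x - x0| < d -> `|t - y| < d -> cmod (K x t - K x0 y) <= e) ->
  pcontT (fun x => fcoef r (K x) n).
Proof.
move=> r0 Kc hK x0; have pV := @pcontT_invX R r n r0.
apply: (pcont_cmean (K := fun x t => (rexpi r t)^-1 ^+ n * K x t) ltr01) => [x _|y e e0].
  by move=> t; exact: pcontM (pV t) (Kc x t).
pose V := r^-1 ^+ n; have V0 : 0 < V by rewrite exprn_gt0 // invr_gt0.
have VE t : cmod ((rexpi r t)^-1 ^+ n) = V.
  by rewrite cmodX cmodV cmod_rexpi // ltW.
have e1 : 0 < e / (2 * V) by rewrite divr_gt0 // mulr_gt0.
have [d d0 hd] := hK x0 y _ e1.
have k0 := cmod_ge0 (K x0 y).
have e2 : 0 < e / (2 * (1 + cmod (K x0 y))) by rewrite divr_gt0 // mulr_gt0 //; lra.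
have /pcontP/(_ _ e2)[d' d'0 hd'] := pV y.
exists (Num.min d d') => [|x t]; first by rewrite lt_min d0.
rewrite !lt_min => /andP[x1 _] /andP[t1 t2].
have h1 := hd x t x1 t1; have h2 := hd' t t2.
have -> : (rexpi r t)^-1 ^+ n * K x t - (rexpi r y)^-1 ^+ n * K x0 y =
  (rexpi r t)^-1 ^+ n * (K x t - K x0 y) +
  ((rexpi r t)^-1 ^+ n - (rexpi r y)^-1 ^+ n) * K x0 y.
  by rewrite mulrBr mulrBl addrA subrK.
apply: le_trans (ler_cmodD _ _) _; rewrite !cmodM VE.
rewrite (splitr e) lerD //.
  have -> : e / 2 = V * (e / (2 * V)) by field; rewrite gt_eqF.
  by rewrite ler_wpM2l // ltW.
apply: (@le_trans _ _ (e / (2 * (1 + cmod (K x0 y))) * cmod (K x0 y))).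
  by rewrite ler_wpM2r // ltW.
rewrite mulrAC ler_pdivrMr ?mulr_gt0 //; last by lra.
have -> : e / 2 * (2 * (1 + cmod (K x0 y))) = e * (1 + cmod (K x0 y)) by field.
by rewrite ler_wpM2l ?(ltW e0) //; lra.
Qed.

Lemma bounded_on_torus (K : R -> R -> CC R) (T : R) : 0 <= T ->
  (forall x0 y e, 0 < e -> exists2 d : R, 0 < d & forall x t,
     `|x - x0| < d -> `|t - y| < d -> cmod (K x t - K x0 y) <= e) ->
  exists B : R, forall x t, 0 <= x <= T -> 0 <= t <= T -> cmod (K x t) <= B.
Proof.
move=> T0 hK.
pose P n a b := exists B : R, forall x t, a <= x <= a + T / 2 ^+ n ->
   b <= t <= b + T / 2 ^+ n -> cmod (K x t) <= B.
suff : P 0%N 0 0 by rewrite /P expr0 divr1 add0r.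
apply: (@bisection2 _ P 0 0 T T) => // [n a b IH|x y].
  have hE : T / 2 ^+ n = T / 2 ^+ n.+1 + T / 2 ^+ n.+1.
    by rewrite exprS; field; rewrite expf_neq0.
  have [B1 h1] := IH _ _ (or_introl erefl) (or_introl erefl).
  have [B2 h2] := IH _ _ (or_introl erefl) (or_intror erefl).
  have [B3 h3] := IH _ _ (or_intror erefl) (or_introl erefl).
  have [B4 h4] := IH _ _ (or_intror erefl) (or_intror erefl).
  exists (Num.max (Num.max B1 B2) (Num.max B3 B4)) => x t.
  rewrite hE !addrA => /andP[xa xb] /andP[ta tb].
  rewrite !le_max; have [xm|/ltW xm] := leP x (a + T / 2 ^+ n.+1);
    have [tm|/ltW tm] := leP t (b + T / 2 ^+ n.+1).
  - by rewrite h1 ?xa ?ta.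
  - by rewrite h2 ?orbT ?xa ?tm.
  - by rewrite h3 ?orbT ?xm ?ta.
  - by rewrite h4 ?orbT ?xm ?tm.
have [d d0 hd] := hK x y 1 ltr01.
have [n hn] := half_pow_small T d0.
exists n => a b xa yb; exists (1 + cmod (K x y)) => x' t' xx tt.
have h : cmod (K x' t' - K x y) <= 1.
  by apply: hd; apply: le_lt_trans hn; rewrite ler_norml; lra.
by have := ler_cmodD (K x' t' - K x y) (K x y); rewrite subrK; lra.
Qed.

Lemma torus_cont (f : CC R * CC R -> CC R) (r : R) : 0 < r -> r < 1 -> holomorphic2 f ->
  forall x0 y e, 0 < e -> exists2 d : R, 0 < d & forall x t,
     `|x - x0| < d -> `|t - y| < d ->
     cmod (f (rexpi r x, rexpi r t) - f (rexpi r x0, rexpi r y)) <= e.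
Proof.
move=> r0 r1 hf x0 y e e0.
have zD : inD2 (rexpi r x0, rexpi r y).
  have cr t : cmod (rexpi r t) < 1 by rewrite cmod_rexpi ?(ltW r0).
  by split; exact: cr.
have [/ccont2P/(_ _ e0)[d d0 hd] _ _] := hf _ zD.
have [d1 d10 hd1] := rexpi_near r x0 d0.
have [d2 d20 hd2] := rexpi_near r y d0.
exists (Num.min d1 d2) => [|x t]; first by rewrite lt_min d10.
rewrite !lt_min => /andP[x1 _] /andP[_ t2].
by apply: hd => /=; [apply: hd1|apply: hd2]; rewrite // subrr normr0.
Qed.

Lemma hol_sections (f : CC R * CC R -> CC R) (w : CC R) : holomorphic2 f -> cmod w < 1 ->
  (forall z, cmod z < 1 -> exists c, cderiv (fun x => f (x, w)) z c) /\
  (forall z, cmod z < 1 -> exists c, cderiv (fun x => f (w, x)) z c).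
Proof.
move=> hf w1; split => z z1.
  have [//|_ h _] := hf (z, w); eexists; exact: derivable_cderiv h.
have [//|_ _ h] := hf (w, z); eexists; exact: derivable_cderiv h.
Qed.

(** Taylor expansion is applied in one variable at a time. Square partial sums are compared with
    [f z] in two moves: the remainder in [z.1], and for each coefficient in [z.1] the Fourier
    coefficient of the remainder in [z.2], which is small uniformly along the first circle. *)
Theorem holomorphic2_psfun (f : CC R * CC R -> CC R) (r : R) : 0 < r -> r < 1 ->
  holomorphic2 f -> exists a M, bddc r M a /\
    forall z, cmod z.1 < r -> cmod z.2 < r -> f z = psfun a z.
Proof.
move=> r0 r1 hf.
pose K x t := f (rexpi r x, rexpi r t).
have Kj := torus_cont r0 r1 hf : forall x0 y e, 0 < e -> exists2 d : R, 0 < d & forall x t,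
     `|x - x0| < d -> `|t - y| < d -> cmod (K x t - K x0 y) <= e.
have cr t : cmod (rexpi r t) < 1 by rewrite cmod_rexpi ?(ltW r0).
have pK x : pcontT (K x).
  apply: (@pcontT_circle _ (fun w => f (rexpi r x, w))); first exact: ltW.
  move=> z zr; have [_ h] := hol_sections hf (cr x).
  by have [|c /cderiv_ccont //] := h z; rewrite zr.
have T0 : 0 <= (pi *+ 2 : R) by rewrite mulrn_wge0 // pi_ge0.
have [B hB] := bounded_on_torus T0 Kj.
have B0 : 0 <= B.
  by apply: le_trans (cmod_ge0 _) (hB 0 0 _ _); rewrite lexx T0.
pose d n x := fcoef r (K x) n.
have pd n : pcontT (d n) by exact: pcontT_fcoef.
have dB n x : 0 <= x <= pi *+ 2 -> cmod (d n x) <= 2 * B / r ^+ n.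
  move=> xT; rewrite ler_pdivlMr ?exprn_gt0 //.
  by apply: fcoef_le => // t tT; exact: hB.
pose a m n := fcoef r (d n) m.
have ha : bddc r (4 * B) a.
  move=> m n; rewrite exprD mulrA -ler_pdivlMr ?exprn_gt0 //.
  have -> : 4 * B / r ^+ n = 2 * (2 * B / r ^+ n) by rewrite !mulrA -natrM.
  exact: fcoef_le (dB n).
exists a, (4 * B); split => // z z1 z2.
apply/esym/ccvg_limn/cvg_cmodP => e e0.
pose q1 := cmod z.1 / r; pose q2 := cmod z.2 / r.
have q10 : 0 <= q1 by rewrite divr_ge0 ?cmod_ge0 // ltW.
have q20 : 0 <= q2 by rewrite divr_ge0 ?cmod_ge0 // ltW.
have q11 : q1 < 1 by rewrite ltr_pdivrMr // mul1r.
have q21 : q2 < 1 by rewrite ltr_pdivrMr // mul1r.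
(* [A2] is the constant of [taylor_remainder] in the second variable; its case [N = 0] bounds [h] on
   the first circle, so [A1] is the same constant one level up. *)
pose A2 := 2 * B / (1 - q2); pose A1 := 2 * A2 / (1 - q1).
pose h t := f (rexpi r t, z.2).
have z21 : cmod z.2 < 1 by exact: lt_trans z2 r1.
have z11 : cmod z.1 < 1 by exact: lt_trans z1 r1.
have ph : pcontT h.
  apply: (@pcontT_circle _ (fun w => f (w, z.2))); first exact: ltW.
  move=> w wr; have [k _] := hol_sections hf z21.
  by have [|c /cderiv_ccont //] := k w; rewrite wr.
have inner t N : 0 <= t <= pi *+ 2 ->
    cmod (h t - \sum_(n < N) z.2 ^+ n * d n t) <= A2 * q2 ^+ N.
  move=> tT; have [_ k] := hol_sections hf (cr t).
  by apply: (taylor_remainder N z2 r1 k) => s sT; exact: hB.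
have hA t : 0 <= t <= pi *+ 2 -> cmod (h t) <= A2.
  by move=> tT; have := inner t 0%N tT; rewrite big_ord0 subr0 mulr1.
have outer N : cmod (f z - \sum_(m < N) z.1 ^+ m * fcoef r h m) <= A1 * q1 ^+ N.
  have [k _] := hol_sections hf z21.
  have := taylor_remainder N z1 r1 k hA.
  by rewrite -surjective_pairing.
have A20 : 0 <= A2 by rewrite !divr_ge0 ?mulr_ge0 // subr_ge0 ltW.
have mid N m : cmod (fcoef r h m - \sum_(n < N) z.2 ^+ n * a m n) <= 2 * (A2 * q2 ^+ N) / r ^+ m.
  rewrite -(fcoef_subsum _ _ _ r0 ph pd) ler_pdivlMr ?exprn_gt0 //.
  apply: (fcoef_le _ r0) => [x|t tT]; last exact: inner.
  apply: pcontB; first exact: ph.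
  apply: (pcontT_sum (H := fun (n : 'I_N) t => z.2 ^+ n * d n t)) => n y.
  by apply: pcontZ; exact: pd.
have tot N : cmod (psum a z N - f z) <= A1 * q1 ^+ N + 2 * A2 / (1 - q1) * q2 ^+ N.
  rewrite cmodBC.
  have gen (X Y Z : CC R) : X - Z = (X - Y) + (Y - Z) by rewrite addrA subrK.
  have -> : f z - psum a z N = (f z - \sum_(m < N) z.1 ^+ m * fcoef r h m) +
     \sum_(m < N) z.1 ^+ m * (fcoef r h m - \sum_(n < N) z.2 ^+ n * a m n).
    rewrite (gen _ (\sum_(m < N) z.1 ^+ m * fcoef r h m)); congr (_ + _).
    rewrite /psum -sumrB; apply: eq_bigr => m _.
    rewrite mulrBr mulr_sumr; congr (_ - _); apply: eq_bigr => n _.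
    by rewrite mulrCA mulrC mulrA mulrAC -mulrA.
  apply: le_trans (ler_cmodD _ _) _; rewrite lerD //.
  apply: le_trans (ler_cmod_sum _ _ _) _.
  apply: (@le_trans _ _ (\sum_(m < N) 2 * (A2 * q2 ^+ N) * q1 ^+ m)).
    apply: ler_sum => m _; rewrite cmodM cmodX /q1 [(cmod z.1 / r) ^+ m]expr_div_n [leRHS]mulrCA.
    by rewrite ler_wpM2l ?exprn_ge0 ?cmod_ge0 //; exact: mid.
  rewrite -mulr_sumr -/(geosum q1 N).
  have -> : 2 * A2 / (1 - q1) * q2 ^+ N = 2 * (A2 * q2 ^+ N) * (1 - q1)^-1 by rewrite mulrAC mulrA.
  by rewrite ler_wpM2l ?geosum_le // mulr_ge0 // mulr_ge0 // exprn_ge0.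
have lim0 : (fun N => A1 * q1 ^+ N + 2 * A2 / (1 - q1) * q2 ^+ N) @ \oo --> (0 : R).
  have hq (A q : R) : 0 <= q -> q < 1 -> (fun N => A * q ^+ N) @ \oo --> (0 : R).
    move=> q0 q_1; rewrite -[X in _ --> X](mulr0 A); apply: cvgM; first exact: cvg_cst.
    by apply: cvg_expr; rewrite ger0_norm.
  rewrite -[X in _ --> X](addr0 0).
  exact: cvgD (hq A1 q1 q10 q11) (hq (2 * A2 / (1 - q1)) q2 q20 q21).
move/cvgrPdist_lt : lim0 => /(_ _ e0); apply: filterS => N; rewrite sub0r normrN.
by move=> /(le_lt_trans (ler_norm _)); apply: le_lt_trans.
Qed.
End TwoVariableTaylor.

(** * The quotient as a holomorphic function *)

Section DivisionHolomorphic.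
Context {R : realType}.
Implicit Types (f F : CC R * CC R -> CC R) (z : CC R * CC R).

Lemma ccont2_ext (F G : CC R * CC R -> CC R) z (d : R) : 0 < d ->
  (forall w : CC R * CC R, cmod (w.1 - z.1) < d -> cmod (w.2 - z.2) < d -> G w = F w) ->
  {for z, continuous G} -> {for z, continuous F}.
Proof.
move=> d0 GF /ccont2P h; apply/ccont2P => e /h[d' d'0 hd'].
exists (Num.min d d') => [|w]; first by rewrite lt_min d0.
rewrite !lt_min => /andP[w1 w1'] /andP[w2 w2'].
by rewrite -!GF ?subrr ?cmod0 //; exact: hd'.
Qed.

Lemma derivable_ext (f g : CC R -> CC R) (z : CC R) (d : R) : 0 < d ->
  (forall w, cmod (w - z) < d -> f w = g w) -> derivable f z 1 -> derivable g z 1.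
Proof.
by move=> d0 fg /derivable_cderiv h; apply: cderiv_derivable (cderiv_ext d0 fg h).
Qed.

Lemma polydisc_nbhs (r : R) z : cmod z.1 < r -> cmod z.2 < r ->
  exists2 d : R, 0 < d & forall w v, cmod (w - z.1) < d -> cmod (v - z.2) < d ->
    cmod w < r /\ cmod v < r.
Proof.
move=> z1 z2; exists (Num.min (r - cmod z.1) (r - cmod z.2)).
  by rewrite lt_min !subr_gt0 z1 z2.
move=> w v; rewrite !lt_min => /andP[w1 _] /andP[_ v2].
have := ler_cmodD (w - z.1) z.1; have := ler_cmodD (v - z.2) z.2.
by rewrite !subrK; split; lra.
Qed.

Definition regular_at F z : Prop :=
  [/\ {for z, continuous F}, derivable (fun w => F (w, z.2)) z.1 1
    & derivable (fun w => F (z.1, w)) z.2 1].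

Lemma regular_ext (F G : CC R * CC R -> CC R) (r : R) z :
  cmod z.1 < r -> cmod z.2 < r ->
  (forall w : CC R * CC R, cmod w.1 < r -> cmod w.2 < r -> G w = F w) ->
  regular_at G z -> regular_at F z.
Proof.
move=> z1 z2 GF [h1 h2 h3]; have [d d0 hd] := polydisc_nbhs z1 z2.
have s (w : CC R) : cmod (w - w) < d by rewrite subrr cmod0.
split.
- by apply: ccont2_ext d0 _ h1 => w w1 w2; have [? ?] := hd _ _ w1 w2; exact: GF.
- apply: derivable_ext d0 _ h2 => w w1; have [? ?] := hd _ _ w1 (s z.2); exact: GF.
- apply: derivable_ext d0 _ h3 => w w2; have [? ?] := hd _ _ (s z.1) w2; exact: GF.
Qed.

Lemma psfun_regular (r M : R) a z : 0 < r -> bddc r M a ->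
  cmod z.1 < r -> cmod z.2 < r -> regular_at (psfun a) z.
Proof.
move=> r0 ha z1 z2; split; first exact: psfun_cont ha z1 z2.
  exact: cderiv_derivable (psfun_cderiv1 r0 ha z1 z2).
exact: cderiv_derivable (psfun_cderiv2 r0 ha z1 z2).
Qed.

Lemma dpsfun_regular (r M : R) a z : 0 < r -> bddc r M a ->
  cmod z.1 < r -> cmod z.2 < r ->
  regular_at (fun y : CC R * CC R => dpsfun a y.1 y.2) z.
Proof.
move=> r0 ha; case: z => p v /= z1 z2; split; first exact: dpsfun_cont ha z1 z2.
  exact: dpsfun_derivable1 ha z1 z2.
exact: dpsfun_derivable2 ha z1 z2.
Qed.

Lemma d1_psfun f (r M : R) a : 0 < r -> bddc r M a ->
  (forall z, cmod z.1 < r -> cmod z.2 < r -> f z = psfun a z) ->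
  forall z, cmod z.1 < r -> cmod z.2 < r -> d1 f z = dpsfun a z.1 z.2.
Proof.
move=> r0 ha fa z z1 z2; apply: cderiv_derive.
have [d d0 hd] := polydisc_nbhs z1 z2.
apply: (cderiv_ext d0) (psfun_cderiv1 r0 ha z1 z2) => w w1.
have z22 : cmod (z.2 - z.2) < d by rewrite subrr cmod0.
by have [wr _] := hd w z.2 w1 z22; rewrite (fa (w, z.2)).
Qed.

Lemma inD2_between z : inD2 z -> exists2 r : R, 0 < r < 1 & cmod z.1 < r /\ cmod z.2 < r.
Proof.
move=> [z1 z2]; have [s s1 [zs1 zs2]] := between2 z1 z2.
exists s; last by split.
by rewrite s1 andbT; exact: le_lt_trans (cmod_ge0 z.1) zs1.
Qed.

Lemma holomorphic2_d1 f : holomorphic2 f -> holomorphic2 (d1 f).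
Proof.
move=> hf z /inD2_between[r /andP[r0 r1] [z1 z2]].
have [a [M [ha fa]]] := holomorphic2_psfun r0 r1 hf.
apply: (regular_ext z1 z2 _ (dpsfun_regular r0 ha z1 z2)) => w w1 w2.
exact/esym/(d1_psfun r0 ha fa).
Qed.

Definition swapf f : CC R * CC R -> CC R := fun z => f (z.2, z.1).

Lemma holomorphic2_swap f : holomorphic2 f -> holomorphic2 (swapf f).
Proof.
move=> hf [u v] [/= u1 v1]; have [//|/ccont2P h1 h2 h3] := hf (v, u).
split; [|exact: h3|exact: h2].
apply/ccont2P => e /h1[d d0 hd]; exists d; first exact: d0.
by move=> w w1 w2; exact: (hd (w.2, w.1)).
Qed.

Lemma holomorphic2_d2 f : holomorphic2 f -> holomorphic2 (d2 f).
Proof.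
by move=> hf; exact: (holomorphic2_swap (holomorphic2_d1 (holomorphic2_swap hf))).
Qed.

(** When [f] vanishes on the line [z.1 = lam], its derivative in the first variable is the limit of
    the quotient there, so this is the holomorphic extension. *)
Definition divf (lam : CC R) f z : CC R :=
  if z.1 == lam then d1 f z else f z / (z.1 - lam).

Section Division.
Context (lam : CC R) (f : CC R * CC R -> CC R)
  (f0 : forall z, inD2 z -> z.1 = lam -> f z = 0).

Lemma divfE z : inD2 z -> f z = (z.1 - lam) * divf lam f z.
Proof.
move=> zD; rewrite /divf; case: eqVneq => [zl|zl].
  by rewrite zl subrr mul0r f0.
by rewrite mulrC divfK // subr_eq0.
Qed.

Lemma divf_psfun (r M : R) a : 0 < r -> r <= 1 -> bddc r M a -> cmod lam < r ->
  (forall z, cmod z.1 < r -> cmod z.2 < r -> f z = psfun a z) ->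
  forall z, cmod z.1 < r -> cmod z.2 < r -> divf lam f z = psfun (divc lam a) z.
Proof.
move=> r0 r1 ha lr fa z z1 z2; rewrite /divf; case: eqVneq => [zl|zl].
  by rewrite (d1_psfun r0 ha fa z1 z2) /dpsfun zl [in RHS](surjective_pairing z) zl.
have h := psfun_divc r0 ha lr z1 z2.
rewrite -!fa // (@f0 (lam, z.2)) // ?subr0 in h; last first.
  by split; [exact: lt_le_trans r1|exact: lt_le_trans r1].
by rewrite h mulrC mulKf // subr_eq0.
Qed.

Lemma holomorphic2_divf : cmod lam < 1 -> holomorphic2 f -> holomorphic2 (divf lam f).
Proof.
move=> l1 hf z [z1 z2].
have [r r1 [z1r lr]] := @between2 _ 1 (z.1, lam) z1 l1.
have rE : cmod (r%:C%C : CC R) = r.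
  by rewrite cmod_real ger0_norm // (le_trans (cmod_ge0 _) (ltW lr)).
have rr1 : cmod (r%:C%C : CC R) < 1 by rewrite rE.
(* The polydisc has to contain [lam] as well as both coordinates; regarding [r] as a complex number
   lets [between2] give one radius above all three. *)
have [s s1 [sz sr]] := @between2 _ 1 (z.2, r%:C%C) z2 rr1.
rewrite [(_, _).2]/= rE in sr; rewrite [(_, _).1]/= in sz.
have s0 : 0 < s by rewrite (le_lt_trans (cmod_ge0 _) sz).
have [a [M [ha fa]]] := holomorphic2_psfun s0 s1 hf.
have ls : cmod lam < s by exact: lt_trans sr.
have z1s : cmod z.1 < s by exact: lt_trans sr.
apply: (regular_ext z1s sz _ (psfun_regular s0 (bddc_divc s0 ha ls) z1s sz)) => w w1 w2.
exact/esym/(divf_psfun s0 (ltW s1) ha ls fa).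
Qed.

Lemma d2_divf z : z.1 != lam -> derivable (fun w => f (z.1, w)) z.2 1 ->
  d2 (divf lam f) z = d2 f z / (z.1 - lam).
Proof.
move=> zl /derivable_cderiv h; apply: cderiv_derive; rewrite mulrC.
have := cderivM (cderiv_cst z.2 (z.1 - lam)^-1) h.
rewrite mulr0 addr0; apply: (cderiv_ext (ltr01 : 0 < 1 :> R)) => w _.
by rewrite /divf /= (negbTE zl) mulrC.
Qed.
End Division.
End DivisionHolomorphic.

(** * Division in the Hardy space *)

Section HardyDivision.
Context {R : realType}.

Lemma cmod_sqr_split (x y : CC R) (del : R) : 0 < del ->
  cmod (x + y) ^+ 2 <= (1 + del^-1) * cmod x ^+ 2 + (1 + del) * cmod y ^+ 2.
Proof.
move=> d0; have x0 := cmod_ge0 x; have y0 := cmod_ge0 y.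
apply: (@le_trans _ _ ((cmod x + cmod y) ^+ 2)).
  by rewrite lerXn2r ?nnegrE ?cmod_ge0 ?addr_ge0 // ler_cmodD.
rewrite -subr_ge0.
have -> : (1 + del^-1) * cmod x ^+ 2 + (1 + del) * cmod y ^+ 2 - (cmod x + cmod y) ^+ 2
   = del^-1 * (cmod x - del * cmod y) ^+ 2 by field; rewrite gt_eqF.
by rewrite mulr_ge0 ?sqr_ge0 // invr_ge0 ltW.
Qed.

(** With [del = (1 - l ^+ 2) / 2] the factor [q] equals l^2 (3 - l^2) / 2, which is below 1. These
    constants absorb the term multiplied by [lam] twice: for Hardy coefficients and for Dirichlet
    integrals. *)
Lemma square_split (l : R) : 0 <= l < 1 ->
  exists C q del : R, [/\ 0 < del, C = 1 + del^-1, q = (1 + del) * l ^+ 2 & 0 <= q < 1].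
Proof.
move=> /andP[l0 l1].
have l2 : l ^+ 2 < 1 by rewrite expr_lt1.
have l20 : 0 <= l ^+ 2 by rewrite exprn_ge0.
pose del := (1 - l ^+ 2) / 2; have del0 : 0 < del by rewrite /del; lra.
exists (1 + del^-1), ((1 + del) * l ^+ 2), del; split => //.
apply/andP; split; first by rewrite mulr_ge0 // addr_ge0 // ltW.
rewrite /del; nra.
Qed.

(** Absorption cannot be done in one stroke, since the recursion compares a block with its shift by
    one row. Iterating it [J] times gives a geometric sum of the known terms plus [q ^+ J] times a
    shifted block, and letting [J] grow leaves a bound free of [N] and [L]. *)
Lemma divc_square_sums (r M S : R) a p : 0 < r -> r = 1 -> bddc r M a -> cmod p < r ->
  (forall N L s, \sum_(m < N) \sum_(n < L) cmod (a (m + s)%N n) ^+ 2 <= S) ->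
  exists T : R, forall N L, \sum_(m < N) \sum_(n < L) cmod (divc p a m n) ^+ 2 <= T.
Proof.
move=> r0 rE ha pr aS; have hb := bddc_divc r0 ha pr.
have pl : 0 <= cmod p < 1 by rewrite cmod_ge0 -rE.
have [C [q [del [del0 CE qE /andP[q0 q1]]]]] := square_split pl.
have C0 : 0 <= C by rewrite CE addr_ge0 // invr_ge0 ltW.
have S0 : 0 <= S by have := aS 0%N 0%N 0%N; rewrite big_ord0.
exists (C * S / (1 - q)) => N L.
pose T s := \sum_(m < N) \sum_(n < L) cmod (divc p a (m + s)%N n) ^+ 2.
have step s : T s <= C * S + q * T s.+1.
  apply: (@le_trans _ _ (\sum_(m < N) \sum_(n < L)
     (C * cmod (a (m + s.+1)%N n) ^+ 2 + q * cmod (divc p a (m + s.+1)%N n) ^+ 2))).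
    apply: ler_sum => m _; apply: ler_sum => n _; rewrite (divcS _ _ r0 ha pr) addnS.
    apply: le_trans (cmod_sqr_split _ _ del0) _.
    by rewrite CE qE cmodM exprMn -[X in _ <= _ + X]mulrA.
  under eq_bigr do rewrite big_split /= -!mulr_sumr.
  by rewrite big_split /= -!mulr_sumr lerD2r ler_wpM2l //; exact: aS.
set M' := M / _ in hb; have M'0 := bddc_ge0 hb.
(* A crude bound that depends on the size of the block but not on the shift, so that [q ^+ J] can
   kill it. *)
have Tb s : T s <= N%:R * (L%:R * M' ^+ 2).
  apply: (@le_trans _ _ (\sum_(m < N) \sum_(n < L) M' ^+ 2)).
    apply: ler_sum => m _; apply: ler_sum => n _.
    rewrite lerXn2r ?nnegrE ?cmod_ge0 //.
    by have := hb (m + s)%N n; rewrite rE expr1n mulr1.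
  by rewrite !sumr_const !card_ord !mulr_natl.
set K := N%:R * _ in Tb.
have iter J : T 0%N <= C * S * geosum q J + q ^+ J * T J.
  elim: J => [|J ih]; first by rewrite /geosum big_ord0 mulr0 add0r expr0 mul1r.
  have h := ler_wpM2l (exprn_ge0 J q0) (step J).
  rewrite [q ^+ J * (_ + _)]mulrDr [q ^+ J * (q * _)]mulrA -exprSr in h.
  by rewrite geosumS; move: ih h; lra.
have -> : \sum_(m < N) \sum_(n < L) cmod (divc p a m n) ^+ 2 = T 0%N.
  by apply: eq_bigr => m _; apply: eq_bigr => n _; rewrite addn0.
have K0 : 0 <= K by rewrite /K mulr_ge0 ?ler0n // mulr_ge0 ?ler0n // sqr_ge0.
suff key (e : R) : 0 < e -> T 0%N <= C * S / (1 - q) + e.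
  by apply/ler_addgt0Pr => e e0; exact: key.
move=> e0.
have lim0 : (fun J => K * q ^+ J) @ \oo --> (0 : R).
  rewrite -[X in _ --> X](mulr0 K); apply: cvgM; first exact: cvg_cst.
  by apply: cvg_expr; rewrite ger0_norm.
move/cvgrPdist_lt : lim0 => /(_ _ e0)/filter_ex[J]; rewrite sub0r normrN => hJ.
apply: le_trans (iter J) _; rewrite lerD //.
  by rewrite ler_wpM2l ?mulr_ge0 // geosum_le.
apply: le_trans (ltW (le_lt_trans (ler_norm _) hJ)); rewrite mulrC ler_wpM2r ?exprn_ge0 //.
Qed.

Lemma esum_nat2 (u : nat -> nat -> R) : (forall m n, 0 <= u m n) ->
  (\esum_(p in [set: nat * nat]) (u p.1 p.2)%:E =
   \sum_(0 <= m <oo) \sum_(0 <= n <oo) (u m n)%:E)%E.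
Proof.
move=> u0; rewrite nneseries_esum => [|m _]; last first.
  by apply: nneseries_ge0 => n _ _; rewrite lee_fin.
have -> : [set: nat * nat] = [set: nat] `*`` (fun=> [set: nat]).
  by apply/seteqP; split=> -[m n].
rewrite -(@esum_esum _ _ _ _ _ (fun m n => (u m n)%:E)) => [|m n _ _]; last by rewrite lee_fin.
have -> : [set x : nat | true] = [set: nat] by apply/seteqP.
apply: eq_esum => m _; rewrite nneseries_esum => [|n _]; last by rewrite lee_fin.
by have -> : [set x : nat | true] = [set: nat] by apply/seteqP.
Qed.

Lemma esum_nat2_ge (u : nat -> nat -> R) N L : (forall m n, 0 <= u m n) ->
  ((\sum_(m < N) \sum_(n < L) u m n)%:E <=
   \esum_(p in [set: nat * nat]) (u p.1 p.2)%:E)%E.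
Proof.
move=> u0; rewrite esum_nat2 //.
have p0 m : (0 <= \sum_(0 <= n <oo) (u m n)%:E)%E.
  by apply: nneseries_ge0 => n _ _; rewrite lee_fin.
apply: le_trans (@nneseries_lim_ge _ _ xpredT 0%N N (fun m _ _ => p0 m)).
rewrite big_mkord -sumEFin; apply: lee_sum => m _.
apply: le_trans (@nneseries_lim_ge _ _ xpredT 0%N L _); last by move=> n _ _; rewrite lee_fin.
by rewrite big_mkord -sumEFin.
Qed.

Lemma esum_nat2_le (u : nat -> nat -> R) (T : R) : (forall m n, 0 <= u m n) ->
  (forall N L, \sum_(m < N) \sum_(n < L) u m n <= T) ->
  (\esum_(p in [set: nat * nat]) (u p.1 p.2)%:E <= T%:E)%E.
Proof.
move=> u0 uT; rewrite esum_nat2 //.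
have p0 m : (0 <= \sum_(0 <= n <oo) (u m n)%:E)%E.
  by apply: nneseries_ge0 => n _ _; rewrite lee_fin.
apply: lime_le; first by apply: is_cvg_nneseries => m _ _.
apply: nearW => N; rewrite -nneseries_sum_nat => [|m n]; last by rewrite lee_fin.
apply: lime_le.
  by apply: is_cvg_nneseries => n _ _; apply: sume_ge0 => m _; rewrite lee_fin.
apply: nearW => L; rewrite big_mkord.
under eq_bigr do rewrite big_mkord sumEFin.
by rewrite sumEFin lee_fin exchange_big.
Qed.

Lemma hardy2_divf (lam : CC R) (f : CC R * CC R -> CC R) : cmod lam < 1 ->
  (forall z, inD2 z -> z.1 = lam -> f z = 0) -> hardy2 f -> hardy2 (divf lam f).
Proof.
move=> l1 f0 [a [aS fa]].
have u0 m n : 0 <= cmod (a m n) ^+ 2 by rewrite exprn_ge0 // cmod_ge0.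
set X := \esum_(p in _) _ in aS.
have X0 : (0 <= X)%E by apply: esum_ge0 => p _; rewrite lee_fin.
have XE : X = (fine X)%:E by rewrite fineK // ge0_fin_numE.
have sumS N L : \sum_(m < N) \sum_(n < L) cmod (a m n) ^+ 2 <= fine X.
  by rewrite -lee_fin -XE; exact: (esum_nat2_ge N L u0).
have shiftS N L s : \sum_(m < N) \sum_(n < L) cmod (a (m + s)%N n) ^+ 2 <= fine X.
  apply: le_trans (sumS (s + N)%N L).
  rewrite big_split_ord /= -[leLHS]add0r lerD //.
    by apply: sumr_ge0 => i _; exact: sumr_ge0.
  by apply: ler_sum => m _; rewrite addnC.
(* Square summable coefficients are bounded, so the series theory applies with radius 1 itself. *)
have aM m n : cmod (a m n) <= Num.sqrt (fine X).
  rewrite -[leLHS]ger0_norm ?cmod_ge0 // -sqrtr_sqr ler_wsqrtr //.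
  apply: le_trans (sumS m.+1 n.+1); rewrite big_ord_recr /= big_ord_recr /=.
  by rewrite addrA lerDr addr_ge0 // ?sumr_ge0 // => i _; rewrite sumr_ge0.
pose M := Num.sqrt (fine X).
have hbdd (r : R) : 0 < r -> r <= 1 -> bddc r M a.
  move=> r0 r1 m n; rewrite (le_trans _ (aM m n)) // ler_piMr ?cmod_ge0 //.
  by rewrite exprn_ile1 // ltW.
have fps (r : R) : r <= 1 -> forall z, cmod z.1 < r -> cmod z.2 < r -> f z = psfun a z.
  move=> r1 z z1 z2; apply/esym/ccvg_limn; apply: fa.
  by split; [exact: lt_le_trans r1|exact: lt_le_trans r1].
exists (divc lam a); split.
  have h1 := hbdd 1 ltr01 (lexx 1).
  have [T hT] := @divc_square_sums 1 _ _ _ _ ltr01 erefl h1 l1 shiftS.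
  apply: le_lt_trans (ltry T); apply: (@esum_nat2_le (fun m n => cmod (divc lam a m n) ^+ 2)) => //.
  by move=> m n; rewrite exprn_ge0 // cmod_ge0.
move=> z [z1 z2].
have h1 := hbdd 1 ltr01 (lexx 1).
rewrite (divf_psfun f0 ltr01 (lexx 1) h1 l1 (fps 1 (lexx 1)) z1 z2).
have [s s1 [sz1 sz2]] := between2 z1 z2.
have [h _] := psum_cvg ltr01 (bddc_divc ltr01 h1 l1) (ltW sz1) (ltW sz2) s1.
exact: h.
Qed.
End HardyDivision.

(** * Monotonicity and scaling of integrals of nonnegative functions *)

Section IntegralMonotone.
Import HBNNSimple.
Context d (T : measurableType d) (R : realType) (mu : {measure set T -> \bar R}).
Implicit Types (D : set T) (f g : T -> \bar R).

(* These two facts hold for arbitrary nonnegative functions, because the integral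
   is a supremum over the simple functions below. *)
Lemma ge0_le_integral_any D f g : (forall x, D x -> (0 <= f x)%E) ->
  (forall x, D x -> (f x <= g x)%E) ->
  (\int[mu]_(x in D) f x <= \int[mu]_(x in D) g x)%E.
Proof.
move=> f0 fg; have g0 x : D x -> (0 <= g x)%E.
  by move=> Dx; exact: le_trans (f0 x Dx) (fg x Dx).
rewrite !ge0_integralE //; apply: le_ereal_sup => _ [h hf <-]; exists h => //= x.
apply: le_trans (hf x) _; rewrite !patchE; case: ifPn => // /set_mem; exact: fg.
Qed.

Lemma ge0_integralZ_le D f (c : R) : 0 < c -> (forall x, D x -> (0 <= f x)%E) ->
  (\int[mu]_(x in D) (c%:E * f x) <= c%:E * \int[mu]_(x in D) f x)%E.
Proof.
move=> c0 f0; have cf0 x : D x -> (0 <= c%:E * f x)%E.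
  by move=> Dx; rewrite mule_ge0 ?f0 // lee_fin ltW.
rewrite [leLHS]ge0_integralE //; apply: ge_ereal_sup => _ [h hf <-].
have ci0 : 0 <= c^-1 by rewrite invr_ge0 ltW.
pose h' := scale_nnsfun h ci0.
have -> : sintegral mu h = (c%:E * sintegral mu h')%E.
  rewrite -sintegralrM; apply: eq_sintegral => x /=.
  by rewrite mulrA divff ?mul1r // gt_eqF.
rewrite lee_wpmul2l ?lee_fin ?(ltW c0) // ge0_integralE //.
apply: ereal_sup_ubound; exists h' => //= x.
have := hf x; rewrite !patchE; case: ifPn => _ hx; last first.
  rewrite lee_fin in hx *.
  have h0 : h x = 0 by apply/eqP; rewrite eq_le hx fun_ge0.
  by rewrite h0 mulr0.
rewrite EFinM muleC lee_pdivrMr //.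
by rewrite muleC.
Qed.
End IntegralMonotone.

(** * Tonelli's theorem on a measurable rectangle *)

Section TonelliOn.
Context d1 d2 (T1 : measurableType d1) (T2 : measurableType d2) (R : realType).
Context (m1 : {sigma_finite_measure set T1 -> \bar R})
        (m2 : {sigma_finite_measure set T2 -> \bar R}).
Context (D1 : set T1) (D2 : set T2) (mD1 : measurable D1) (mD2 : measurable D2).
Context (f : T1 * T2 -> \bar R) (mf : measurable_fun (D1 `*` D2) f)
  (f0 : forall x y, D1 x -> D2 y -> (0 <= f (x, y))%E).

(** Extension by zero reduces the rectangle to the whole product; [sec1] and [sec2] check that it
    commutes with integrating one variable out. *)
Let f' := f \_ (D1 `*` D2).
Let mf' : measurable_fun setT f'.
Proof. exact/(measurable_restrictT _ (measurableX mD1 mD2)). Qed.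
Let f'0 x : (0 <= f' x)%E.
Proof. by rewrite /f' patchE; case: ifPn => // /set_mem; case: x => x y [] /=; exact: f0. Qed.
Let sec1 x : ((fun x => \int[m2]_(y in D2) f (x, y)) \_ D1)%E x = (\int[m2]_y f' (x, y))%E.
Proof.
rewrite patchE; case: ifPn => [/set_mem D1x|D1x].
  rewrite integral_mkcond; apply: eq_integral => y _; rewrite /f' !patchE.
  by congr (if _ then _ else _); apply/idP/idP => [/set_mem ?|/set_mem [_ ?]]; apply/mem_set.
rewrite [RHS]integral0_eq // => y _; rewrite /f' patchE ifF //.
apply/negbTE/negP => /set_mem [/= h _].
by move/negP : D1x; apply; exact/mem_set.
Qed.
Let sec2 y : ((fun y => \int[m1]_(x in D1) f (x, y)) \_ D2)%E y = (\int[m1]_x f' (x, y))%E.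
Proof.
rewrite patchE; case: ifPn => [/set_mem D2y|D2y].
  rewrite integral_mkcond; apply: eq_integral => x _; rewrite /f' !patchE.
  by congr (if _ then _ else _); apply/idP/idP => [/set_mem ?|/set_mem [? _]]; apply/mem_set.
rewrite [RHS]integral0_eq // => x _; rewrite /f' patchE ifF //.
apply/negbTE/negP => /set_mem [/= _ h].
by move/negP : D2y; apply; exact/mem_set.
Qed.

Lemma tonelli_on :
  (\int[m1]_(x in D1) \int[m2]_(y in D2) f (x, y) =
   \int[m2]_(y in D2) \int[m1]_(x in D1) f (x, y))%E.
Proof.
rewrite integral_mkcond [RHS]integral_mkcond.
under eq_integral do rewrite sec1.
under [RHS]eq_integral do rewrite sec2.
exact: fubini_tonelli.
Qed.

Lemma measurable_fun_tonelli_on :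
  measurable_fun D1 (fun x => \int[m2]_(y in D2) f (x, y))%E.
Proof.
apply/(measurable_restrictT _ mD1).
rewrite (_ : _ \_ _ = fun x => (\int[m2]_y f' (x, y))%E); last exact/funext/sec1.
exact: measurable_fun_fubini_tonelli_F.
Qed.

Lemma measurable_fun_tonelli_on2 :
  measurable_fun D2 (fun y => \int[m1]_(x in D1) f (x, y))%E.
Proof.
apply/(measurable_restrictT _ mD2).
rewrite (_ : _ \_ _ = fun y => (\int[m1]_x f' (x, y))%E); last exact/funext/sec2.
exact: measurable_fun_fubini_tonelli_G.
Qed.
End TonelliOn.

(** * Plane Lebesgue measure, measurability of holomorphic functions and of the Poisson kernel *)

Section PlaneMeasure.
Context {R : realType}.
Local Notation T := (measurableTypeR R).
Local Notation leb := (@lebesgue_measure R).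

Definition leb1 : {sigma_finite_measure set T -> \bar R} := leb.
(** Named so that the product measure can carry a sigma-finite structure and serve as one factor in
    Tonelli's theorem, against the circle or against [mu]. *)
Definition leb2 : set (T * T) -> \bar R := (leb1 \x leb1)%E.
HB.instance Definition _ := Measure.on leb2.

Lemma leb2_sigma_finite : sigma_finite setT leb2.
Proof.
have /sigma_finiteP[F [TF ndF Foo]] := sigma_finiteT leb1.
exists (fun n => F n `*` F n).
  apply/seteqP; split => [[x y] _|//].
  have : setT x by []. have : setT y by []. rewrite TF => -[n _ Fy] [m _ Fx].
  exists (maxn m n) => //; split => /=.
    exact: (subsetPset _ _ (ndF _ _ (leq_maxl m n))).
  exact: (subsetPset _ _ (ndF _ _ (leq_maxr m n))).
move=> n; have [mF Ff] := Foo n; split; first exact: measurableX.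
by rewrite /leb2 product_measure1E // lte_mul_pinfty // ge0_fin_numE.
Qed.
HB.instance Definition _ := Measure_isSigmaFinite.Build _ _ _ leb2 leb2_sigma_finite.

(** The same measure repackaged as a finite one, the form in which Tonelli's theorem accepts it. *)
Definition fmu (mu : {measure set R -> \bar R}) (hmu : (mu setT < +oo)%E) :
  {finite_measure set R -> \bar R} := mfrestr measurableT hmu.

Lemma fmuE (mu : {measure set R -> \bar R}) (hmu : (mu setT < +oo)%E) (D : set R) (f : R -> \bar R) :
  (\int[mu]_(x in D) f x = \int[fmu hmu]_(x in D) f x)%E.
Proof.
by apply: eq_measure_integral => A mA _; rewrite /fmu /= /mfrestr /mrestr /= setIT.
Qed.

Definition disc (r : R) : set (T * T) := [set p | p.1 ^+ 2 + p.2 ^+ 2 < r ^+ 2].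

Lemma measurable_lt_fun d (U : measurableType d) (f : U -> R) (c : R) :
  measurable_fun setT f -> measurable [set x | f x < c].
Proof.
move=> mf; rewrite (_ : [set _ | _] = setT `&` f @^-1` `]-oo, c[%classic).
  by apply: mf => //; exact: measurable_itv.
apply/seteqP; split => [x h|x [_]]; last by rewrite /= in_itv.
by split => //; rewrite /= in_itv.
Qed.

Lemma measurable_disc r : measurable (disc r).
Proof.
apply: (@measurable_lt_fun _ _ (fun p : T * T => p.1 ^+ 2 + p.2 ^+ 2)).
apply: measurable_funD; apply: measurable_funX.
  exact: measurable_fst.
exact: measurable_snd.
Qed.

Lemma discP (r : R) (p : T * T) : 0 <= r ->
  disc r p <-> cmod (Complex p.1 p.2 : CC R) < r.
Proof.
move=> r0.
have -> : (cmod (Complex p.1 p.2 : CC R) < r) = (p.1 ^+ 2 + p.2 ^+ 2 < r ^+ 2).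
  by rewrite -(ltr_pXn2r (n := 2)) ?nnegrE ?cmod_ge0 // sqr_cmod.
by [].
Qed.

Definition cmeas d (U : measurableType d) (D : set U) (Z : U -> CC R) : Prop :=
  measurable_fun D (fun x => complex.Re (Z x)) /\
  measurable_fun D (fun x => complex.Im (Z x)).

Section Cmeas.
Context d (U : measurableType d) (D : set U).
Implicit Types Z W : U -> CC R.

Lemma cmeas_cst (c : CC R) : cmeas D (fun=> c).
Proof. by split; exact: measurable_cst. Qed.

Lemma cmeasD Z W : cmeas D Z -> cmeas D W -> cmeas D (fun x => Z x + W x).
Proof.
move=> [z1 z2] [w1 w2]; split.
  by under eq_fun do rewrite ReD; exact: measurable_funD.
by under eq_fun do rewrite ImD; exact: measurable_funD.
Qed.

Lemma cmeasM Z W : cmeas D Z -> cmeas D W -> cmeas D (fun x => Z x * W x).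
Proof.
move=> [z1 z2] [w1 w2]; split.
  by under eq_fun do rewrite ReM; apply: measurable_funB; exact: measurable_funM.
by under eq_fun do rewrite ImM; apply: measurable_funD; exact: measurable_funM.
Qed.

Lemma cmeasX Z n : cmeas D Z -> cmeas D (fun x => Z x ^+ n).
Proof.
move=> hZ; elim: n => [|n ih]; first exact: cmeas_cst.
by under eq_fun do rewrite exprS; exact: cmeasM.
Qed.

Lemma cmeas_sum N (H : nat -> U -> CC R) : (forall n, cmeas D (H n)) ->
  cmeas D (fun x => \sum_(n < N) H n x).
Proof.
move=> hH; elim: N => [|N ih].
  by under eq_fun do rewrite big_ord0; exact: cmeas_cst.
by under eq_fun do rewrite big_ord_recr /=; exact: cmeasD.
Qed.

Lemma cmeas_lim (H : nat -> U -> CC R) Z : (forall n, cmeas D (H n)) ->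
  (forall x, D x -> (fun n => H n x) @ \oo --> Z x) -> cmeas D Z.
Proof.
move=> hH hZ; split.
  apply: (measurable_fun_cvg (fun m => (hH m).1)) => x Dx.
  apply/cvgrPdist_lt => e e0; have /cvg_cmodP/(_ _ e0) := hZ x Dx.
  apply: filterS => n; apply: le_lt_trans.
  by rewrite -ReN -ReD cmodBC normr_Re_le.
apply: (measurable_fun_cvg (fun m => (hH m).2)) => x Dx.
apply/cvgrPdist_lt => e e0; have /cvg_cmodP/(_ _ e0) := hZ x Dx.
apply: filterS => n; apply: le_lt_trans.
by rewrite -ImN -ImD cmodBC normr_Im_le.
Qed.

Lemma measurable_sqr_cmod Z : cmeas D Z -> measurable_fun D (fun x => cmod (Z x) ^+ 2).
Proof.
move=> [z1 z2]; under eq_fun do rewrite sqr_cmod.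
by apply: measurable_funD; exact: measurable_funX.
Qed.

(** On a polydisc of radius below 1 the function is a pointwise limit of polynomials in [Z] and
    [W]. *)
Lemma cmeas_hol (F : CC R * CC R -> CC R) Z W (r : R) : holomorphic2 F ->
  0 < r -> r < 1 -> (forall x, D x -> cmod (Z x) < r) -> (forall x, D x -> cmod (W x) < r) ->
  cmeas D Z -> cmeas D W -> cmeas D (fun x => F (Z x, W x)).
Proof.
move=> hF r0 r1 Zr Wr hZ hW.
have [a [M [ha Fa]]] := holomorphic2_psfun r0 r1 hF.
apply: (@cmeas_lim (fun N x => psum a (Z x, W x) N)) => [N|x Dx].
  apply: (@cmeas_sum N (fun m x => \sum_(n < N) a m n * Z x ^+ m * W x ^+ n)) => m.
  apply: (@cmeas_sum N (fun n x => a m n * Z x ^+ m * W x ^+ n)) => n.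
  by apply: cmeasM; [apply: cmeasM; [exact: cmeas_cst|exact: cmeasX]|exact: cmeasX].
rewrite (Fa (Z x, W x) (Zr x Dx) (Wr x Dx)).
have [s sr [h1 h2]] := @between2 _ r (Z x, W x) (Zr x Dx) (Wr x Dx).
have [h _] := @psum_cvg _ _ _ _ (Z x, W x) _ r0 ha (ltW h1) (ltW h2) sr.
exact: h.
Qed.
End Cmeas.

Definition pker (p : T * T) (t : R) : R :=
  (1 - cmod (Complex p.1 p.2 : CC R) ^+ 2) / cmod (Complex p.1 p.2 - rexpi 1 t) ^+ 2.

Lemma pker_ge0 p t : disc 1 p -> 0 <= pker p t.
Proof.
move=> /(discP _ ler01) h; rewrite divr_ge0 ?sqr_ge0 // subr_ge0.
by rewrite exprn_ile1 ?cmod_ge0 // ltW.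
Qed.

Lemma pker_den_gt0 p t : disc 1 p -> 0 < cmod (Complex p.1 p.2 - rexpi 1 t) ^+ 2.
Proof.
move=> /(discP _ ler01) h; rewrite exprn_gt0 // -cmodN opprB.
by rewrite cmod_gt0 rexpi_neq.
Qed.

Lemma measurable_pker : measurable_fun (disc 1 `*` (setT : set R)) (fun x => pker x.1 x.2).
Proof.
have mD : measurable (disc 1 `*` (setT : set R)) by apply: measurableX => //; exact: measurable_disc.
have m1 : measurable_fun (disc 1 `*` (setT : set R)) (fun x => x.1.1 : R).
  apply: measurable_funS (measurableT) _ _ => //.
  exact: (measurableT_comp (f := fst) measurable_fst measurable_fst).
have m2 : measurable_fun (disc 1 `*` (setT : set R)) (fun x => x.1.2 : R).
  apply: measurable_funS (measurableT) _ _ => //.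
  exact: (measurableT_comp (f := snd) measurable_snd measurable_fst).
have m3 : measurable_fun (disc 1 `*` (setT : set R)) (fun x => x.2 : R).
  by apply: measurable_funS (measurableT) _ _ => //; exact: measurable_snd.
have mc : measurable_fun (disc 1 `*` (setT : set R)) (fun x => cos x.2 : R).
  apply: (@measurableT_comp _ _ _ _ _ _ (@cos R)) => //.
  by apply: continuous_measurable_fun; exact: continuous_cos.
have ms : measurable_fun (disc 1 `*` (setT : set R)) (fun x => sin x.2 : R).
  apply: (@measurableT_comp _ _ _ _ _ _ (@sin R)) => //.
  by apply: continuous_measurable_fun; exact: continuous_sin.
have mz : cmeas (disc 1 `*` (setT : set R)) (fun x => Complex x.1.1 x.1.2) by split.
have mw : cmeas (disc 1 `*` (setT : set R)) (fun x => Complex x.1.1 x.1.2 + -1 * rexpi 1 x.2).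
  apply: cmeasD => //; apply: cmeasM; first exact: cmeas_cst.
  by split => /=; under eq_fun do rewrite mul1r.
have mw2 := measurable_sqr_cmod mw; have mz2 := measurable_sqr_cmod mz.
(* The denominator is positive on the disc, so its inverse is [expR] of minus its [ln], a
   composition of measurable functions. *)
apply: (eq_measurable_fun (fun x => (1 - cmod (Complex x.1.1 x.1.2 : CC R) ^+ 2) *
   expR (0 - ln (cmod (Complex x.1.1 x.1.2 + -1 * rexpi 1 x.2 : CC R) ^+ 2)))).
  move=> x /set_mem [Dx _]; have dp := pker_den_gt0 x.2 Dx.
  by rewrite /pker mulN1r sub0r expRN lnK ?posrE.
apply: measurable_funM; first by apply: measurable_funB => //; exact: measurable_cst.
apply: measurableT_comp; first exact: measurable_expR.
apply: measurable_funB; first exact: measurable_cst.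
by apply: measurableT_comp; first exact: measurable_ln.
Qed.
End PlaneMeasure.

(** * Mean square estimates on circles *)

Section CircleL2.
Context {R : realType}.
Local Notation T := (measurableTypeR R).
Local Notation leb := (@lebesgue_measure R).

Lemma twopi_gt0 : 0 < (pi *+ 2 : R). Proof. by rewrite mulrn_wgt0 // pi_gt0. Qed.

(** The variance is nonnegative: expand the integral of [(u x - m) ^+ 2], with [m] the mean. *)
Lemma Rintegral_mean_sqr_le (u : R -> R) (L : R) : 0 < L ->
  (forall x, u @ nbhs x --> u x) ->
  (L^-1 * \int[leb]_(x in `[0, L]) u x) ^+ 2 <= L^-1 * \int[leb]_(x in `[0, L]) (u x ^+ 2).
Proof.
move=> L0 uc; pose m := L^-1 * \int[leb]_(x in `[0, L]) u x.
have u2c x : (fun y => u y ^+ 2) @ nbhs x --> u x ^+ 2.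
  by under eq_fun do rewrite expr2; apply: cvgM; exact: uc.
have i1 := segment_integrable (a := 0) (b := L) (fun x _ => uc x).
have i2 := segment_integrable (a := 0) (b := L) (fun x _ => u2c x).
have i3 : leb.-integrable `[0, L] (EFin \o (fun x => 2 * m * u x)).
  exact: (integrableZl _ (2 * m) i1).
have i4 : leb.-integrable `[0, L] (EFin \o (fun=> m ^+ 2)).
  by apply: segment_integrable => x _; exact: cvg_cst.
have i5 : leb.-integrable `[0, L] (EFin \o (fun x => u x ^+ 2 - 2 * m * u x)).
  exact: (integrableB _ i2 i3).
have : 0 <= \int[leb]_(x in `[0, L]) (u x ^+ 2 - 2 * m * u x + m ^+ 2).
  apply: Rintegral_ge0 => x _.
  have -> : u x ^+ 2 - 2 * m * u x + m ^+ 2 = (u x - m) ^+ 2 by ring.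
  exact: sqr_ge0.
rewrite (RintegralD _ i5 i4) // (RintegralB _ i2 i3) // (RintegralZl _ _ i1) //.
rewrite Rintegral_segment_cst ?(ltW L0) // subr0 -/m.
have -> : \int[leb]_(x in `[0, L]) u x = L * m by rewrite /m mulrA divff ?mul1r // gt_eqF.
move: (\int[leb]_(x in _) _) => I2 h.
by rewrite [leRHS]mulrC ler_pdivlMr //; move: h; lra.
Qed.

Definition rmean (u : R -> R) : R := (pi *+ 2)^-1 * \int[leb]_(x in `[0, pi *+ 2]) u x.

Lemma sqr_cmod_cmean_le (F : R -> CC R) : pcontT F ->
  cmod (cmean F) ^+ 2 <= rmean (fun t => cmod (F t) ^+ 2).
Proof.
move=> Fc; rewrite sqr_cmod /cmean ReM ImM /= !mul0r subr0 addr0.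
have hR := Rintegral_mean_sqr_le twopi_gt0 (fun x => pcont_Re (Fc x)).
have hI := Rintegral_mean_sqr_le twopi_gt0 (fun x => pcont_Im (Fc x)).
apply: le_trans (lerD hR hI) _; rewrite -mulrDr /rmean.
rewrite -RintegralD //; last 2 first.
- apply: segment_integrable => x _; under eq_fun do rewrite expr2.
  by apply: cvgM; exact: pcont_Re.
- apply: segment_integrable => x _; under eq_fun do rewrite expr2.
  by apply: cvgM; exact: pcont_Im.
by under [in leRHS]eq_Rintegral do rewrite sqr_cmod.
Qed.

Lemma pcont_sqr_cmod (F : R -> CC R) x : pcont F x ->
  (fun t => cmod (F t) ^+ 2) @ nbhs x --> cmod (F x) ^+ 2.
Proof.
move=> Fx; under eq_fun do rewrite sqr_cmod !expr2.
rewrite sqr_cmod !expr2.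
by apply: cvgD; apply: cvgM; first [exact: pcont_Re|exact: pcont_Im].
Qed.

Lemma circT_EFin (u : R -> R) : (forall x, u @ nbhs x --> u x) ->
  circT (fun t => (u t)%:E) = (rmean u)%:E.
Proof.
move=> uc; rewrite /circT /rmean EFinM /Rintegral fineK //.
apply: integrable_fin_num => //.
exact: (segment_integrable (fun x _ => uc x)).
Qed.

(** Cauchy's formula on the circle of radius [r1], where the kernel is at most [r1 / (r1 - r0)] in
    modulus, followed by the mean square inequality. The constant exceeds 1, but only finiteness is
    at stake, and it is the same for all [z] in the smaller disc. *)
Lemma sqr_cmod_le_circle_mean (phi : CC R -> CC R) (z : CC R) (r0 r1 : R) :
  cmod z <= r0 -> r0 < r1 -> r1 < 1 ->
  (forall w, cmod w < 1 -> exists c, cderiv phi w c) ->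
  ((cmod (phi z) ^+ 2)%:E <= ((r1 / (r1 - r0)) ^+ 2)%:E *
     circT (fun s => (cmod (phi (rexpi r1 s)) ^+ 2)%:E))%E.
Proof.
move=> zr0 r01 r11 dphi.
have zr1 : cmod z < r1 by exact: le_lt_trans r01.
have r1p : 0 < r1 by exact: le_lt_trans (cmod_ge0 z) zr1.
have pphi : pcontT (fun t => phi (rexpi r1 t)).
  apply: pcontT_circle => [|w wr]; first exact: ltW.
  by have [|d /cderiv_ccont] := dphi w; rewrite ?wr.
have pk := pcontT_ckernel zr1.
have ppk : pcontT (fun t => phi (rexpi r1 t) * ckernel z (rexpi r1 t)).
  by move=> x; exact: pcontM (pphi x) (pk x).
rewrite (circT_EFin (fun x => pcont_sqr_cmod (pphi x))) -EFinM lee_fin.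
rewrite -(cauchy_formula zr1 r11 dphi).
apply: le_trans (sqr_cmod_cmean_le ppk) _.
set c := (r1 / (r1 - r0)) ^+ 2; rewrite /rmean [leRHS]mulrCA.
apply: ler_wpM2l; first by rewrite invr_ge0 ltW // twopi_gt0.
have iphi : leb.-integrable `[0, pi *+ 2] (EFin \o (fun t => cmod (phi (rexpi r1 t)) ^+ 2)).
  by apply: segment_integrable => x _; exact: pcont_sqr_cmod.
rewrite -RintegralZl //; apply: le_Rintegral => //.
- by apply: segment_integrable => x _; exact: (pcont_sqr_cmod (ppk x)).
- exact: (integrableZl _ c iphi).
move=> t _; rewrite cmodM exprMn mulrC ler_wpM2r ?sqr_ge0 //.
rewrite lerXn2r ?nnegrE ?cmod_ge0 ?divr_ge0 ?subr_ge0 ?(ltW r1p) ?(ltW r01) //.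
rewrite /ckernel cmodM cmodV cmod_rexpi ?(ltW r1p) // ler_wpM2l ?(ltW r1p) //.
rewrite lef_pV2 ?posrE ?cmod_gt0 ?rexpi_neq ?subr_gt0 //.
by apply: le_trans (cmod_circle_sub _ _ (ltW r1p)); rewrite lerB.
Qed.
End CircleL2.

(** * The Dirichlet integral in the variable that is not divided *)

Section DirichletTwo.
Context {R : realType}.
Local Notation T := (measurableTypeR R).
Local Notation leb := (@lebesgue_measure R).
Context (mu : {measure set R -> \bar R}) (hmu : measure_on_T mu).

Lemma areaDE (g : CC R -> \bar R) :
  areaD g = ((pi^-1)%:E * \int[leb2]_(p in disc 1) g (Complex p.1 p.2))%E.
Proof.
rewrite /areaD; congr (_ * _)%E.
by rewrite (_ : [set p | _] = disc 1) //; apply/funext => p; rewrite /disc /mkset /= expr1n.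
Qed.

Lemma areaD_le (u v : CC R -> \bar R) (c : R) : 0 < c ->
  (forall x, cmod x < 1 -> (0 <= u x)%E) -> (forall x, cmod x < 1 -> (0 <= v x)%E) ->
  (forall x, cmod x < 1 -> (u x <= c%:E * v x)%E) ->
  (areaD u <= c%:E * areaD v)%E.
Proof.
move=> c0 u0 v0 uv; rewrite !areaDE muleCA lee_wpmul2l ?lee_fin ?invr_ge0 ?pi_ge0 //.
have dE p : disc 1 p -> cmod (Complex p.1 p.2 : CC R) < 1 by move/(discP _ ler01).
apply: le_trans (ge0_integralZ_le _ c0 _); last by move=> p /dE; exact: v0.
by apply: ge0_le_integral_any => p /dE h; [exact: u0|exact: uv].
Qed.

Lemma circT_le (u v : R -> \bar R) (c : R) : 0 < c ->
  (forall t, (0 <= u t)%E) -> (forall t, (0 <= v t)%E) ->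
  (forall t, (u t <= c%:E * v t)%E) -> (circT u <= c%:E * circT v)%E.
Proof.
move=> c0 u0 v0 uv; rewrite /circT muleCA lee_wpmul2l ?lee_fin ?invr_ge0 ?(ltW twopi_gt0) //.
apply: le_trans (ge0_integralZ_le _ c0 _); last by move=> p _.
by apply: ge0_le_integral_any => p _.
Qed.

Lemma circT_cst (c : \bar R) : (0 <= c)%E -> circT (fun=> c) = c.
Proof.
move=> c0; rewrite /circT integral_cst //= lebesgue_measure_itv /= lte_fin twopi_gt0.
rewrite -EFinB subr0 muleCA -EFinM mulVf ?mule1 //.
by rewrite gt_eqF // twopi_gt0.
Qed.

Lemma areaD_ge0 (u : CC R -> \bar R) : (forall x, cmod x < 1 -> (0 <= u x)%E) ->
  (0 <= areaD u)%E.
Proof.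
move=> u0; rewrite areaDE mule_ge0 ?lee_fin ?invr_ge0 ?pi_ge0 //.
by apply: integral_ge0 => p /(discP _ ler01); exact: u0.
Qed.

Lemma poisson_ge0 (x : CC R) : cmod x < 1 -> (0 <= poisson mu x)%E.
Proof.
move=> x1; apply: integral_ge0 => t _; rewrite lee_fin divr_ge0 ?sqr_ge0 //.
by rewrite subr_ge0 exprn_ile1 ?cmod_ge0 // ltW.
Qed.

Lemma poissonE p : poisson mu (Complex p.1 p.2) =
  (\int[fmu hmu.1]_(t in `[0%R, (pi *+ 2)%R[%classic) (pker p t)%:E)%E.
Proof. by rewrite -fmuE. Qed.

Lemma measurable_poisson :
  measurable_fun (disc 1) (fun p : T * T => poisson mu (Complex p.1 p.2)).
Proof.
under eq_fun do rewrite poissonE.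
apply: (@measurable_fun_tonelli_on _ _ _ _ _ (fmu hmu.1) (disc 1)
  (`[0, pi *+ 2[%classic) _ _ (fun x => (pker x.1 x.2)%:E)).
- exact: measurable_disc.
- exact: measurable_itv.
- apply/measurable_EFinP; apply: measurable_funS measurable_pker.
    by apply: measurableX; [exact: measurable_disc|].
  by move=> x [].
- by move=> p t Dp _; rewrite lee_fin pker_ge0.
Qed.

Let W x := poisson mu x.

Lemma sqr_poisson_ge0 (a : R) x : cmod x < 1 -> (0 <= (a ^+ 2)%:E * W x)%E.
Proof. by move=> x1; rewrite mule_ge0 ?poisson_ge0 // lee_fin sqr_ge0. Qed.

Lemma dir2_ge0 F r : (0 <= dir2 mu F r)%E.
Proof.
rewrite /dir2 /circT mule_ge0 ?lee_fin ?invr_ge0 ?(ltW twopi_gt0) //.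
apply: integral_ge0 => t _; apply: areaD_ge0 => x x1; exact: sqr_poisson_ge0.
Qed.

Lemma dir2_le_outer (lam : CC R) (f : CC R * CC R -> CC R) (r0 r : R) :
  cmod lam < r0 -> r0 <= r -> r < 1 -> holomorphic2 f ->
  (dir2 mu (divf lam f) r <= ((r0 - cmod lam) ^- 2)%:E * dir2 mu f r)%E.
Proof.
move=> lr0 r0r r1 hf.
have c0 : 0 < (r0 - cmod lam) ^- 2 by rewrite invr_gt0 exprn_gt0 // subr_gt0.
have rp : 0 <= r by rewrite (le_trans (cmod_ge0 lam)) // (le_trans (ltW lr0)).
apply: circT_le => // [t|t|t].
- by apply: areaD_ge0 => x x1; exact: sqr_poisson_ge0.
- by apply: areaD_ge0 => x x1; exact: sqr_poisson_ge0.
apply: areaD_le => // x x1; try exact: sqr_poisson_ge0.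
rewrite muleA lee_wpmul2r ?poisson_ge0 // -EFinM lee_fin.
have lr : cmod lam < r by exact: lt_le_trans r0r.
have nz := rexpi_neq t lr.
have zD : inD2 (rexpi r t, x).
  by split; rewrite /inD //; apply: le_lt_trans r1; rewrite [X in X <= _]cmod_rexpi.
rewrite d2_divf /=; last 2 first.
- by rewrite -subr_eq0.
- by have [_ _ h] := hf _ zD; exact: h.
rewrite cmodM cmodV exprMn mulrC ler_wpM2r ?sqr_ge0 //.
rewrite -exprVn lerXn2r ?nnegrE ?invr_ge0 ?cmod_ge0 ?subr_ge0 ?(ltW lr0) //.
rewrite lef_pV2 ?posrE ?cmod_gt0 ?subr_gt0 //.
by apply: le_trans (cmod_circle_sub t lam rp); rewrite lerB.
Qed.

(** The pointwise estimate puts the circle mean inside the area integral; Tonelli's theorem restores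
    the order used in [dir2]. Most of the work is joint measurability. *)
Lemma dir2_swap (g : CC R * CC R -> CC R) (r1 : R) : 0 < r1 -> r1 < 1 -> holomorphic2 g ->
  areaD (fun x => (circT (fun s => (cmod (d2 g (rexpi r1 s, x)) ^+ 2)%:E) * W x)%E)
  = dir2 mu g r1.
Proof.
move=> r10 r11 hg; have hd2 := holomorphic2_d2 hg.
pose q (p : T * T) (s : T) := cmod (d2 g (rexpi r1 s, Complex p.1 p.2)) ^+ 2.
pose C := `[0%R, (pi *+ 2 : R)%R]%classic : set T.
have mC : measurable C by exact: measurable_itv.
have mD := @measurable_disc R 1.
have mq : measurable_fun (disc 1 `*` C) (fun x : (T * T) * T => q x.1 x.2).
  (* [cmeas_hol] works on polydiscs of radius below 1, so the open disc is exhausted by smaller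
     ones; [n.+2] keeps every radius positive. *)
  pose s n : R := 1 - (n.+2%:R)^-1.
  have s0 n : 0 < s n by rewrite subr_gt0 invf_lt1 // ltr1n.
  have s1 n : s n < 1 by rewrite gtrBl invr_gt0.
  have -> : disc 1 `*` C = \bigcup_n (disc (s n) `*` C).
    apply/seteqP; split => [[p t] [/= /(discP _ ler01) Dp Ct]|[p t] [n _ [/= + Ct]]].
      have : 0 < 1 - cmod (Complex p.1 p.2 : CC R) by rewrite subr_gt0.
      move=> /(half_pow_small 1)[n hn]; exists (2 ^ n)%N => //; split => //=.
      apply/(discP _ (ltW (s0 (2 ^ n)%N))); rewrite /s ltrBrDr -ltrBrDl.
      apply: le_lt_trans hn; rewrite mul1r lef_pV2 ?posrE ?exprn_gt0 //.
      by rewrite -natrX ler_nat leqW // leqnSn.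
    move=> /(discP _ (ltW (s0 n))) h; split => //=; apply/(discP _ ler01).
    exact: lt_trans (s1 n).
  apply/measurable_fun_bigcup => n; first by apply: measurableX => //; exact: measurable_disc.
  pose r := Num.max (s n) ((1 + r1) / 2).
  have rr1 : r1 < r by rewrite lt_max; apply/orP; right; lra.
  have r_1 : r < 1 by rewrite gt_max s1 /=; lra.
  apply: measurable_sqr_cmod.
  apply: (cmeas_hol (Z := fun x : (T * T) * T => rexpi r1 x.2)
     (W := fun x : (T * T) * T => Complex x.1.1 x.1.2) hd2 (lt_trans r10 rr1) r_1).
  - by move=> x _; rewrite cmod_rexpi ?(ltW r10).
  - move=> x [/(discP _ (ltW (s0 n))) h _]; apply: lt_le_trans h _.
    by rewrite le_max lexx.
  - split; apply: measurable_funM; try exact: measurable_cst.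
      apply: measurable_funTS; apply: measurableT_comp; last exact: measurable_snd.
      by apply: continuous_measurable_fun; exact: continuous_cos.
    apply: measurable_funTS; apply: measurableT_comp; last exact: measurable_snd.
    by apply: continuous_measurable_fun; exact: continuous_sin.
  - split; apply: measurable_funTS => /=.
      exact: (measurableT_comp (f := fst) measurable_fst measurable_fst).
    exact: (measurableT_comp (f := snd) measurable_snd measurable_fst).
have q0 p s : (0 <= (q p s)%:E)%E by rewrite lee_fin sqr_ge0.
have mqs p : disc 1 p -> measurable_fun C (fun s => (q p s)%:E).
  move=> Dp; apply/measurable_EFinP.
  have pc : pcontT (fun s => d2 g (rexpi r1 s, Complex p.1 p.2)).
    apply: (@pcontT_circle _ (fun w => d2 g (w, Complex p.1 p.2))); first exact: ltW.
    move=> w wr; have [h _] := hol_sections hd2 ((discP _ ler01).1 Dp).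
    by have [|c /cderiv_ccont //] := h w; rewrite wr.
  apply: measurable_funTS; apply: continuous_measurable_fun => x.
  exact: pcont_sqr_cmod (pc x).
pose w p := poisson mu (Complex p.1 p.2).
have w0 p : disc 1 p -> (0 <= w p)%E.
  by move=> /(discP _ ler01); exact: poisson_ge0.
pose f (x : (T * T) * T) := ((q x.1 x.2)%:E * w x.1)%E.
have mf : measurable_fun (disc 1 `*` C) f.
  apply: emeasurable_funM; first exact/measurable_EFinP.
  have := measurable_poisson => mw _ Y mY.
  have := mw mD Y mY; rewrite (_ : _ `&` _ = (disc 1 `&` w @^-1` Y) `*` C).
    by move=> h; exact: measurableX.
  by apply/seteqP; split => [[p s] [[/= ? ?] ?]|[p s] [[/= ? ?] ?]].
have f0 p s : disc 1 p -> C s -> (0 <= f (p, s))%E.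
  by move=> Dp _; rewrite mule_ge0 ?w0.
have P0 : (0 <= (pi^-1 : R)%:E)%E by rewrite lee_fin invr_ge0 pi_ge0.
have P20 : (0 <= ((pi *+ 2 : R)^-1)%:E)%E by rewrite lee_fin invr_ge0 ltW // twopi_gt0.
rewrite areaDE /dir2 /circT.
transitivity ((pi^-1)%:E * \int[leb2]_(p in disc 1)
   (((pi *+ 2)^-1)%:E * \int[leb1]_(s in C) f (p, s)))%E.
  congr (_ * _)%E; apply: eq_integral => p /set_mem Dp.
  rewrite -muleA; congr (_ * _)%E.
  by rewrite -(ge0_integralZr leb mC (mqs p Dp) (fun s _ => q0 p s) (w0 p Dp)).
have h0 p : disc 1 p -> (0 <= \int[leb1]_(s in C) f (p, s))%E.
  by move=> Dp; apply: integral_ge0 => s Cs; exact: f0.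
have mh := @measurable_fun_tonelli_on _ _ _ _ _ leb1 _ _ mD mC f mf f0.
rewrite (ge0_integralZl leb2 mD mh h0 P20).
rewrite (@tonelli_on _ _ _ _ _ leb2 leb1 _ _ mD mC f mf f0) muleCA; congr (_ * _)%E.
have g0 s : C s -> (0 <= \int[leb2]_(p in disc 1) f (p, s))%E.
  by move=> Cs; apply: integral_ge0 => p Dp; exact: f0.
have mg := @measurable_fun_tonelli_on2 _ _ _ _ _ leb2 _ _ mD mC f mf f0.
rewrite -(ge0_integralZl leb1 mC mg g0 P0).
by apply: eq_integral => s _; rewrite areaDE.
Qed.

(** The bound by the mean over the circle of radius [r1] is the same for every angle [t], so
    averaging over [t] leaves it unchanged. The weight depends on the other variable only and passes
    through. *)
Lemma dir2_le_inner (g : CC R * CC R -> CC R) (r r0 r1 : R) : 0 <= r -> r <= r0 ->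
  r0 < r1 -> r1 < 1 -> holomorphic2 g ->
  (dir2 mu g r <= ((r1 / (r1 - r0)) ^+ 2)%:E * dir2 mu g r1)%E.
Proof.
move=> rp rr0 r01 r11 hg; have hd2 := holomorphic2_d2 hg.
have r1p : 0 < r1 by exact: le_lt_trans (le_trans rp rr0) r01.
have K0 : 0 < (r1 / (r1 - r0)) ^+ 2 by rewrite exprn_gt0 // divr_gt0 // subr_gt0.
have cm0 x : (0 <= circT (fun s => (cmod (d2 g (rexpi r1 s, x)) ^+ 2)%:E))%E.
  rewrite /circT mule_ge0 ?lee_fin ?invr_ge0 ?(ltW twopi_gt0) //.
  by apply: integral_ge0 => t _; rewrite lee_fin sqr_ge0.
have A0 : (0 <= areaD (fun x => (circT (fun s => (cmod (d2 g (rexpi r1 s, x)) ^+ 2)%:E) * W x)))%E.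
  apply: areaD_ge0 => x x1; apply: mule_ge0; [exact: cm0|exact: poisson_ge0].
rewrite -(dir2_swap r1p r11 hg) -[X in (_ <= _ * X)%E](circT_cst A0).
apply: (circT_le K0) => [t|t|t].
- by apply: areaD_ge0 => x; exact: sqr_poisson_ge0.
- exact: A0.
apply: (areaD_le K0) => [x x1|x x1|x x1].
- exact: sqr_poisson_ge0.
- by apply: mule_ge0; [exact: cm0|exact: poisson_ge0].
rewrite muleA; apply: lee_wpmul2r; first exact: poisson_ge0.
have zr0 : cmod (rexpi r t) <= r0 by rewrite cmod_rexpi.
have [h _] := hol_sections hd2 x1.
exact: (@sqr_cmod_le_circle_mean _ (fun w => d2 g (w, x)) (rexpi r t) r0 r1 zr0 r01 r11 h).
Qed.

(** Radii from [r0] on keep a fixed distance to [cmod lam]. A smaller radius is compared with the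
    quotient, not with [f], at the single radius [r1], where the outer bound is available. The sum
    of both bounds serves all radii. *)
Lemma dir2_divf_bounded (lam : CC R) (f : CC R * CC R -> CC R) : cmod lam < 1 ->
  (forall z, inD2 z -> z.1 = lam -> f z = 0) -> holomorphic2 f ->
  (ereal_sup [set dir2 mu f r | r in `]0%R, 1%R[%classic] < +oo)%E ->
  (ereal_sup [set dir2 mu (divf lam f) r | r in `]0%R, 1%R[%classic] < +oo)%E.
Proof.
move=> l1 f0 hf Soo'.
pose S := ereal_sup [set dir2 mu f r | r in `]0%R, 1%R[%classic].
have Soo : (S < +oo)%E := Soo'.
have hg := holomorphic2_divf f0 l1 hf.
have dS r : 0 < r < 1 -> (dir2 mu f r <= S)%E.
  by move=> r01; apply: ereal_sup_ubound; exists r => //; rewrite /= in_itv.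
have S0 : (0 <= S)%E by apply: le_trans (dir2_ge0 f 2^-1) (dS _ _); rewrite invr_gt0 invf_lt1 // ltr1n andbT.
have SE : S = (fine S)%:E by rewrite fineK // ge0_fin_numE.
pose r0 := (1 + cmod lam) / 2; pose r1 := (1 + r0) / 2.
have lp := cmod_ge0 lam.
have lr0 : cmod lam < r0 by rewrite /r0; lra.
have r0p : 0 < r0 by rewrite /r0; lra.
have r01 : r0 < r1 by rewrite /r1 /r0; lra.
have r11 : r1 < 1 by rewrite /r1 /r0; lra.
pose C := (r0 - cmod lam) ^- 2; pose K := (r1 / (r1 - r0)) ^+ 2.
have C0 : 0 <= C by rewrite invr_ge0 sqr_ge0.
have K0 : 0 <= K by rewrite sqr_ge0.
have outer r : r0 <= r -> r < 1 -> (dir2 mu (divf lam f) r <= (C * fine S)%:E)%E.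
  move=> r0r r_1; apply: le_trans (dir2_le_outer lr0 r0r r_1 hf) _.
  rewrite EFinM -SE lee_wpmul2l ?lee_fin // dS // r_1 andbT; exact: lt_le_trans r0r.
apply: (@le_lt_trans _ _ ((C * fine S)%:E + (K * (C * fine S))%:E)%E); last by rewrite -EFinD ltry.
have fS0 : 0 <= fine S by rewrite fine_ge0.
apply: ge_ereal_sup => _ [r + <-]; rewrite /= in_itv /= => /andP[rp r_1].
have [r0r|/ltW rr0] := leP r0 r.
  by apply: le_trans (outer r r0r r_1) _; rewrite -EFinD lee_fin lerDl; exact: mulr_ge0 K0 (mulr_ge0 C0 fS0).
apply: le_trans (dir2_le_inner (ltW rp) rr0 r01 r11 hg) _.
rewrite -/K; apply: (@le_trans _ _ (K%:E * (C * fine S)%:E)%E).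
  by apply: lee_wpmul2l; [rewrite lee_fin|exact: outer (ltW r01) r11].
by rewrite -EFinM -EFinD lee_fin lerDr; exact: mulr_ge0 C0 fS0.
Qed.
End DirichletTwo.

(** * Real derivatives of holomorphic functions and the divergence identity *)

Section GreenAlgebra.
Context {R : realType}.

Definition hol1 (phi : CC R -> CC R) : Prop :=
  forall z, cmod z < 1 -> exists c, cderiv phi z c.
Definition dC (phi : CC R -> CC R) (z : CC R) : CC R := 'D_1 phi z.

Lemma hol1_cderiv phi z : hol1 phi -> cmod z < 1 -> cderiv phi z (dC phi z).
Proof. by move=> h /h[c hc]; rewrite /dC (cderiv_derive hc). Qed.

(** Derivative along a line with unit direction [v], for any real-linear functional bounded by the
    modulus. The directions 1 and ['i%C] together give the Cauchy-Riemann equations. *)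
Lemma is_derive_line (phi : CC R -> CC R) (c v : CC R) (gam : R -> CC R) (x : R) :
  cmod v = 1 -> (forall y, gam y - gam x = (y - x)%:C%C * v) -> cderiv phi (gam x) c ->
  is_derive x 1 (fun y => complex.Re (phi (gam y))) (complex.Re (c * v)) /\
  is_derive x 1 (fun y => complex.Im (phi (gam y))) (complex.Im (c * v)).
Proof.
move=> v1 gamE hc.
have key (L : CC R -> R) : (forall a b, L (a - b) = L a - L b) ->
    (forall (k : R) a, L (k%:C%C * a) = k * L a) -> (forall a, `|L a| <= cmod a) ->
    is_derive x 1 (fun y => L (phi (gam y))) (L (c * v)).
  move=> LB LZ Lb.
  have h : (fun h : R => h^-1 *: (((fun y => L (phi (gam y))) \o shift x) (h *: (1 : R)) - L (phi (gam x)))) @ 0^' --> L (c * v).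
    apply/cvgrPdist_le => e e0; have [d d0 hd] := hc e e0.
    exists d => // h /= hd0 h0.
    have hd' : `|h| < d by move: hd0; rewrite distrC subr0.
    have h1 : h *: (1 : R) = h by exact: mulr1.
    rewrite h1 -[_ *: _]/(h^-1 * _).
    have gE : gam (h + x) - gam x = h%:C%C * v by rewrite gamE addrK.
    have cE : cmod (gam (h + x) - gam x) = `|h|.
      by rewrite gE cmodM v1 mulr1 /cmod /= expr0n addr0 sqrtr_sqr.
    have := hd (gam (h + x)); rewrite cE => /(_ hd') hh.
    have -> : L (c * v) - h^-1 * (L (phi (gam (h + x))) - L (phi (gam x))) =
       - (h^-1 * L (phi (gam (h + x)) - phi (gam x) - c * (gam (h + x) - gam x))).
      rewrite LB LB gE mulrCA LZ; field.
      by [].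
    rewrite normrN normrM normfV ler_pdivrMl ?normr_gt0 // [leRHS]mulrC.
    exact: le_trans (Lb _) hh.
  by apply: DeriveDef; [apply/cvg_ex; eexists; exact: h|apply: (cvg_lim _ h)].
split; apply: key.
- by move=> a b; rewrite ReD ReN.
- by move=> k a; rewrite ReM /= mul0r subr0.
- exact: normr_Re_le.
- by move=> a b; rewrite ImD ImN.
- by move=> k a; rewrite ImM /= mul0r addr0.
- exact: normr_Im_le.
Qed.

Lemma is_derive_horizontal phi (x y : R) (c : CC R) : cderiv phi (Complex x y) c ->
  is_derive x 1 (fun x => complex.Re (phi (Complex x y))) (complex.Re c) /\
  is_derive x 1 (fun x => complex.Im (phi (Complex x y))) (complex.Im c).
Proof.
move=> h; have := @is_derive_line phi c 1 (fun x => Complex x y) x cmod1.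
rewrite mulr1; apply => // w; apply: CC_eqP; rewrite mulr1 ?ReD ?ImD ?ReN ?ImN //=.
exact: subrr.
Qed.

Lemma is_derive_vertical phi (x y : R) (c : CC R) : cderiv phi (Complex x y) c ->
  is_derive y 1 (fun y => complex.Re (phi (Complex x y))) (- complex.Im c) /\
  is_derive y 1 (fun y => complex.Im (phi (Complex x y))) (complex.Re c).
Proof.
move=> h; have i1 : cmod ('i%C : CC R) = 1 by rewrite /cmod /= expr0n expr1n add0r sqrtr1.
have := @is_derive_line phi c 'i%C (fun y => Complex x y) y i1.
rewrite ReM ImM /= !mulr0 !mulr1 sub0r addr0; apply => // w.
apply: CC_eqP; rewrite ?ReM ?ImM ?ReD ?ImD ?ReN ?ImN /=; ring.
Qed.

Lemma is_derive_val (f : R -> R) (x a b : R) : is_derive x 1 f a -> a = b -> is_derive x 1 f b.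
Proof. by move=> h <-. Qed.
Lemma rderivD (f g : R -> R) (x a b : R) : is_derive x 1 f a -> is_derive x 1 g b ->
  is_derive x 1 (fun y => f y + g y) (a + b).
Proof. by move=> h h'; exact: is_deriveD. Qed.
Lemma rderivB (f g : R -> R) (x a b : R) : is_derive x 1 f a -> is_derive x 1 g b ->
  is_derive x 1 (fun y => f y - g y) (a - b).
Proof. by move=> h h'; exact: is_deriveB. Qed.
Lemma rderivM (f g : R -> R) (x a b : R) : is_derive x 1 f a -> is_derive x 1 g b ->
  is_derive x 1 (fun y => f y * g y) (f x * b + g x * a).
Proof. by move=> h h'; exact: is_deriveM. Qed.
Lemma rderiv_cst (c x : R) : is_derive x 1 (fun=> c) 0.
Proof. exact: is_derive_cst. Qed.
Lemma rderiv_id (x : R) : is_derive x 1 (fun y => y) 1.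
Proof. exact: is_derive_id. Qed.

Section GreenFlux.
(* [u + iv] is a holomorphic function with derivatives [p + iq] and [s + it], and [w]
   a harmonic weight with gradient [(a, b)] and second derivative [h] in x.
   [fluxx] and [fluxy] are the components of w grad(Phi) - Phi grad(w) for
   Phi = (x^2 + y^2 - r^2) (u^2 + v^2). *)
Context (u v p q s t w a b h : R -> R -> R) (r : R).
Let N x y := u x y * u x y + v x y * v x y.
Let Nx x y := 2 * (u x y * p x y + v x y * q x y).
Let Ny x y := 2 * (v x y * p x y - u x y * q x y).
Let E (x y : R) := x * x + y * y - r * r.
Let G x y := p x y * p x y + q x y * q x y.
Let H x y := u x y * s x y + v x y * t x y.

Definition fluxx x y := w x y * (2 * x * N x y + E x y * Nx x y) - E x y * N x y * a x y.
Definition fluxy x y := w x y * (2 * y * N x y + E x y * Ny x y) - E x y * N x y * b x y.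
Definition dfluxx x y := w x y * (2 * N x y + 4 * x * Nx x y + E x y * (2 * (G x y + H x y)))
  - E x y * N x y * h x y.
Definition dfluxy x y := w x y * (2 * N x y + 4 * y * Ny x y + E x y * (2 * (G x y - H x y)))
  + E x y * N x y * h x y.

(** This is w Laplace(Phi) - Phi Laplace(w). Harmonicity cancels [h] against [- h], and likewise the
    terms [H] with second derivatives of the holomorphic function k = u + i v. What remains is 4 w
    (|(z k)'|^2 - r^2 |k'|^2). *)
Lemma flux_divergence x y : dfluxx x y + dfluxy x y = 4 * w x y *
  ((u x y + (x * p x y - y * q x y)) ^+ 2 + (v x y + (x * q x y + y * p x y)) ^+ 2
   - r ^+ 2 * (p x y ^+ 2 + q x y ^+ 2)).
Proof. rewrite /dfluxx /dfluxy /N /Nx /Ny /G /H /E; ring. Qed.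

Lemma fluxx_boundary (x y : R) : x ^+ 2 + y ^+ 2 = r ^+ 2 -> fluxx x y = 2 * x * (w x y * N x y).
Proof.
move=> e; have E0 : E x y = 0 by rewrite /E -!expr2 e subrr.
by rewrite /fluxx E0; ring.
Qed.

Lemma fluxy_boundary (x y : R) : x ^+ 2 + y ^+ 2 = r ^+ 2 -> fluxy x y = 2 * y * (w x y * N x y).
Proof.
move=> e; have E0 : E x y = 0 by rewrite /E -!expr2 e subrr.
by rewrite /fluxy E0; ring.
Qed.

Lemma sqr_sum_ge0 x y : 0 <= N x y.
Proof. by rewrite /N -!expr2 addr_ge0 // sqr_ge0. Qed.

Lemma is_derive_fluxx (x y : R) :
  is_derive x 1 (u^~ y) (p x y) -> is_derive x 1 (v^~ y) (q x y) ->
  is_derive x 1 (p^~ y) (s x y) -> is_derive x 1 (q^~ y) (t x y) ->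
  is_derive x 1 (w^~ y) (a x y) -> is_derive x 1 (a^~ y) (h x y) ->
  is_derive x 1 (fluxx^~ y) (dfluxx x y).
Proof.
move=> du dv dp dq dw da.
have dN := rderivD (rderivM du du) (rderivM dv dv).
have dN' := rderivM (rderiv_cst 2 x) (rderivD (rderivM du dp) (rderivM dv dq)).
have dE := rderivB (rderivD (rderivM (rderiv_id x) (rderiv_id x)) (rderiv_cst (y * y) x)) (rderiv_cst (r * r) x).
have d := rderivB (rderivM dw (rderivD (rderivM (rderivM (rderiv_cst 2 x) (rderiv_id x)) dN)
  (rderivM dE dN'))) (rderivM (rderivM dE dN) da).
apply: (is_derive_val d); rewrite /dfluxx /N /Nx /G /H /E; ring.
Qed.

Lemma is_derive_fluxy (x y : R) :
  is_derive y 1 (u x) (- q x y) -> is_derive y 1 (v x) (p x y) ->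
  is_derive y 1 (p x) (- t x y) -> is_derive y 1 (q x) (s x y) ->
  is_derive y 1 (w x) (b x y) -> is_derive y 1 (b x) (- h x y) ->
  is_derive y 1 (fluxy x) (dfluxy x y).
Proof.
move=> du dv dp dq dw da.
have dN := rderivD (rderivM du du) (rderivM dv dv).
have dN' := rderivM (rderiv_cst 2 y) (rderivB (rderivM dv dp) (rderivM du dq)).
have dE := rderivB (rderivD (rderiv_cst (x * x) y) (rderivM (rderiv_id y) (rderiv_id y))) (rderiv_cst (r * r) y).
have d := rderivB (rderivM dw (rderivD (rderivM (rderivM (rderiv_cst 2 y) (rderiv_id y)) dN)
  (rderivM dE dN'))) (rderivM (rderivM dE dN) da).
apply: (is_derive_val d); rewrite /dfluxy /N /Ny /G /H /E; ring.
Qed.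

(** Both derivatives are polynomials in the listed functions, so any class closed under ring
    operations contains them. It is used for separate continuity at a point and for bounded
    measurability on a disc. *)
Lemma dflux_closed (P : (R -> R -> R) -> Prop) :
  (forall f g, P f -> P g -> P (fun x y => f x y + g x y)) ->
  (forall f g, P f -> P g -> P (fun x y => f x y - g x y)) ->
  (forall f g, P f -> P g -> P (fun x y => f x y * g x y)) ->
  (forall c : R, P (fun _ _ => c)) -> P (fun x _ => x) -> P (fun _ y => y) ->
  P u -> P v -> P p -> P q -> P s -> P t -> P w -> P h -> P dfluxx /\ P dfluxy.
Proof.
move=> PD PB PM Pc Px Py Pu Pv Pp Pq Ps Pt Pw Ph.
have PN : P N := PD _ _ (PM _ _ Pu Pu) (PM _ _ Pv Pv).
have PNx : P Nx := PM _ _ (Pc 2) (PD _ _ (PM _ _ Pu Pp) (PM _ _ Pv Pq)).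
have PNy : P Ny := PM _ _ (Pc 2) (PB _ _ (PM _ _ Pv Pp) (PM _ _ Pu Pq)).
have PE : P E := PB _ _ (PD _ _ (PM _ _ Px Px) (PM _ _ Py Py)) (Pc (r * r)).
have PG : P G := PD _ _ (PM _ _ Pp Pp) (PM _ _ Pq Pq).
have PH : P H := PD _ _ (PM _ _ Pu Ps) (PM _ _ Pv Pt).
split.
  exact: (PB _ _ (PM _ _ Pw (PD _ _ (PD _ _ (PM _ _ (Pc 2) PN) (PM _ _ (PM _ _ (Pc 4) Px) PNx))
    (PM _ _ PE (PM _ _ (Pc 2) (PD _ _ PG PH))))) (PM _ _ (PM _ _ PE PN) Ph)).
exact: (PD _ _ (PM _ _ Pw (PD _ _ (PD _ _ (PM _ _ (Pc 2) PN) (PM _ _ (PM _ _ (Pc 4) Py) PNy))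
    (PM _ _ PE (PM _ _ (Pc 2) (PB _ _ PG PH))))) (PM _ _ (PM _ _ PE PN) Ph)).
Qed.
End GreenFlux.
End GreenAlgebra.

(** * The sign of an integrated divergence over a closed disc, by slicing *)

Section GreenIntegral.
Context {R : realType}.
Local Notation T := (measurableTypeR R).
Local Notation leb := (@lebesgue_measure R).

Definition cdisc (r : R) : set (T * T) := [set p | p.1 ^+ 2 + p.2 ^+ 2 <= r ^+ 2].

Lemma measurable_cdisc r : measurable (cdisc r).
Proof.
rewrite (_ : cdisc r = ~` [set p : T * T | - (p.1 ^+ 2 + p.2 ^+ 2) < - r ^+ 2]).
  apply: measurableC.
  apply: (@measurable_lt_fun _ _ _ (fun p : T * T => - (p.1 ^+ 2 + p.2 ^+ 2))).
  under eq_fun do rewrite -sub0r.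
  apply: measurable_funB; first exact: measurable_cst.
  apply: measurable_funD; apply: measurable_funX.
    exact: measurable_fst.
  exact: measurable_snd.
apply/funext => p; apply/propext; rewrite /cdisc /= ltrN2 ltNge.
by split => [->|/negP]; rewrite ?negbK.
Qed.

Lemma cdiscP (r : R) (p : T * T) : 0 <= r ->
  cdisc r p <-> cmod (Complex p.1 p.2 : CC R) <= r.
Proof.
move=> r0.
have -> : (cmod (Complex p.1 p.2 : CC R) <= r) = (p.1 ^+ 2 + p.2 ^+ 2 <= r ^+ 2).
  by rewrite -(ler_pXn2r (n := 2)) ?nnegrE ?cmod_ge0 // sqr_cmod.
by [].
Qed.

Lemma leb2_cdisc_lty (r : R) : 0 <= r -> (leb2 (cdisc r) < +oo)%E.
Proof.
move=> r0; pose I := `[- r, r]%classic : set T.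
have mI : measurable I by exact: measurable_itv.
apply: (@le_lt_trans _ _ (leb2 (I `*` I))).
  apply: le_measure; rewrite ?inE //; first exact: measurable_cdisc.
    exact: measurableX.
  move=> [x y]; rewrite /cdisc /= => h.
  have h1 : x ^+ 2 <= r ^+ 2 by apply: le_trans h; rewrite lerDl sqr_ge0.
  have h2 : y ^+ 2 <= r ^+ 2 by apply: le_trans h; rewrite lerDr sqr_ge0.
  have key (z : R) : z ^+ 2 <= r ^+ 2 -> - r <= z <= r.
    rewrite -ler_norml -[z ^+ 2]real_normK ?num_real // => hz.
    by rewrite -(ler_pXn2r (n := 2)) ?nnegrE.
  by split; rewrite /I /= in_itv /=; exact: key.
rewrite /leb2 product_measure1E // lte_mul_pinfty //.
  by rewrite ge0_fin_numE //= lebesgue_measure_itv /=; case: ifP => // _; rewrite -EFinB ltry.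
by rewrite /= lebesgue_measure_itv /=; case: ifP => // _; rewrite -EFinB ltry.
Qed.

(** Bounded measurable functions: integrable on discs and, unlike integrable functions in general,
    stable under products. *)
Definition bm (D : set (T * T)) (f : R -> R -> R) : Prop :=
  measurable_fun D (fun p : T * T => f p.1 p.2) /\
  exists M : R, forall p, D p -> `|f p.1 p.2| <= M.

Lemma bmD D f g : bm D f -> bm D g -> bm D (fun x y => f x y + g x y).
Proof.
move=> [mf [M hM]] [mg [M' hM']]; split; first exact: measurable_funD.
exists (M + M') => p Dp; apply: le_trans (ler_normD _ _) _.
by rewrite lerD ?hM ?hM'.
Qed.

Lemma bmB D f g : bm D f -> bm D g -> bm D (fun x y => f x y - g x y).
Proof.
move=> [mf [M hM]] [mg [M' hM']]; split; first exact: measurable_funB.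
exists (M + M') => p Dp; apply: le_trans (ler_normB _ _) _.
by rewrite lerD ?hM ?hM'.
Qed.

Lemma bmM D f g : bm D f -> bm D g -> bm D (fun x y => f x y * g x y).
Proof.
move=> [mf [M hM]] [mg [M' hM']]; split; first exact: measurable_funM.
by exists (M * M') => p Dp; rewrite normrM ler_pM ?hM ?hM'.
Qed.

Lemma bm_cst D (c : R) : bm D (fun _ _ => c).
Proof. by split; [exact: measurable_cst|exists `|c|]. Qed.

Lemma bm_fst r : 0 <= r -> bm (cdisc r) (fun x _ => x).
Proof.
move=> r0; split; first by apply: measurable_funTS; exact: measurable_fst.
exists r => p /(cdiscP _ r0); apply: le_trans.
exact: (normr_Re_le (Complex p.1 p.2)).
Qed.

Lemma bm_snd r : 0 <= r -> bm (cdisc r) (fun _ y => y).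
Proof.
move=> r0; split; first by apply: measurable_funTS; exact: measurable_snd.
exists r => p /(cdiscP _ r0); apply: le_trans.
exact: (normr_Im_le (Complex p.1 p.2)).
Qed.

Lemma bm_integrable r f : 0 <= r -> bm (cdisc r) f ->
  leb2.-integrable (cdisc r) (fun p => (f p.1 p.2)%:E).
Proof.
move=> r0 [mf [M hM]].
apply: (@measurable_bounded_integrable _ _ _ leb2 (fun p : T * T => f p.1 p.2)) => //.
- exact: measurable_cdisc.
- exact: leb2_cdisc_lty.
exists M; split; first exact: num_real.
by move=> x Mx p Dp; apply: le_trans (hM p Dp) (ltW Mx).
Qed.

(** A slice of the disc is empty or a segment from [- c] to [c], and the fundamental theorem of
    calculus leaves [A c y - A (- c) y], whose sign is the boundary hypothesis. *)
Let slice_ge0 (r : R) (A A1 : R -> R -> R) (y : R) : 0 <= r ->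
  (forall x : R, x ^+ 2 + y ^+ 2 <= r ^+ 2 -> is_derive x 1 (A^~ y) (A1 x y)) ->
  (forall x : R, x ^+ 2 + y ^+ 2 <= r ^+ 2 -> (A1^~ y) @ nbhs x --> A1 x y) ->
  (forall x : R, x ^+ 2 + y ^+ 2 = r ^+ 2 -> 0 <= x -> 0 <= A x y /\ A (- x) y <= 0) ->
  (0 <= \int[leb]_x (if (x ^+ 2 + y ^+ 2 <= r ^+ 2)%R then (A1 x y)%:E else 0))%E.
Proof.
move=> r0 dA cA1 bA.
have [yr|yr] := leP (y ^+ 2) (r ^+ 2); last first.
  rewrite integral0_eq // => x _; rewrite ifF //.
  apply/negbTE; rewrite -ltNge; apply: lt_le_trans yr _.
  by rewrite lerDr sqr_ge0.
pose c : R := Num.sqrt (r ^+ 2 - y ^+ 2).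
have c0 : 0 <= c by exact: sqrtr_ge0.
have c2 : c ^+ 2 = r ^+ 2 - y ^+ 2 by rewrite sqr_sqrtr // subr_ge0.
have inE' x : (x ^+ 2 + y ^+ 2 <= r ^+ 2) = (- c <= x <= c).
  rewrite -ler_norml -lerBrDr -c2 -[x ^+ 2]real_normK ?num_real //.
  by rewrite ler_pXn2r ?nnegrE.
have -> : (\int[leb]_x (if (x ^+ 2 + y ^+ 2 <= r ^+ 2)%R then (A1 x y)%:E else 0) =
    \int[leb]_(x in `[(- c)%R, c%R]) (A1 x y)%:E)%E.
  rewrite [RHS]integral_mkcond; apply: eq_integral => x _; rewrite patchE inE'.
  by congr (if _ then _ else _); apply/idP/idP; rewrite inE /= in_itv /=.
have int1 : leb.-integrable `[(- c), c] (EFin \o (A1^~ y)).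
  by apply: segment_integrable => x; rewrite -inE'; exact: cA1.
have fi : (\int[leb]_(x in `[(- c)%R, c%R]) (A1 x y)%:E)%E \is a fin_num.
  exact: (integrable_fin_num _ int1).
rewrite -(fineK fi) lee_fin -/(Rintegral _ _ _).
have cc : - c <= c by lra.
have dA' x : - c <= x <= c -> is_derive x 1 (A^~ y) (A1 x y) by rewrite -inE'; exact: dA.
have cA1' x : - c <= x <= c -> (A1^~ y) @ nbhs x --> A1 x y by rewrite -inE'; exact: cA1.
rewrite (FTC_segment cc dA' cA1').
have [|h1 h2] := bA c _ c0; first by rewrite c2 subrK.
by rewrite subr_ge0 (le_trans h2).
Qed.

(** A one-sided divergence theorem: [A1] is integrated along horizontal chords first, [B1] along
    vertical ones, and an outward flux at all end points makes both integrals nonnegative. *)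
Lemma flux_integral_ge0 (r : R) (A A1 B B1 : R -> R -> R) : 0 <= r ->
  (forall x y : R, x ^+ 2 + y ^+ 2 <= r ^+ 2 -> is_derive x 1 (A^~ y) (A1 x y)) ->
  (forall x y : R, x ^+ 2 + y ^+ 2 <= r ^+ 2 -> is_derive y 1 (B x) (B1 x y)) ->
  (forall x y : R, x ^+ 2 + y ^+ 2 <= r ^+ 2 -> (A1^~ y) @ nbhs x --> A1 x y) ->
  (forall x y : R, x ^+ 2 + y ^+ 2 <= r ^+ 2 -> (B1 x) @ nbhs y --> B1 x y) ->
  (forall x y : R, x ^+ 2 + y ^+ 2 = r ^+ 2 -> 0 <= x -> 0 <= A x y /\ A (- x) y <= 0) ->
  (forall x y : R, x ^+ 2 + y ^+ 2 = r ^+ 2 -> 0 <= y -> 0 <= B x y /\ B x (- y) <= 0) ->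
  bm (cdisc r) A1 -> bm (cdisc r) B1 ->
  (0 <= \int[leb2]_(p in cdisc r) (A1 p.1 p.2 + B1 p.1 p.2)%:E)%E.
Proof.
move=> r0 dA dB cA cB bA bB mA mB.
have iA := bm_integrable r0 mA; have iB := bm_integrable r0 mB.
have mD := measurable_cdisc r.
have rI f : leb2.-integrable (cdisc r) f -> leb2.-integrable setT (f \_ (cdisc r)).
  by move=> h; apply/(integrable_restrict leb2 mD measurableT f); rewrite setTI.
rewrite (integralD_EFin mD iA iB); apply: adde_ge0.
  rewrite integral_mkcond -(integral21_prod_meas1 (m1 := leb1) (m2 := leb1) (rI _ iA)).
  apply: integral_ge0 => y _.
  apply: le_trans (slice_ge0 r0 (dA^~ y) (cA^~ y) (bA^~ y)) _.
  rewrite le_eqVlt; apply/orP; left; apply/eqP; apply: eq_integral => x _.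
  rewrite patchE; congr (if _ then _ else _).
  by apply/idP/idP => [h|/set_mem]; [apply/mem_set|].
rewrite integral_mkcond -(integral12_prod_meas1 (m1 := leb1) (m2 := leb1) (rI _ iB)).
apply: integral_ge0 => x _.
have h : (0 <= \int[leb]_y (if (y ^+ 2 + x ^+ 2 <= r ^+ 2)%R then (B1 x y)%:E else 0))%E.
  by apply: (@slice_ge0 r (fun y x => B x y) (fun y x => B1 x y) x r0) => y; rewrite addrC;
    [exact: dB|exact: cB|exact: bB].
apply: le_trans h _.
rewrite le_eqVlt; apply/orP; left; apply/eqP; apply: eq_integral => y _.
rewrite patchE addrC; congr (if _ then _ else _).
by apply/idP/idP => [h|/set_mem]; [apply/mem_set|].
Qed.
End GreenIntegral.

(** * Green's inequality for a holomorphic function and a positive harmonic weight *)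

Section HolomorphicGreen.
Context {R : realType}.
Implicit Types (z : CC R) (phi psi : CC R -> CC R) (x y r : R).
Local Notation T := (measurableTypeR R).

(** Regarding [phi] as constant in a second variable makes the two-variable results available:
    holomorphic derivatives, boundedness and measurability. *)
Lemma hol1_holomorphic2 phi : hol1 phi -> holomorphic2 (fun w => phi w.1).
Proof.
move=> h z [z1 z2]; have [c hc] := h _ z1; split.
- apply/ccont2P => e e0; have [d d0 hd] := cderiv_ccont hc e0.
  by exists d => // w w1 _; exact: hd.
- exact: cderiv_derivable hc.
- exact: cderiv_derivable (cderiv_cst z.2 (phi z.1)).
Qed.

Lemma hol1_dC phi : hol1 phi -> hol1 (dC phi).
Proof.
move=> h.
have c0 : cmod (0 : CC R) < 1 by rewrite cmod0 ltr01.
exact: (hol_sections (holomorphic2_d1 (hol1_holomorphic2 h)) c0).1.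
Qed.

Lemma hol1M phi psi : hol1 phi -> hol1 psi -> hol1 (fun z => phi z * psi z).
Proof.
by move=> h h' z z1; have [c hc] := h z z1; have [c' hc'] := h' z z1; eexists; exact: cderivM hc hc'.
Qed.

Lemma hol1D phi psi : hol1 phi -> hol1 psi -> hol1 (fun z => phi z + psi z).
Proof.
by move=> h h' z z1; have [c hc] := h z z1; have [c' hc'] := h' z z1; eexists; exact: cderivD hc hc'.
Qed.

Lemma hol1_subc (c : CC R) : hol1 (fun z => z - c).
Proof. by move=> z _; exists 1; exact: cderiv_subc. Qed.

Definition cre phi x y : R := complex.Re (phi (Complex x y)).
Definition cim phi x y : R := complex.Im (phi (Complex x y)).

Lemma cmod_lt1 x y : x ^+ 2 + y ^+ 2 < 1 -> cmod (Complex x y : CC R) < 1.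
Proof.
move=> h; rewrite -(ltr_pXn2r (n := 2)) ?nnegrE ?cmod_ge0 ?ler01 //.
by rewrite expr1n sqr_cmod.
Qed.

Lemma hol1_horizontal phi x y : hol1 phi -> x ^+ 2 + y ^+ 2 < 1 ->
  is_derive x 1 ((cre phi)^~ y) (cre (dC phi) x y) /\
  is_derive x 1 ((cim phi)^~ y) (cim (dC phi) x y).
Proof. by move=> h /cmod_lt1 z1; exact: is_derive_horizontal (hol1_cderiv h z1). Qed.

Lemma hol1_vertical phi x y : hol1 phi -> x ^+ 2 + y ^+ 2 < 1 ->
  is_derive y 1 (cre phi x) (- cim (dC phi) x y) /\
  is_derive y 1 (cim phi x) (cre (dC phi) x y).
Proof. by move=> h /cmod_lt1 z1; exact: is_derive_vertical (hol1_cderiv h z1). Qed.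

Definition sepcont x y (f : R -> R -> R) : Prop :=
  (f^~ y @ nbhs x --> f x y) /\ (f x @ nbhs y --> f x y).

Lemma is_derive_cvg (f : R -> R) (a c : R) : is_derive a 1 f c -> f @ nbhs a --> f a.
Proof.
by move=> [h _]; apply: differentiable_continuous; apply/derivable1_diffP.
Qed.

Lemma hol1_sepcont phi x y : hol1 phi -> x ^+ 2 + y ^+ 2 < 1 ->
  sepcont x y (cre phi) /\ sepcont x y (cim phi).
Proof.
move=> h z1; have [h1 h2] := hol1_horizontal h z1; have [v1 v2] := hol1_vertical h z1.
split; split.
- exact: is_derive_cvg h1.
- exact: is_derive_cvg v1.
- exact: is_derive_cvg h2.
- exact: is_derive_cvg v2.
Qed.

Lemma hol1_bm phi r : hol1 phi -> 0 <= r -> r < 1 ->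
  bm (cdisc r) (cre phi) /\ bm (cdisc r) (cim phi).
Proof.
move=> h r0 r1; pose s := (1 + r) / 2; pose t := (1 + s) / 2.
have rs : r < s by rewrite /s; lra.
have s0 : 0 < s by rewrite /s; lra.
have st : s < t by rewrite /t /s; lra.
have t1 : t < 1 by rewrite /t /s; lra.
have h2 := hol1_holomorphic2 h.
have [a [M [ba fE]]] := holomorphic2_psfun (lt_trans s0 st) t1 h2.
have c0 e : 0 < e -> cmod (0 : CC R) < e by rewrite cmod0.
have zl (p : T * T) : cdisc r p -> cmod (Complex p.1 p.2 : CC R) < s.
  by move=> /(cdiscP _ r0) hp; exact: le_lt_trans rs.
have bd (p : T * T) : cdisc r p -> cmod (phi (Complex p.1 p.2)) <= M / (1 - s / t) ^+ 2.
  move=> /zl hp; rewrite (fE (Complex p.1 p.2, 0)); last 2 first.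
  - exact: lt_trans st.
  - exact: c0 (lt_trans s0 st).
  apply: (psfun_le (lt_trans s0 st) ba _ _ st); first exact: ltW.
  exact: ltW (c0 _ s0).
have [m1 m2] : cmeas (cdisc r) (fun p : T * T => phi (Complex p.1 p.2)).
  apply: (cmeas_hol (Z := fun p : T * T => Complex p.1 p.2) (W := fun=> 0) h2 s0 (lt_trans st t1)).
  - exact: zl.
  - by move=> _ _; exact: c0.
  - by split; apply: measurable_funTS; [exact: measurable_fst|exact: measurable_snd].
  - exact: cmeas_cst.
split; split => //; exists (M / (1 - s / t) ^+ 2) => p Dp; apply: le_trans (bd p Dp).
  exact: normr_Re_le.
exact: normr_Im_le.
Qed.

Lemma bm_sqr_cmod phi r : hol1 phi -> 0 <= r -> r < 1 ->
  bm (cdisc r) (fun x y => cmod (phi (Complex x y)) ^+ 2).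
Proof.
move=> h r0 r1; have [b1 b2] := hol1_bm h r0 r1.
have := bmD (bmM b1 b1) (bmM b2 b2); congr (bm _ _).
by apply/funext => x; apply/funext => y; rewrite sqr_cmod.
Qed.

(** Harmonic because [m] is to be holomorphic. The normalisation comes from Re((e + z) / (e - z)) =
    2 Re(e / (e - z)) - 1. *)
Definition weight (m : CC R -> CC R) x y : R := 2 * cre m x y - 1.

Lemma bm_weight m r : hol1 m -> 0 <= r -> r < 1 -> bm (cdisc r) (weight m).
Proof.
move=> h r0 r1; have [b1 _] := hol1_bm h r0 r1.
exact: (bmB (bmM (bm_cst _ 2) b1) (bm_cst _ 1)).
Qed.

Lemma green_hol (k m : CC R -> CC R) r : hol1 k -> hol1 m -> 0 <= r -> r < 1 ->
  (forall x y, x ^+ 2 + y ^+ 2 < 1 -> 0 <= weight m x y) ->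
  (0 <= \int[leb2]_(p in cdisc r) (4 * weight m p.1 p.2 *
     (cmod (k (Complex p.1 p.2) + Complex p.1 p.2 * dC k (Complex p.1 p.2)) ^+ 2
      - r ^+ 2 * cmod (dC k (Complex p.1 p.2)) ^+ 2))%:E)%E.
Proof.
move=> hk hm r0 r1 w0.
have hk1 := hol1_dC hk; have hk2 := hol1_dC hk1.
have hm1 := hol1_dC hm; have hm2 := hol1_dC hm1.
pose w := weight m.
(* By Cauchy-Riemann the gradient of the weight is (2 Re m', -2 Im m'); its x-derivative in the
   first slot and y-derivative in the second are [h] and [- h]. *)
pose a x y := 2 * cre (dC m) x y.
pose b x y := - 2 * cim (dC m) x y.
pose h x y := 2 * cre (dC (dC m)) x y.
have lt1 x y : x ^+ 2 + y ^+ 2 <= r ^+ 2 -> x ^+ 2 + y ^+ 2 < 1.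
  by move=> /le_lt_trans; apply; rewrite exprn_ilt1.
have wx x y : x ^+ 2 + y ^+ 2 < 1 -> is_derive x 1 (w^~ y) (a x y).
  move=> z1; have [h1 _] := hol1_horizontal hm z1.
  apply: (is_derive_val (rderivB (rderivM (rderiv_cst 2 x) h1) (rderiv_cst 1 x))).
  by rewrite /a mulr0 addr0 subr0.
have wy x y : x ^+ 2 + y ^+ 2 < 1 -> is_derive y 1 (w x) (b x y).
  move=> z1; have [h1 _] := hol1_vertical hm z1.
  apply: (is_derive_val (rderivB (rderivM (rderiv_cst 2 y) h1) (rderiv_cst 1 y))).
  by rewrite /b mulr0 addr0 subr0 mulrN mulNr.
have ax x y : x ^+ 2 + y ^+ 2 < 1 -> is_derive x 1 (a^~ y) (h x y).
  move=> z1; have [h1 _] := hol1_horizontal hm1 z1.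
  apply: (is_derive_val (rderivM (rderiv_cst 2 x) h1)).
  by rewrite /h mulr0 addr0.
have by_ x y : x ^+ 2 + y ^+ 2 < 1 -> is_derive y 1 (b x) (- h x y).
  move=> z1; have [_ h1] := hol1_vertical hm1 z1.
  apply: (is_derive_val (rderivM (rderiv_cst (- 2) y) h1)).
  by rewrite /h mulr0 addr0 mulNr.
pose A := fluxx (cre k) (cim k) (cre (dC k)) (cim (dC k)) w a r.
pose B := fluxy (cre k) (cim k) (cre (dC k)) (cim (dC k)) w b r.
pose A1 := dfluxx (cre k) (cim k) (cre (dC k)) (cim (dC k)) (cre (dC (dC k))) (cim (dC (dC k))) w h r.
pose B1 := dfluxy (cre k) (cim k) (cre (dC k)) (cim (dC k)) (cre (dC (dC k))) (cim (dC (dC k))) w h r.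
have dA x y : x ^+ 2 + y ^+ 2 <= r ^+ 2 -> is_derive x 1 (A^~ y) (A1 x y).
  move=> /lt1 z1.
  exact: (is_derive_fluxx r (hol1_horizontal hk z1).1 (hol1_horizontal hk z1).2
    (hol1_horizontal hk1 z1).1 (hol1_horizontal hk1 z1).2 (wx x y z1) (ax x y z1)).
have dB x y : x ^+ 2 + y ^+ 2 <= r ^+ 2 -> is_derive y 1 (B x) (B1 x y).
  move=> /lt1 z1.
  exact: (is_derive_fluxy r (hol1_vertical hk z1).1 (hol1_vertical hk z1).2
    (hol1_vertical hk1 z1).1 (hol1_vertical hk1 z1).2 (wy x y z1) (by_ x y z1)).
have cont x y : x ^+ 2 + y ^+ 2 <= r ^+ 2 -> sepcont x y A1 /\ sepcont x y B1.
  move=> /lt1 z1; apply: (@dflux_closed R _ _ _ _ _ _ _ _ r (sepcont x y)).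
  - by move=> f g [f1 f2] [g1 g2]; split; [exact: cvgD f1 g1|exact: cvgD f2 g2].
  - by move=> f g [f1 f2] [g1 g2]; split; [exact: cvgB f1 g1|exact: cvgB f2 g2].
  - by move=> f g [f1 f2] [g1 g2]; split; [exact: cvgM f1 g1|exact: cvgM f2 g2].
  - by move=> c; split; exact: cvg_cst.
  - by split; [exact: cvg_id|exact: cvg_cst].
  - by split; [exact: cvg_cst|exact: cvg_id].
  - exact: (hol1_sepcont hk z1).1.
  - exact: (hol1_sepcont hk z1).2.
  - exact: (hol1_sepcont hk1 z1).1.
  - exact: (hol1_sepcont hk1 z1).2.
  - exact: (hol1_sepcont hk2 z1).1.
  - exact: (hol1_sepcont hk2 z1).2.
  - by split; [exact: is_derive_cvg (wx x y z1)|exact: is_derive_cvg (wy x y z1)].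
  - have [f1 f2] := (hol1_sepcont hm2 z1).1.
    by split; [exact: cvgM (cvg_cst _) f1|exact: cvgM (cvg_cst _) f2].
have [mA mB] : bm (cdisc r) A1 /\ bm (cdisc r) B1.
  apply: (@dflux_closed R _ _ _ _ _ _ _ _ r (bm (cdisc r))).
  - exact: bmD.
  - exact: bmB.
  - exact: bmM.
  - exact: bm_cst.
  - exact: bm_fst.
  - exact: bm_snd.
  - exact: (hol1_bm hk r0 r1).1.
  - exact: (hol1_bm hk r0 r1).2.
  - exact: (hol1_bm hk1 r0 r1).1.
  - exact: (hol1_bm hk1 r0 r1).2.
  - exact: (hol1_bm hk2 r0 r1).1.
  - exact: (hol1_bm hk2 r0 r1).2.
  - exact: bm_weight.
  - exact: (bmM (bm_cst _ 2) (hol1_bm hm2 r0 r1).1).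
(* On the boundary circle the flux is [2 * x] or [2 * y] times this quantity, so it points
   outward. *)
have wN x y : x ^+ 2 + y ^+ 2 = r ^+ 2 ->
    0 <= w x y * (cre k x y * cre k x y + cim k x y * cim k x y).
  move=> e; apply: mulr_ge0; first by apply: w0; apply: lt1; rewrite e.
  exact: sqr_sum_ge0.
have bA x y : x ^+ 2 + y ^+ 2 = r ^+ 2 -> 0 <= x -> 0 <= A x y /\ A (- x) y <= 0.
  move=> e x0; have e' : (- x) ^+ 2 + y ^+ 2 = r ^+ 2 by rewrite sqrrN.
  split; first by rewrite /A fluxx_boundary //; exact: (mulr_ge0 (mulr_ge0 (ler0n _ 2) x0) (wN _ _ e)).
  rewrite /A fluxx_boundary //; apply: mulr_le0_ge0 (wN _ _ e').
  by rewrite mulrN oppr_le0 mulr_ge0.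
have bB x y : x ^+ 2 + y ^+ 2 = r ^+ 2 -> 0 <= y -> 0 <= B x y /\ B x (- y) <= 0.
  move=> e x0; have e' : x ^+ 2 + (- y) ^+ 2 = r ^+ 2 by rewrite sqrrN.
  split; first by rewrite /B fluxy_boundary //; exact: (mulr_ge0 (mulr_ge0 (ler0n _ 2) x0) (wN _ _ e)).
  rewrite /B fluxy_boundary //; apply: mulr_le0_ge0 (wN _ _ e').
  by rewrite mulrN oppr_le0 mulr_ge0.
have := flux_integral_ge0 r0 dA dB (fun x y hz => (cont x y hz).1.1)
  (fun x y hz => (cont x y hz).2.2) bA bB mA mB.
move=> /le_trans; apply; rewrite le_eqVlt; apply/orP; left; apply/eqP.
apply: eq_integral => p _; congr EFin; rewrite /A1 /B1 flux_divergence.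
rewrite !sqr_cmod ReD ImD ReM ImM /cre /cim /=.
congr (_ * (_ + _ - _)).
Qed.
End HolomorphicGreen.

(** * The one-variable division estimate for a single Poisson kernel *)

Section WeightedDirichlet.
Context {R : realType}.
Implicit Types (z : CC R) (phi psi : CC R -> CC R) (x y r : R).
Local Notation T := (measurableTypeR R).

(* [2 Re (pkmap t) - 1] is the Poisson kernel at [e^{it}]. *)
Definition pkmap (t : R) z : CC R := - rexpi 1 t * (z - rexpi 1 t)^-1.

Lemma disc_neq_rexpi t z : cmod z < 1 -> z != rexpi 1 t.
Proof. by move=> z1; rewrite -subr_eq0 -oppr_eq0 opprB rexpi_neq. Qed.

Lemma hol1_pkmap t : hol1 (pkmap t).
Proof.
move=> z z1; eexists.
exact: cderivM (cderiv_cst z (- rexpi 1 t)) (cderivV (disc_neq_rexpi t z1)).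
Qed.

Lemma weight_pkmap t x y : x ^+ 2 + y ^+ 2 < 1 -> weight (pkmap t) x y = pker (x, y) t.
Proof.
move=> xy; have z1 := cmod_lt1 xy.
have Dp : disc 1 ((x, y) : T * T) by rewrite /disc /= expr1n.
have d0 := pker_den_gt0 t Dp.
(* The defining equation in product form; its real and imaginary parts determine the real part of
   [pkmap] times the squared distance, which is [e3] below. *)
have e : pkmap t (Complex x y) * (Complex x y - rexpi 1 t) = - rexpi 1 t.
  by rewrite /pkmap divfK // subr_eq0 disc_neq_rexpi.
rewrite /weight /cre; move: (pkmap t (Complex x y)) e => P e.
have e1 := congr1 (@complex.Re R) e; have e2 := congr1 (@complex.Im R) e.
move: e1 e2 d0; rewrite /pker !sqr_cmod ReM ImM !ReD !ImD !ReN !ImN.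
rewrite [complex.Re (rexpi 1 t)]mul1r [complex.Im (rexpi 1 t)]mul1r.
move: (complex.Re P) (complex.Im P) => a b /=.
have := cos2Dsin2 t; move: (cos t) (sin t) => c s cs e1 e2 d0.
have d1 : (x - c) ^+ 2 + (y - s) ^+ 2 != 0 by rewrite gt_eqF.
apply: (mulIf d1); rewrite divfK //.
have e3 : a * ((x - c) ^+ 2 + (y - s) ^+ 2) = - c * (x - c) - s * (y - s).
  transitivity ((a * (x - c) - b * (y - s)) * (x - c) + (a * (y - s) + b * (x - c)) * (y - s)); first by ring.
  by rewrite e1 e2; ring.
transitivity (2 * (a * ((x - c) ^+ 2 + (y - s) ^+ 2)) - ((x - c) ^+ 2 + (y - s) ^+ 2)); first by ring.
rewrite e3; transitivity (c ^+ 2 + s ^+ 2 - x ^+ 2 - y ^+ 2); first by ring.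
by rewrite cs; ring.
Qed.

Lemma dC_factor (k h : CC R -> CC R) (lam z : CC R) : hol1 k ->
  (forall z, cmod z < 1 -> h z = (z - lam) * k z) -> cmod z < 1 ->
  cderiv h z (k z + (z - lam) * dC k z).
Proof.
move=> hk hE z1.
have d0 : 0 < 1 - cmod z by rewrite subr_gt0.
have d := cderivM (cderiv_subc z lam) (hol1_cderiv hk z1).
rewrite mulr1 in d; rewrite addrC; apply: (cderiv_ext d0 _ d) => w wz; apply/esym/hE.
by rewrite -[w](subrK z); apply: le_lt_trans (ler_cmodD _ _) _; rewrite -ltrBrDr.
Qed.

(** Here [P], [H], [K] stand for |(z k)'|^2, |h'|^2, |k'|^2. The condition on [r] leaves (1 - q) / 2
    of [K] after absorption, whence the factor [2 / (1 - q)]. *)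
Let absorb_weight (q r C w P H K : R) : q < 1 -> (1 + q) / 2 <= r ^+ 2 -> 0 <= w -> 0 <= K ->
  P <= C * H + q * K ->
  2 / (1 - q) / 4 * (4 * w * (P - r ^+ 2 * K)) <= 2 * C / (1 - q) * H * w - K * w.
Proof.
move=> q1 rq w0 K0 PH; have q0 : 1 - q != 0 by rewrite subr_eq0 gt_eqF.
have c0 : 0 < 2 / (1 - q) by rewrite divr_gt0 // subr_gt0.
have -> : 2 / (1 - q) / 4 * (4 * w * (P - r ^+ 2 * K)) = 2 / (1 - q) * (P - r ^+ 2 * K) * w by field.
rewrite -mulrBl; apply: ler_wpM2r => //.
have -> : 2 * C / (1 - q) * H - K = 2 / (1 - q) * (C * H - (1 - q) / 2 * K) by field.
rewrite ler_pM2l //; have : (1 + q) / 2 * K <= r ^+ 2 * K by exact: ler_wpM2r.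
lra.
Qed.

Lemma weighted_le (k h m : CC R -> CC R) (lam : CC R) (C q del r : R) :
  hol1 k -> hol1 h -> (forall z, cmod z < 1 -> h z = (z - lam) * k z) -> hol1 m ->
  (forall x y, x ^+ 2 + y ^+ 2 < 1 -> 0 <= weight m x y) ->
  0 < del -> C = 1 + del^-1 -> q = (1 + del) * cmod lam ^+ 2 -> 0 <= q < 1 ->
  0 <= r -> r < 1 -> (1 + q) / 2 <= r ^+ 2 ->
  (\int[leb2]_(p in cdisc r) (cmod (dC k (Complex p.1 p.2)) ^+ 2 * weight m p.1 p.2)%:E
   <= \int[leb2]_(p in cdisc r)
      (2 * C / (1 - q) * cmod (dC h (Complex p.1 p.2)) ^+ 2 * weight m p.1 p.2)%:E)%E.
Proof.
move=> hk hh hE hm w0 del0 CE qE /andP[q0 q1] r0 r1 rq.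
have mD := measurable_cdisc r.
have bw := bm_weight hm r0 r1.
have bK := bmM (bm_sqr_cmod (hol1_dC hk) r0 r1) bw.
have bH := bmM (bmM (bm_cst _ (2 * C / (1 - q))) (bm_sqr_cmod (hol1_dC hh) r0 r1)) bw.
have iK := bm_integrable r0 bK; have iH := bm_integrable r0 bH.
have hid : hol1 (fun z : CC R => z - 0) := hol1_subc 0.
have hP := hol1D hk (hol1M hid (hol1_dC hk)).
pose G x y : R := 4 * weight m x y *
  (cmod (k (Complex x y) + Complex x y * dC k (Complex x y)) ^+ 2
   - r ^+ 2 * cmod (dC k (Complex x y)) ^+ 2).
have bG : bm (cdisc r) G.
  have := bmM (bmM (bm_cst _ 4) bw) (bmB (bm_sqr_cmod hP r0 r1)
    (bmM (bm_cst _ (r ^+ 2)) (bm_sqr_cmod (hol1_dC hk) r0 r1))).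
  congr (bm _ _); apply/funext => x; apply/funext => y.
  by rewrite /G subr0.
have c0 : 0 < 2 / (1 - q) by rewrite divr_gt0 // subr_gt0.
have iG := bm_integrable r0 (bmM (bm_cst _ (2 / (1 - q) / 4)) bG).
have G0 : (0 <= \int[leb2]_(p in cdisc r) (2 / (1 - q) / 4 * G p.1 p.2)%:E)%E.
  under eq_integral do rewrite EFinM.
  rewrite (integralZl mD (bm_integrable r0 bG)) mule_ge0 //.
    by rewrite lee_fin divr_ge0 // ltW.
  exact: (green_hol hk hm r0 r1 w0).
(* All integrands are bounded on the closed disc of radius [r < 1], so the left integral is finite
   and may be subtracted. *)
rewrite -sube_ge0; last by rewrite (integrable_fin_num mD iK).
rewrite -(integralB_EFin mD iH iK); apply: le_trans G0 _.
apply: (le_integral mD iG (bm_integrable r0 (bmB bH bK))) => p /set_mem Dp.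
rewrite lee_fin; set z : CC R := Complex p.1 p.2.
have z1 : cmod z < 1 by move/(cdiscP _ r0): Dp => /le_lt_trans; apply.
have w1 : 0 <= weight m p.1 p.2.
  by apply: w0; apply: le_lt_trans Dp _; rewrite exprn_ilt1.
have hd : dC h z = k z + (z - lam) * dC k z by exact: cderiv_derive (dC_factor hk hE z1).
have P0 := cmod_sqr_split (dC h z) (lam * dC k z) del0.
(* Adding [lam * dC k z] turns h' into (z k)', which is the function in Green's inequality. *)
have PE : dC h z + lam * dC k z = k z + z * dC k z.
  by rewrite hd -addrA -mulrDl subrK.
rewrite PE cmodM exprMn [(1 + del) * (_ * _)]mulrA in P0; rewrite -qE -CE in P0; exact: (absorb_weight q1 rq w1 (sqr_ge0 _) P0).
Qed.
End WeightedDirichlet.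

(** * The Dirichlet integral in the divided variable *)

Section DirichletOne.
Context {R : realType}.
Local Notation T := (measurableTypeR R).
Context (mu : {measure set R -> \bar R}) (hmu : measure_on_T mu).
Let I := `[0%R, (pi *+ 2 : R)%R[%classic.

Lemma cdisc_disc (r s : R) : 0 <= r -> r < s -> cdisc r `<=` disc s.
Proof.
move=> r0 rs p /(cdiscP _ r0) h; apply/(discP _ (le_trans r0 (ltW rs))).
exact: le_lt_trans rs.
Qed.

(** Tonelli's theorem moves the boundary measure outside, so that inequalities can be proved for
    each kernel [pker p t] separately. *)
Lemma integral_poissonE (r : R) (F : R -> R -> R) : 0 <= r -> r < 1 -> bm (cdisc r) F ->
  (forall x y, 0 <= F x y) ->
  (\int[leb2]_(p in cdisc r) ((F p.1 p.2)%:E * poisson mu (Complex p.1 p.2)) =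
   \int[fmu hmu.1]_(t in I) \int[leb2]_(p in cdisc r) (F p.1 p.2 * pker p t)%:E)%E.
Proof.
move=> r0 r1 [mF _] F0; have mD := measurable_cdisc r.
have mI : measurable (I : set R) by exact: measurable_itv.
have sub := cdisc_disc r0 r1.
have mk : measurable_fun (cdisc r `*` (I : set R)) (fun x => pker x.1 x.2).
  apply: measurable_funS measurable_pker; first by apply: measurableX => //; exact: measurable_disc.
  by move=> [p t] [/= Dp _]; split => //; exact: sub.
have mf : measurable_fun (cdisc r `*` (I : set R)) (fun x => (F x.1.1 x.1.2 * pker x.1 x.2)%:E).
  apply/measurable_EFinP; apply: measurable_funM => //.
  move=> _ Y mY; rewrite (_ : _ `&` _ = (cdisc r `&` (fun p : T * T => F p.1 p.2) @^-1` Y) `*` I).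
    by apply: measurableX => //; exact: mF.
  by apply/seteqP; split => [[p s] [[/= ? ?] ?]|[p s] [[/= ? ?] ?]].
have f0 (p : T * T) (t : R) : cdisc r p -> I t -> (0 <= (F p.1 p.2 * pker p t)%:E)%E.
  by move=> Dp _; rewrite lee_fin mulr_ge0 // pker_ge0 //; exact: sub.
rewrite -(tonelli_on leb2 (fmu hmu.1) mD mI mf f0).
apply: eq_integral => p /set_mem Dp; rewrite poissonE.
rewrite -ge0_integralZl ?lee_fin //.
  apply/measurable_EFinP.
  apply: (@measurable_comp _ _ _ _ _ _ (cdisc r `*` (I : set R)) (fun x => pker x.1 x.2) I (fun t => (p, t))) => //.
  - exact: measurableX.
  - by move=> _ [t It <-].
  - by apply: measurable_funTS; exact: pair1_measurable.
by move=> t _; rewrite lee_fin pker_ge0 //; exact: sub.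
Qed.

Lemma ge0_integral_subset (A B : set (T * T)) (f : T * T -> \bar R) :
  (forall p, B p -> (0 <= f p)%E) -> A `<=` B ->
  (\int[leb2]_(p in A) f p <= \int[leb2]_(p in B) f p)%E.
Proof.
move=> f0 AB; rewrite integral_mkcond [leRHS]integral_mkcond.
apply: ge0_le_integral_any => p _; rewrite !patchE.
  by case: ifPn => // /set_mem /AB; exact: f0.
case: ifPn => [/set_mem pA|_]; first by rewrite mem_set //; exact: AB.
by case: ifPn => // /set_mem; exact: f0.
Qed.

(** The comparison [weighted_le] is integrated over boundary points. Enlarging the right side to the
    whole disc makes the bound independent of [r], in view of the passage to the limit. *)
Lemma hol1_le_disc (k h : CC R -> CC R) (lam : CC R) (C q del r : R) :
  hol1 k -> hol1 h -> (forall z, cmod z < 1 -> h z = (z - lam) * k z) ->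
  0 < del -> C = 1 + del^-1 -> q = (1 + del) * cmod lam ^+ 2 -> 0 <= q < 1 ->
  0 <= r -> r < 1 -> (1 + q) / 2 <= r ^+ 2 ->
  (\int[leb2]_(p in cdisc r) ((cmod (dC k (Complex p.1 p.2)) ^+ 2)%:E * poisson mu (Complex p.1 p.2))
   <= (2 * C / (1 - q))%:E * \int[leb2]_(p in disc 1)
        ((cmod (dC h (Complex p.1 p.2)) ^+ 2)%:E * poisson mu (Complex p.1 p.2)))%E.
Proof.
move=> hk hh hE del0 CE qE q01 r0 r1 rq; have [_ q1] := andP q01.
have sub := cdisc_disc r0 r1.
have c0 : 0 < 2 * C / (1 - q).
  by rewrite divr_gt0 ?subr_gt0 // mulr_gt0 // CE addr_gt0 // invr_gt0.
have bK := bm_sqr_cmod (hol1_dC hk) r0 r1.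
have bH := bmM (bm_cst _ (2 * C / (1 - q))) (bm_sqr_cmod (hol1_dC hh) r0 r1).
have K0 x y : 0 <= cmod (dC k (Complex x y)) ^+ 2 by exact: sqr_ge0.
have H0 x y : 0 <= 2 * C / (1 - q) * cmod (dC h (Complex x y)) ^+ 2.
  by rewrite mulr_ge0 ?sqr_ge0 // ltW.
rewrite (integral_poissonE r0 r1 bK K0).
apply: (@le_trans _ _ (\int[fmu hmu.1]_(t in I) \int[leb2]_(p in cdisc r)
   (2 * C / (1 - q) * cmod (dC h (Complex p.1 p.2)) ^+ 2 * pker p t)%:E)%E).
  apply: ge0_le_integral_any => t _.
    apply: integral_ge0 => p Dp; rewrite lee_fin mulr_ge0 ?sqr_ge0 // pker_ge0 //.
    exact: sub.
  have w0 x y : x ^+ 2 + y ^+ 2 < 1 -> 0 <= weight (pkmap t) x y.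
    by move=> xy; rewrite weight_pkmap // pker_ge0 // /disc /= expr1n.
  have := weighted_le hk hh hE (hol1_pkmap t) w0 del0 CE qE q01 r0 r1 rq.
  have wE (p : T * T) : cdisc r p -> weight (pkmap t) p.1 p.2 = pker p t.
    by move=> /sub; rewrite /disc /= expr1n => /(weight_pkmap t); case: p.
  congr (_ <= _)%E; apply: eq_integral => p /set_mem Dp; rewrite wE //.
rewrite -(integral_poissonE r0 r1 bH H0).
apply: (@le_trans _ _ (\int[leb2]_(p in disc 1) ((2 * C / (1 - q))%:E *
   ((cmod (dC h (Complex p.1 p.2)) ^+ 2)%:E * poisson mu (Complex p.1 p.2))))%E).
  under eq_integral do rewrite EFinM -muleA.
  apply: ge0_integral_subset sub => p /(discP _ ler01) p1.
  by rewrite mule_ge0 ?lee_fin ?(ltW c0) // mule_ge0 ?lee_fin ?sqr_ge0 ?poisson_ge0.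
apply: ge0_integralZ_le c0 _ => p /(discP _ ler01) p1.
by rewrite mule_ge0 ?lee_fin ?sqr_ge0 ?poisson_ge0.
Qed.

Let areaD_le_integral (u v : CC R -> \bar R) (c : R) :
  (\int[leb2]_(p in disc 1) u (Complex p.1 p.2) <=
   c%:E * \int[leb2]_(p in disc 1) v (Complex p.1 p.2))%E -> (areaD u <= c%:E * areaD v)%E.
Proof.
move=> h; rewrite !areaDE muleCA; apply: lee_wpmul2l h.
by rewrite lee_fin invr_ge0 pi_ge0.
Qed.

(** The constant is chosen before [k] and [h], so one constant serves all slices [z.2 = rexpi r t]
    of a function of two variables. *)
Lemma areaD_division (lam : CC R) : cmod lam < 1 -> exists2 c : R, 0 < c &
  forall k h : CC R -> CC R, hol1 k -> hol1 h ->
  (forall z, cmod z < 1 -> h z = (z - lam) * k z) ->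
  (areaD (fun z => (cmod (dC k z) ^+ 2)%:E * poisson mu z) <=
   c%:E * areaD (fun z => (cmod (dC h z) ^+ 2)%:E * poisson mu z))%E.
Proof.
move=> l1; have l01 : 0 <= cmod lam < 1 by rewrite cmod_ge0.
have [C [q [del [del0 CE qE q01]]]] := square_split l01; have [q0 q1] := andP q01.
exists (2 * C / (1 - q)) => [|k h hk hh hE].
  by rewrite divr_gt0 ?subr_gt0 // mulr_gt0 // CE addr_gt0 // invr_gt0.
apply: areaD_le_integral.
(* The smallest radius that [hol1_le_disc] accepts. *)
pose r0 := Num.sqrt ((1 + q) / 2).
have r02 : r0 ^+ 2 = (1 + q) / 2 by rewrite sqr_sqrtr //; lra.
have r0p : 0 <= r0 by exact: sqrtr_ge0.
have r01 : r0 < 1.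
  by rewrite -(ltr_pXn2r (n := 2)) ?nnegrE ?ler01 // expr1n r02; lra.
(* Radii that start at [r0] and increase to 1: the closed discs exhaust the open unit disc, and
   monotone convergence gives the integral over it. *)
pose s n : R := 1 - (1 - r0) / 2 ^+ n.
have d0 n : 0 < (1 - r0) / 2 ^+ n by rewrite divr_gt0 ?subr_gt0 // exprn_gt0.
have s1 n : s n < 1 by rewrite gtrBl.
have r0s n : r0 <= s n.
  rewrite /s lerBrDl -lerBrDr ler_pdivrMr ?exprn_gt0 // ler_peMr ?subr_ge0 ?(ltW r01) //.
  by rewrite exprn_ege1 // ler1n.
have s0 n : 0 <= s n by exact: le_trans (r0s n).
have sq n : (1 + q) / 2 <= s n ^+ 2 by rewrite -r02 ler_pXn2r ?nnegrE.
have mono : {homo (fun n => cdisc (s n)) : n m / (n <= m)%N >-> (n <= m)%O}.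
  move=> n m nm; apply/subsetPset => p; rewrite /cdisc /= => /le_trans; apply.
  rewrite ler_pXn2r ?nnegrE // /s lerD2l lerN2 ler_pM2l ?subr_gt0 //.
  by rewrite lef_pV2 ?posrE ?exprn_gt0 // ler_weXn2l // ler1n.
have DE : disc 1 = \bigcup_n cdisc (s n).
  apply/seteqP; split => [p /(discP _ ler01)|p [n _]]; last exact: cdisc_disc.
  rewrite -subr_gt0 => /(half_pow_small (1 - r0))[n hn]; exists n => //.
  by apply/(cdiscP _ (s0 n)); rewrite /s lerBrDl -lerBrDr ltW.
rewrite DE; apply: cvge_le (ge0_nondecreasing_set_cvg_integral mono _ _ _).
- by near=> n; rewrite -DE; exact: hol1_le_disc hE del0 CE qE q01 (s0 n) (s1 n) (sq n).
- by move=> n; exact: measurable_cdisc.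
- move=> n; apply: emeasurable_funM.
    by apply/measurable_EFinP; exact: (bm_sqr_cmod (hol1_dC hk) (s0 n) (s1 n)).1.
  apply: measurable_funS (measurable_poisson hmu); first exact: measurable_disc.
  exact: cdisc_disc.
- move=> n p /(cdisc_disc (s0 n) (s1 n)) /(discP _ ler01) p1.
  by rewrite mule_ge0 ?lee_fin ?sqr_ge0 ?poisson_ge0.
Unshelve. all: by end_near.
Qed.

Lemma dir1_ge0 F r : (0 <= dir1 mu F r)%E.
Proof. exact: (dir2_ge0 mu (swapf F) r). Qed.

Lemma dir1_divf_bounded (lam : CC R) (f : CC R * CC R -> CC R) : cmod lam < 1 ->
  (forall z, inD2 z -> z.1 = lam -> f z = 0) -> holomorphic2 f ->
  (ereal_sup [set dir1 mu f r | r in `]0%R, 1%R[%classic] < +oo)%E ->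
  (ereal_sup [set dir1 mu (divf lam f) r | r in `]0%R, 1%R[%classic] < +oo)%E.
Proof.
move=> l1 f0 hf Soo'; have hg := holomorphic2_divf f0 l1 hf.
have [c c0 hc] := areaD_division l1.
pose S := ereal_sup [set dir1 mu f r | r in `]0%R, 1%R[%classic].
have Soo : (S < +oo)%E := Soo'.
have dS r : 0 < r < 1 -> (dir1 mu f r <= S)%E.
  by move=> r01; apply: ereal_sup_ubound; exists r => //; rewrite /= in_itv.
apply: (@le_lt_trans _ _ (c%:E * S)%E).
  apply: ge_ereal_sup => _ [r + <-]; rewrite /= in_itv /= => r01.
  apply: (@le_trans _ _ (c%:E * dir1 mu f r)%E); last first.
    by apply: lee_wpmul2l; [rewrite lee_fin ltW|exact: dS].
  have sp (a : R) x : cmod x < 1 -> (0 <= (a ^+ 2)%:E * poisson mu x)%E by exact: sqr_poisson_ge0.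
  apply: (circT_le c0) => [t|t|t].
  - by apply: areaD_ge0 => x; exact: sp.
  - by apply: areaD_ge0 => x; exact: sp.
  have [rp r1] := andP r01.
  have w1 : cmod (rexpi r t) < 1 by rewrite cmod_rexpi // ltW.
  apply: (hc (fun x => divf lam f (x, rexpi r t)) (fun x => f (x, rexpi r t))).
  - exact: (hol_sections hg w1).1.
  - exact: (hol_sections hf w1).1.
  - by move=> z z1; exact: (divfE f0 (z := (z, rexpi r t))).
have S0 : (0 <= S)%E by apply: le_trans (dir1_ge0 f 2^-1) (dS _ _); rewrite invr_gt0 invf_lt1 // ltr1n andbT.
by rewrite lte_mul_pinfty // ?lee_fin ?(ltW c0).
Qed.
End DirichletOne.

(** * Membership in the Dirichlet-type space and the symmetry of the variables *)

Section DirichletTypeSpace.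
Context {R : realType}.
Implicit Types (f : CC R * CC R -> CC R) (lam : CC R) (mu : {measure set R -> \bar R}).

Lemma hardy2_swap f : hardy2 f -> hardy2 (swapf f).
Proof.
move=> [a [sa fE]]; exists (fun m n => a n m); split.
  rewrite (reindex_esum [set: nat * nat] [set: nat * nat] (fun p : nat * nat => (p.2, p.1))) in sa.
    exact: sa.
  by split => [//|[m n] [m' n'] _ _ [-> ->]//|[m n] _]; exists (n, m).
move=> z [z1 z2].
have E N : \sum_(m < N) \sum_(n < N) a n m * z.1 ^+ m * z.2 ^+ n =
    \sum_(m < N) \sum_(n < N) a m n * z.2 ^+ m * z.1 ^+ n.
  by rewrite exchange_big; apply: eq_bigr => m _; apply: eq_bigr => n _; rewrite mulrAC.
have h : (fun N : nat => \sum_(m < N) \sum_(n < N) a n m * z.1 ^+ m * z.2 ^+ n) @ \oo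
    --> f (z.2, z.1) by rewrite (funext E); exact: (fE (z.2, z.1) (conj z2 z1)).
exact: h.
Qed.

Lemma in_Dspace_swap mu1 mu2 f : in_Dspace mu1 mu2 f -> in_Dspace mu2 mu1 (swapf f).
Proof.
move=> [hf hH hD]; split; first exact: holomorphic2_swap.
  by move=> h; apply: hardy2_swap; apply: hH; tauto.
have e1 : dir1 mu2 (swapf f) = dir2 mu2 f := erefl.
have e2 : dir2 mu1 (swapf f) = dir1 mu1 f := erefl.
by rewrite /Dint e1 e2 addeC.
Qed.

Lemma in_Dspace_divf mu1 mu2 lam f : measure_on_T mu1 -> measure_on_T mu2 ->
  cmod lam < 1 -> (forall z, inD2 z -> z.1 = lam -> f z = 0) ->
  in_Dspace mu1 mu2 f -> in_Dspace mu1 mu2 (divf lam f).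
Proof.
move=> hmu1 hmu2 l1 f0 [hf hH hD]; split; first exact: holomorphic2_divf.
  by move=> /hH; exact: hardy2_divf.
(* A sample radius: each supremum dominates a nonnegative value, so finiteness of the sum passes to
   both summands. *)
have half : (2^-1 : R) \in `]0, 1[ by rewrite in_itv /= invr_gt0 invf_lt1 // ltr1n andbT.
have s1 : (0 <= ereal_sup [set dir1 mu1 f r | r in `]0%R, 1%R[%classic])%E.
  by apply: le_trans (dir1_ge0 mu1 f 2^-1) _; apply: ereal_sup_ubound; exists 2^-1.
have s2 : (0 <= ereal_sup [set dir2 mu2 f r | r in `]0%R, 1%R[%classic])%E.
  by apply: le_trans (dir2_ge0 mu2 f 2^-1) _; apply: ereal_sup_ubound; exists 2^-1.
apply: lte_add_pinfty.
  exact: (dir1_divf_bounded hmu1 l1 f0 hf (le_lt_trans (leeDl _ s2) hD)).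
exact: (dir2_divf_bounded hmu2 l1 f0 hf (le_lt_trans (leeDr _ s1) hD)).
Qed.
End DirichletTypeSpace.

Theorem theorem2p2 (R : realType) (mu1 mu2 : {measure set R -> \bar R}) :
  measure_on_T mu1 -> measure_on_T mu2 ->
  forall (j : 'I_2) (lam : CC R * CC R) (f : CC R * CC R -> CC R),
    inD2 lam -> in_Dspace mu1 mu2 f ->
    (forall z, inD2 z -> zcoord j z = zcoord j lam -> f z = 0) ->
    exists g : CC R * CC R -> CC R,
      (forall z, inD2 z -> f z = (zcoord j z - zcoord j lam) * g z) /\
      in_Dspace mu1 mu2 g.
Proof.
move=> hmu1 hmu2 j lam f [l1 l2] hf; rewrite /zcoord; case: (val j == 0%N) => f0.
  by exists (divf lam.1 f); split; [exact: divfE|exact: in_Dspace_divf].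
(* Division in the second variable is [divf] conjugated by the swap of coordinates, which exchanges
   the two measures as well. *)
have f0' z : inD2 z -> z.1 = lam.2 -> swapf f z = 0.
  by move=> [z1 z2] e; apply: f0.
exists (swapf (divf lam.2 (swapf f))); split.
  by case=> u v [u1 v1]; exact: (divfE f0' (z := (v, u))).
exact: in_Dspace_swap (in_Dspace_divf hmu2 hmu1 l2 f0' (in_Dspace_swap hf)).
Qed.
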